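(* Let $k\ge0$ be an integer or half-integer, let $\mu$ be a vanishing $k$-FC measure, and let $\alpha,\beta\in\mathbb{Z}_+$ with $\alpha+\beta=2k$. Then the operator in $\mathcal{F}^2(\mathbb{C})$ defined by the sesquilinear form $$F(f,g)=\int_{\mathbb{C}}f^{(\alpha)}(z)\,\overline{g^{(\beta)}(z)}\,e^{-|z|^2}\,d\mu(z),\qquad f,g\in\mathcal{F}^2(\mathbb{C}),$$ is compact.
   Context: $\mathcal{F}^2(\mathbb{C})$ is the Fock space of entire functions $f$ with $\|f\|_{\mathcal{F}^2}^2=\int_{\mathbb{C}}|f(z)|^2\,d\nu(z)<\infty$, where $d\nu(z)=\pi^{-1}e^{-|z|^2}dV(z)$ and $dV$ is Lebesgue measure on $\mathbb{C}=\mathbb{R}^2$. $\mathbb{Z}_+=\{0,1,2,\dots\}$. Its reproducing kernel is $\mathbf{k}_z(w)=e^{w\overline z}$. Measures are complex-valued Borel measures on $\mathbb{C}$ that are locally finite (possibly of infinite total variation); $|\mu|$ is the variation of $\mu$. $B(z,r)$ is the disk of radius $r$ centered at $z$, and $r$ is fixed, $r=\sqrt2$. A measure $\mu$ is called a vanishing $k$-FC measure if $$\lim_{|z|\to\infty}|\mu|(B(z,r))\,(1+|z|^2)^k=0.$$ The operator defined by a bounded sesquilinear form $F$ on $\mathcal{F}^2(\mathbb{C})$ is the bounded operator $T_F$ with $(T_Ff)(z)=F(f,\mathbf{k}_z)$, equivalently $\langle T_Ff,g\rangle=F(f,g)$ for all $f,g\in\mathcal{F}^2(\mathbb{C})$.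 *)

(* Defs.v *)
From HB Require Import structures.
From mathcomp Require Import all_boot all_order all_algebra.
From mathcomp Require Import all_classical all_reals all_analysis.
From mathcomp Require Import complex.

Set Implicit Arguments.
Unset Strict Implicit.
Unset Printing Implicit Defensive.

Import Order.TTheory GRing.Theory Num.Theory.
Import numFieldNormedType.Exports.

Local Open Scope classical_set_scope.
Local Open Scope ring_scope.
Local Open Scope complex_scope.

(* The complex numbers are [R[i]]; as a normed space they are [R[i]^o], whose
   norm is [R[i]]-valued.  The real-valued modulus is [Normc.normc].  As a
   measurable space they are identified with R^2 (product of the Borel
   sigma-algebras) through [toC]. *)
Notation plane R := (measurableTypeR R * measurableTypeR R)%type.
Notation cabs := Normc.normc.

Definition toC (R : realType) (p : plane R) : R[i] := p.1 +i* p.2.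

Definition disk (R : realType) (z : R[i]) (r : R) : set (plane R) :=
  [set p | cabs (toC p - z) < r].

Definition bounded_borel (R : realType) (A : set (plane R)) : Prop :=
  measurable A /\ exists M : R, A `<=` disk 0 M.

Section ComplexMeasure.
Context (R : realType).
Implicit Types (nu : set (plane R) -> R) (m : set (plane R) -> R[i]).

(* The variation of [m]: supremum over countable Borel partitions of [E].  The
   pieces are taken bounded, since [m] is only meaningful on bounded sets. *)
Definition cvariation m (E : set (plane R)) : \bar R :=
  ereal_sup [set (\sum_(0 <= i <oo) (cabs (m (A i)))%:E)%E |
    A in [set A : (set (plane R))^nat |
      [/\ forall i, bounded_borel (A i), trivIset setT A &
          \bigcup_i A i = E]]].

(* A locally finite complex Borel measure of possibly infinite total variation
   has complex values only on bounded sets: values at other sets are junk and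
   are never used below. *)
Record complex_measure := ComplexMeasure {
  cm_fun :> set (plane R) -> R[i] ;
  cm_sigma_additive : forall A : (set (plane R))^nat,
    (forall i, measurable (A i)) -> trivIset setT A ->
    bounded_borel (\bigcup_i A i) ->
    ((fun n => \sum_(0 <= i < n) cm_fun (A i)) : nat -> R[i]^o) @ \oo
      --> (cm_fun (\bigcup_i A i) : R[i]^o) ;
  cm_locally_finite : forall M : R, (cvariation cm_fun (disk 0%R M) < +oo)%E }.

(* Upper variation: the positive Jordan part of a real set function. *)
Definition upper_variation nu (E : set (plane R)) : \bar R :=
  ereal_sup [set (nu B)%:E | B in [set B | bounded_borel B /\ B `<=` E]].

Definition local_sigma_additive nu : Prop :=
  forall A : (set (plane R))^nat,
    (forall i, measurable (A i)) -> trivIset setT A ->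
    bounded_borel (\bigcup_i A i) ->
    (fun n => \sum_(0 <= i < n) nu (A i)) @ \oo --> nu (\bigcup_i A i).

Lemma bounded_borel0 : bounded_borel (set0 : set (plane R)).
Proof. by split=> //; exists 0. Qed.

Lemma bounded_borelS (A B : set (plane R)) :
  bounded_borel A -> measurable B -> B `<=` A -> bounded_borel B.
Proof.
by move=> [_ [M AM]] mB BA; split=> //; exists M; exact: subset_trans AM.
Qed.

Lemma disk_le (M N : R) : M <= N -> disk 0 M `<=` disk 0 N.
Proof. by move=> MN p /= /lt_le_trans; exact. Qed.

Lemma bounded_borelU (A B : set (plane R)) :
  bounded_borel A -> bounded_borel B -> bounded_borel (A `|` B).
Proof.
move=> [mA [M AM]] [mB [N BN]]; split; first exact: measurableU.
exists (Num.max M N) => p [/AM|/BN]; apply: disk_le; rewrite le_max lexx//.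
by rewrite orbT.
Qed.

Section upper_variation.
Variables (nu : set (plane R) -> R) (nu_add : local_sigma_additive nu).

Lemma lsa0 : nu set0 = 0.
Proof.
have := @nu_add (fun=> set0) (fun=> measurable0) (@trivIset_set0 _ _ _).
rewrite bigcup0//; move=> /(_ bounded_borel0) h.
have h2 : (fun n => \sum_(0 <= i < n.+1) nu set0) @ \oo --> nu set0.
  by rewrite (cvg_shiftS (fun n => \sum_(0 <= i < n) nu set0)).
have h3 := cvgB h2 h.
rewrite subrr in h3.
have E : (fun n => \sum_(0 <= i < n.+1) nu set0 - \sum_(0 <= i < n) nu set0)
    = fun=> nu set0.
  by apply/funext => n; rewrite big_nat_recr//= addrAC subrr add0r.
have h4 : (fun=> nu set0 : R) @ \oo --> (0 : R) by rewrite -E; exact: h3.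
by rewrite -(cvg_lim (@Rhausdorff R) h4) lim_cst.
Qed.

Lemma lsaU (A B : set (plane R)) : bounded_borel A -> bounded_borel B ->
  A `&` B = set0 -> nu (A `|` B) = nu A + nu B.
Proof.
move=> bA bB AB0; have := @nu_add (bigcup2 A B).
rewrite bigcup2E -trivIset_bigcup2 => h.
have {}h := h _ AB0 (bounded_borelU bA bB).
have : forall i, measurable (bigcup2 A B i).
  by case=> [|[|i]] /=; [case: bA|case: bB|].
move=> /h c; rewrite -(cvg_lim (@Rhausdorff R) c).
apply: (cvg_lim (@Rhausdorff R)).
apply: cvg_near_cst; near=> n.
have n2 : (2 <= n)%N by near: n; exact: nbhs_infty_ge.
rewrite (big_cat_nat (leq0n 2) n2)//= !big_nat_recr//= big_nil add0r.
rewrite big_nat big1 ?addr0//.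
by case=> [|[|i]] //= _; exact: lsa0.
Unshelve. all: by end_near. Qed.

Local Notation V := (upper_variation nu).
Local Open Scope ereal_scope.

Lemma upper_variation_ub (B E : set (plane R)) :
  bounded_borel B -> B `<=` E -> (nu B)%:E <= V E.
Proof. by move=> bB BE; apply: ereal_sup_ubound; exists B. Qed.

Lemma upper_variation_ge0 E : 0 <= V E.
Proof.
by have := upper_variation_ub bounded_borel0 (@sub0set _ E); rewrite lsa0.
Qed.

Lemma upper_variation0 : V set0 = 0.
Proof.
apply/eqP; rewrite eq_le upper_variation_ge0 andbT.
apply/ereal_supP => _ [B [_ B0] <-]; move: B0.
by rewrite subset0 => ->; rewrite lsa0.
Qed.

Lemma le_upper_variation E F : E `<=` F -> V E <= V F.
Proof.
move=> EF; apply/ereal_supP => _ [B [bB BE] <-].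
by apply: upper_variation_ub => //; exact: subset_trans EF.
Qed.

Lemma upper_variation_superU E F : E `&` F = set0 -> V E + V F <= V (E `|` F).
Proof.
move=> EF0.
have VE := @le_upper_variation E (E `|` F) (@subsetUl _ _ _).
have VF := @le_upper_variation F (E `|` F) (@subsetUr _ _ _).
have [->|VU] := eqVneq (V (E `|` F)) +oo; first by rewrite leey.
have VUfin : V (E `|` F) \is a fin_num.
  by rewrite ge0_fin_numE ?ltey// upper_variation_ge0.
have VFfin : V F \is a fin_num.
  rewrite ge0_fin_numE ?upper_variation_ge0// (le_lt_trans VF)//.
  by rewrite ltey.
rewrite -leeBrDr//; apply/ereal_supP => _ [A [bA AE] <-].
rewrite leeBrDr// addeC -leeBrDr//; apply/ereal_supP => _ [B [bB BF] <-].
rewrite leeBrDr// addeC -EFinD -lsaU//.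
  by apply: upper_variation_ub; [exact: bounded_borelU|exact: setUSS].
by rewrite -subset0 -EF0; exact: setISS.
Qed.

Lemma upper_variation_sigma_additive : semi_sigma_additive V.
Proof.
move=> F mF tF mUF.
have cF : cvgn (fun n => \sum_(0 <= i < n) V (F i)).
  by apply: is_cvg_ereal_nneg_natsum => n _; exact: upper_variation_ge0.
suff -> : V (\bigcup_n F n) = limn (fun n => \sum_(0 <= i < n) V (F i)) by [].
apply/eqP; rewrite eq_le; apply/andP; split.
- apply/ereal_supP => _ [B [bB BF] <-].
  have mBF i : measurable (B `&` F i) by apply: measurableI => //; case: bB.
  have BE : \bigcup_i (B `&` F i) = B.
    by rewrite -setI_bigcupr; exact/setIidPl.
  have := @nu_add (fun i => B `&` F i) mBF
    (@trivIset_setIl _ _ _ F (fun=> B) tF).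
  rewrite BE => /(_ bB) nuB.
  have nuBE : (fun n => (\sum_(0 <= i < n) nu (B `&` F i))%R%:E) @ \oo
      --> (nu B)%:E.
    by apply/fine_cvgP; split=> //; exact: nearW.
  rewrite -(cvg_lim _ nuBE)//; apply: lee_lim => //.
    by apply/cvg_ex; exists (nu B)%:E.
  near=> n; rewrite -sumEFin; apply: lee_sum => i _.
  by apply: upper_variation_ub; [exact: bounded_borelS bB _ _|exact: subIsetr].
- apply: lime_le => //; near=> n.
  apply: (@le_trans _ _ (V (\big[setU/set0]_(0 <= i < n) F i))); last first.
    by apply: le_upper_variation; rewrite big_mkord; exact: bigsetU_bigcup.
  elim: {+}n => [|k ih]; first by rewrite !big_nil upper_variation_ge0.
  rewrite !big_nat_recr//=.
  apply: (@le_trans _ _ (V (\big[setU/set0]_(0 <= i < k) F i) + V (F k))).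
    by rewrite leeD.
  apply: upper_variation_superU; rewrite big_mkord.
  by apply: (@trivIset_bigsetUI _ predT) => // i j _ _; exact: tF.
Unshelve. all: by end_near. Qed.

End upper_variation.

Lemma cvg_cabs (f : nat -> R[i]) (l : R[i]) :
  (f : nat -> R[i]^o) @ \oo --> (l : R[i]^o) ->
  cabs (l - f n) @[n --> \oo] --> (0 : R).
Proof.
move=> fl; apply/cvgrPdist_lt => e e0.
have e0' : 0 < e%:C by rewrite ltcR.
near=> n; rewrite sub0r normrN ger0_norm.
  rewrite -ltcR -[X in X < _]/(`|l - f n|); near: n.
  by move/cvgrPdist_lt : fl => /(_ _ e0').
by case: (l - f n) => *; exact: sqrtr_ge0.
Unshelve. all: by end_near. Qed.

Lemma Re_le_cabs (z : R[i]) : `|complex.Re z| <= cabs z.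
Proof. by rewrite -lecR; exact: normc_ge_Re. Qed.

Lemma Im_le_cabs (z : R[i]) : `|complex.Im z| <= cabs z.
Proof.
by case: z => a b /=; rewrite -sqrtr_sqr ler_wsqrtr// lerDr sqr_ge0.
Qed.

Section parts.
Variable mu : complex_measure.

Lemma local_sigma_additive_comp (h : R[i] -> R) :
  {morph h : x y / x - y} -> (forall z, `|h z| <= cabs z) ->
  local_sigma_additive (fun A => h (mu A)).
Proof.
move=> hB hle A mA tA bA.
have /cvgrPdist_lt H := cvg_cabs (@cm_sigma_additive mu A mA tA bA).
have h0 : h 0 = 0 by rewrite -(subrr 0) hB subrr.
have hD : {morph h : x y / x + y}.
  by move=> x y; rewrite -[in LHS](opprK y) hB -[- y]sub0r hB h0 sub0r opprK.
apply/cvgrPdist_lt => e /H {}H; near=> n.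
rewrite -(big_morph h hD h0) -hB (le_lt_trans (hle _))//.
have : `|0 - cabs (mu (\bigcup_i A i) - \sum_(0 <= i < n) mu (A i))| < e.
  by near: n.
by rewrite sub0r normrN; apply: le_lt_trans; exact: ler_norm.
Unshelve. all: by end_near. Qed.

(* The Jordan parts of the real and imaginary parts of [mu]. *)
Definition re_pos := upper_variation (fun A => complex.Re (mu A)).
Definition re_neg := upper_variation (fun A => - complex.Re (mu A)).
Definition im_pos := upper_variation (fun A => complex.Im (mu A)).
Definition im_neg := upper_variation (fun A => - complex.Im (mu A)).

Let re_pos_add : local_sigma_additive (fun A => complex.Re (mu A)).
Proof. by apply: local_sigma_additive_comp Re_le_cabs => -[? ?] [? ?]. Qed.

Let re_neg_add : local_sigma_additive (fun A => - complex.Re (mu A)).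
Proof.
apply: (local_sigma_additive_comp (h := fun z => - complex.Re z)).
  by move=> [? ?] [? ?] /=; rewrite opprD.
by move=> z; rewrite normrN; exact: Re_le_cabs.
Qed.

Let im_pos_add : local_sigma_additive (fun A => complex.Im (mu A)).
Proof. by apply: local_sigma_additive_comp Im_le_cabs => -[? ?] [? ?]. Qed.

Let im_neg_add : local_sigma_additive (fun A => - complex.Im (mu A)).
Proof.
apply: (local_sigma_additive_comp (h := fun z => - complex.Im z)).
  by move=> [? ?] [? ?] /=; rewrite opprD.
by move=> z; rewrite normrN; exact: Im_le_cabs.
Qed.

HB.instance Definition _ := isMeasure.Build _ _ _ re_pos
  (upper_variation0 re_pos_add) (upper_variation_ge0 re_pos_add)
  (upper_variation_sigma_additive re_pos_add).
HB.instance Definition _ := isMeasure.Build _ _ _ re_neg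
  (upper_variation0 re_neg_add) (upper_variation_ge0 re_neg_add)
  (upper_variation_sigma_additive re_neg_add).
HB.instance Definition _ := isMeasure.Build _ _ _ im_pos
  (upper_variation0 im_pos_add) (upper_variation_ge0 im_pos_add)
  (upper_variation_sigma_additive im_pos_add).
HB.instance Definition _ := isMeasure.Build _ _ _ im_neg
  (upper_variation0 im_neg_add) (upper_variation_ge0 im_neg_add)
  (upper_variation_sigma_additive im_neg_add).

End parts.

Definition cintegrable (m : {measure set (plane R) -> \bar R})
    (h : R[i] -> R[i]) : Prop :=
  m.-integrable setT (fun p => (complex.Re (h (toC p)))%:E) /\
  m.-integrable setT (fun p => (complex.Im (h (toC p)))%:E).

Definition cintegral (m : {measure set (plane R) -> \bar R})
    (h : R[i] -> R[i]) : R[i] :=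
  (\int[m]_p complex.Re (h (toC p))) +i* (\int[m]_p complex.Im (h (toC p))).

(* Since the Jordan parts are mutually singular, this is integrability with
   respect to the variation of [mu]. *)
Definition cm_integrable (mu : complex_measure) (h : R[i] -> R[i]) : Prop :=
  [/\ cintegrable (re_pos mu) h, cintegrable (re_neg mu) h,
      cintegrable (im_pos mu) h & cintegrable (im_neg mu) h].

Definition cm_integral (mu : complex_measure) (h : R[i] -> R[i]) : R[i] :=
  cintegral (re_pos mu) h - cintegral (re_neg mu) h
  + (0 +i* 1) * (cintegral (im_pos mu) h - cintegral (im_neg mu) h).

End ComplexMeasure.

Section FockSpace.
Context (R : realType).
Implicit Types (f g : R[i] -> R[i]).

(* Differentiability over the scalar field [R[i]], i.e. holomorphy. *)
Definition entire f : Prop :=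
  forall z : R[i], derivable (f : R[i]^o -> R[i]^o) z 1.

Definition cderiv (n : nat) f : R[i] -> R[i] :=
  @derive1n R[i] R[i]^o n f.

Definition lebesgue2 : {measure set (plane R) -> \bar R} :=
  (lebesgue_measure \x lebesgue_measure)%E.

Definition gauss (z : R[i]) : R := expR (- cabs z ^+ 2).

Definition fock_norm2 f : \bar R :=
  (\int[lebesgue2]_p (cabs (f (toC p)) ^+ 2 * (pi^-1 * gauss (toC p)))%:E)%E.

Definition fock f : Prop := entire f /\ (fock_norm2 f < +oo)%E.

Definition fock_norm f : R := Num.sqrt (fine (fock_norm2 f)).

Definition fock_inner f g : R[i] :=
  cintegral lebesgue2 (fun z => f z * conjc (g z) * (pi^-1 * gauss z)%:C).

Definition cexp (z : R[i]) : R[i] :=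
  (expR (complex.Re z))%:C * (cos (complex.Im z) +i* sin (complex.Im z)).

Definition fock_kernel (z : R[i]) : R[i] -> R[i] := fun w => cexp (w * conjc z).

Definition bounded_sesquilinear
    (F : (R[i] -> R[i]) -> (R[i] -> R[i]) -> R[i]) : Prop :=
  [/\ forall (a : R[i]) f1 f2 g, fock f1 -> fock f2 -> fock g ->
        F (fun z => a * f1 z + f2 z) g = a * F f1 g + F f2 g,
      forall (a : R[i]) f g1 g2, fock f -> fock g1 -> fock g2 ->
        F f (fun z => a * g1 z + g2 z) = conjc a * F f g1 + F f g2 &
      exists M : R, forall f g, fock f -> fock g ->
        cabs (F f g) <= M * fock_norm f * fock_norm g].

Definition form_operator (F : (R[i] -> R[i]) -> (R[i] -> R[i]) -> R[i]) f :
  R[i] -> R[i] := fun z => F f (fock_kernel z).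

(* Operators on the Fock space are maps on all functions, of which only the
   values on [fock] matter. *)
Definition bounded_operator (T : (R[i] -> R[i]) -> (R[i] -> R[i])) : Prop :=
  [/\ forall f, fock f -> fock (T f),
      forall (a : R[i]) f1 f2, fock f1 -> fock f2 ->
        T (fun z => a * f1 z + f2 z) = (fun z => a * T f1 z + T f2 z) &
      exists M : R, forall f, fock f -> fock_norm (T f) <= M * fock_norm f].

Definition compact_operator (T : (R[i] -> R[i]) -> (R[i] -> R[i])) : Prop :=
  bounded_operator T /\
  forall u : nat -> R[i] -> R[i],
    (forall n, fock (u n)) -> (exists M : R, forall n, fock_norm (u n) <= M) ->
    exists2 phi : nat -> nat, {homo phi : m n / (m < n)%N} &
    exists2 g, fock g &
      fock_norm (fun z => T (u (phi n)) z - g z) @[n --> \oo] --> (0 : R).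

Definition vanishing_FC (mu : complex_measure R) (k : R) : Prop :=
  forall e : R, 0 < e -> exists M : R, forall z : R[i], M < cabs z ->
    (cvariation mu (disk z (Num.sqrt 2)) * ((1 + cabs z ^+ 2) `^ k)%:E < e%:E)%E.

Definition FC_integrand (al be : nat) f g (z : R[i]) : R[i] :=
  cderiv al f z * conjc (cderiv be g z) * (gauss z)%:C.

Definition FC_form (mu : complex_measure R) (al be : nat) f g : R[i] :=
  cm_integral mu (FC_integrand al be f g).

End FockSpace.

(* Main.v *)
(* The mean value property and Cauchy's estimates on disks of radius of order
   1/(1 + |z|) give
     |f^(a)(z)|^2 e^{-|z|^2} <= C (1 + |z|^2)^a \int_{B(z,1)} |f|^2 e^{-|u|^2} dV(u).
   As a + b = 2k, the weights (1 + |z|^2)^(k - a) and (1 + |z|^2)^(k - b) are inverse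
   to each other, so that AM-GM and Tonelli bound |F(f, g)|^2 by J(f) |g|^2, where,
   since mu vanishes at infinity, for each e > 0,
     J(f) <= e |f|^2 + C \int_{|u| < L} |f|^2 e^{-|u|^2} dV(u).
   The coefficients of a bounded sequence converge along an ultrafilter finer than
   the neighbourhoods of infinity, to the coefficients of a Fock function by
   Parseval's identity.  The difference v tends to 0 uniformly on compact sets, hence
   |T_F v|^2 <= J(v) tends to 0 along the ultrafilter.
   Complex analysis is obtained from Goursat's theorem on rectangles applied to
   f(e^z), and the power series of f from the reproducing formula. *)

Require Import Defs.
From HB Require Import structures.
From mathcomp Require Import all_boot all_order all_algebra.
From mathcomp Require Import all_classical all_reals all_analysis.
From mathcomp Require Import complex.
From mathcomp Require Import ring lra measurable_realfun.

Import Order.TTheory GRing.Theory Num.Theory.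
Import numFieldNormedType.Exports.

Set Implicit Arguments.
Unset Strict Implicit.
Unset Printing Implicit Defensive.

Local Open Scope classical_set_scope.
Local Open Scope ring_scope.
Local Open Scope complex_scope.

(** [entire] provides a single complex derivative at each point, and this dictates the order of the
    arguments. The mean value property needs no more than that; the reproducing formula needs only
    the mean value property; and only once Fock functions are power series are their higher
    derivatives known to be entire, as iterated Cauchy estimates require. Composing with [exp] turns
    circles into vertical segments and the puncture at 0 into [Re z -> -oo], so that rectangles are
    the only contours.

    [mu] has values on bounded sets only. It is handled through the four Jordan parts of its real
    and imaginary parts, which are positive measures dominated on disks by the variation. The
    estimates are made for one such measure, keeping a free scale [s] in AM-GM that is optimized
    once for the sum of the four. Since [sqrt 2 >= 1], energies on unit disks suffice.

    The ultrafilter replaces a diagonal extraction: all the coefficients converge at once, and a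
    subsequence is chosen only at the very end, by picking indices in members of the ultrafilter. *)

Local Notation Re := complex.Re.
Local Notation Im := complex.Im.

(** * Moduli and complex derivatives *)

Section Modulus.
Context (R : realType).
Implicit Types (x y z w : R[i]) (r : R).

Lemma cabs_ge0 z : 0 <= cabs z.
Proof. by case: z => a b; exact: sqrtr_ge0. Qed.

Lemma cabsE z : (cabs z)%:C = `|z|.
Proof. by []. Qed.

Lemma cabs0 : cabs (0 : R[i]) = 0.
Proof. exact: Normc.normc0. Qed.

Lemma cabs1 : cabs (1 : R[i]) = 1.
Proof. exact: Normc.normc1. Qed.

Lemma cabsM x y : cabs (x * y) = cabs x * cabs y.
Proof. exact: Normc.normcM. Qed.

Lemma cabsV x : cabs x^-1 = (cabs x)^-1.
Proof. exact: Normc.normcV. Qed.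

Lemma cabsX x n : cabs (x ^+ n) = cabs x ^+ n.
Proof. by elim: n => [|n ih]; rewrite ?expr0 ?cabs1// !exprS cabsM ih. Qed.

Lemma cabsN x : cabs (- x) = cabs x.
Proof. by apply: complexI; rewrite !cabsE normrN. Qed.

Lemma cabs_conj x : cabs (conjc x) = cabs x.
Proof. by case: x => a b /=; rewrite sqrrN. Qed.

Lemma cabsD x y : cabs (x + y) <= cabs x + cabs y.
Proof. by rewrite -lecR rmorphD /= !cabsE ler_normD. Qed.

Lemma cabsB x y : cabs (x - y) <= cabs x + cabs y.
Proof. by rewrite -(cabsN y) cabsD. Qed.

Lemma cabsBC x y : cabs (x - y) = cabs (y - x).
Proof. by rewrite -cabsN opprB. Qed.

Lemma cabs_tri z x y : cabs (x - y) <= cabs (x - z) + cabs (z - y).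
Proof. by rewrite -[x - y](subrKA z) cabsD. Qed.

Lemma cabs_sub x y : cabs x - cabs y <= cabs (x - y).
Proof. by rewrite lerBlDr -{1}(subrK y x) cabsD. Qed.

Lemma cabs_eq0 z : (cabs z == 0) = (z == 0).
Proof.
by apply/eqP/eqP => [/Normc.eq0_normc//|->]; exact: cabs0.
Qed.

Lemma cabs_gt0 z : (0 < cabs z) = (z != 0).
Proof. by rewrite lt_neqAle cabs_ge0 andbT eq_sym cabs_eq0. Qed.

Lemma cabsR r : cabs r%:C = `|r|.
Proof. by rewrite /= expr0n addr0 sqrtr_sqr. Qed.

Lemma cabs_sqr z : cabs z ^+ 2 = Re z ^+ 2 + Im z ^+ 2.
Proof. by case: z => a b /=; rewrite sqr_sqrtr// addr_ge0// sqr_ge0. Qed.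

Lemma cabs_le_ReIm z : cabs z <= `|Re z| + `|Im z|.
Proof.
case: z => a b; rewrite [X in cabs X](_ : _ = a%:C + b%:C * (0 +i* 1)).
  by rewrite (le_trans (cabsD _ _))// cabsM !cabsR /= expr0n expr1n add0r sqrtr1
    mulr1.
by apply/eqP; rewrite eq_complex /= !mulr0 !mul0r subr0 mulr1 !addr0 add0r !eqxx.
Qed.

Lemma cabs_sum (I : Type) (s : seq I) (P : pred I) (F : I -> R[i]) :
  cabs (\sum_(i <- s | P i) F i) <= \sum_(i <- s | P i) cabs (F i).
Proof.
elim/big_rec2: _ => [|i y x _ h]; first by rewrite cabs0.
by rewrite (le_trans (cabsD _ _))// lerD2l.
Qed.

Lemma mulcJ z : z * conjc z = (cabs z ^+ 2)%:C.
Proof.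
by rewrite cabs_sqr; case: z => a b; apply/eqP; rewrite eq_complex /= !expr2;
  apply/andP; split; apply/eqP; ring.
Qed.

Lemma cReD x y : Re (x + y) = Re x + Re y. Proof. by case: x y => a b []. Qed.
Lemma cImD x y : Im (x + y) = Im x + Im y. Proof. by case: x y => a b []. Qed.
Lemma cReN x : Re (- x) = - Re x. Proof. by case: x. Qed.
Lemma cImN x : Im (- x) = - Im x. Proof. by case: x. Qed.
Lemma cReB x y : Re (x - y) = Re x - Re y. Proof. by rewrite cReD cReN. Qed.
Lemma cImB x y : Im (x - y) = Im x - Im y. Proof. by rewrite cImD cImN. Qed.
Lemma cReM x y : Re (x * y) = Re x * Re y - Im x * Im y.
Proof. by case: x y => a b []. Qed.
Lemma cImM x y : Im (x * y) = Re x * Im y + Im x * Re y.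
Proof. by case: x y => a b []. Qed.
Lemma cReJ x : Re (conjc x) = Re x. Proof. by case: x. Qed.
Lemma cImJ x : Im (conjc x) = - Im x. Proof. by case: x. Qed.
Lemma complex_ReIm x y : Re x = Re y -> Im x = Im y -> x = y.
Proof. by case: x y => a b [c d] /= -> ->. Qed.

Lemma cJM x y : conjc (x * y) = conjc x * conjc y.
Proof. exact: (rmorphM (@conjc R)). Qed.
Lemma cJD x y : conjc (x + y) = conjc x + conjc y.
Proof. exact: (rmorphD (@conjc R)). Qed.
Lemma cJK x : conjc (conjc x) = x. Proof. exact: conjcK. Qed.

End Modulus.

(** This form and its converse are kept over any numeric field, so as to serve complex derivatives
    as well as the real functions exp, cos, sin and [s |-> Re (g (s z))]. *)
Lemma is_derive_expansion (K : numFieldType) (f : K^o -> K^o) (x : K^o) (L : K) :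
  is_derive x 1 f L ->
  forall e : K, 0 < e -> exists2 d : K, 0 < d &
    forall h : K, `|h| < d -> `|f (x + h) - f x - L * h| <= e * `|h|.
Proof.
move=> [df fL] e e0.
have : (fun h : K^o => h^-1 *: (f (h *: 1 + x) - f x)) @ 0^' --> (L : K^o).
  by rewrite -fL; exact: df.
move=> /cvgrPdist_le /(_ e e0).
rewrite near_withinE /= => /nbhs_ballP [d /= d0 H].
exists d => // h hd.
have [->|h0] := eqVneq h 0.
  by rewrite addr0 subrr mulr0 subr0 normr0 mulr0.
have := H h; rewrite /ball /= sub0r normrN => /(_ hd h0).
rewrite /GRing.scale /= mulr1 => H1.
have -> : f (x + h) - f x - L * h = (h^-1 * (f (h + x) - f x) - L) * h.
  by rewrite mulrBl mulrAC mulVf// mul1r [h + x]addrC.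
by rewrite normrM ler_wpM2r// distrC.
Qed.

Lemma expansion_is_derive (K : numFieldType) (f : K^o -> K^o) (x : K^o) (L : K) :
  (forall e : K, 0 < e -> exists2 d : K, 0 < d &
    forall h : K, `|h| < d -> `|f (x + h) - f x - L * h| <= e * `|h|) ->
  is_derive x 1 f L.
Proof.
move=> H.
have C : (fun h : K^o => h^-1 *: (f (h *: 1 + x) - f x)) @ 0^' --> (L : K^o).
  apply/cvgrPdist_le => e e0; have [d d0 {}H] := H _ e0.
  rewrite near_withinE /=; apply/nbhs_ballP; exists d => //= h.
  rewrite /ball /= sub0r normrN => hd h0.
  have h0' : 0 < `|h| by rewrite normr_gt0.
  rewrite /GRing.scale /= mulr1.
  rewrite -(ler_pM2r h0') -normrM mulrBl mulrAC mulVf// mul1r.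
  by rewrite distrC [h + x]addrC; exact: H.
by split; [apply/cvg_ex; exists L | exact: cvg_lim].
Qed.

Section ComplexDerivative.
Context (R : realType).
Implicit Types (f g : R[i] -> R[i]) (z w L : R[i]).

(** The tolerances are in [R]: in the partial order of [R[i]] a positive element is a positive real,
    so that nothing is lost, and all estimates can be made with real moduli. *)
Definition cdiff f z L := forall e : R, 0 < e -> exists2 d : R, 0 < d &
  forall h : R[i], cabs h < d ->
    cabs (f (z + h) - f z - L * h) <= e * cabs h.

Definition ccont f := forall z (e : R), 0 < e -> exists2 d : R, 0 < d &
  forall w, cabs (w - z) < d -> cabs (f w - f z) < e.

Lemma is_derive_cdiff f z L :
  is_derive (z : R[i]^o) 1 (f : R[i]^o -> R[i]^o) L -> cdiff f z L.
Proof.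
move=> /is_derive_expansion H e e0.
have [|[d d'] /=] := H e%:C; first by rewrite ltcR.
rewrite ltcE /= => /andP[/eqP -> d0] {}H; exists d => // h hd.
by have := H h; rewrite -cabsE ltcR => /(_ hd); rewrite -!cabsE -rmorphM lecR.
Qed.

Lemma cdiff_is_derive f z L : cdiff f z L ->
  is_derive (z : R[i]^o) 1 (f : R[i]^o -> R[i]^o) L.
Proof.
move=> H; apply: expansion_is_derive => -[e e']; rewrite ltcE /= => /andP[/eqP -> e0].
have [d d0 {}H] := H _ e0; exists d%:C; first by rewrite ltcR.
by move=> h; rewrite -cabsE ltcR => /H; rewrite -!cabsE -lecR rmorphM.
Qed.

Lemma cdiffE f z L : cdiff f z L ->
  derivable (f : R[i]^o -> R[i]^o) z 1 /\
  derive1 (f : R[i]^o -> R[i]^o) z = L.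
Proof. by move=> /cdiff_is_derive [df e]; split; rewrite ?derive1E. Qed.

Lemma entireP f : entire f <-> forall z, cdiff f z (cderiv 1 f z).
Proof.
split=> [h z|h z].
  by apply: is_derive_cdiff; split; [exact: h|rewrite /cderiv derive1n1 derive1E].
by have [] := cdiffE (h z).
Qed.

Lemma cderivE f g : (forall z, cdiff f z (g z)) -> cderiv 1 f = g.
Proof. by move=> h; apply/funext => z; have [] := cdiffE (h z). Qed.

Lemma entireI f g : (forall z, cdiff f z (g z)) -> entire f.
Proof. by move=> h z; have [] := cdiffE (h z). Qed.

Lemma cdiff_cont f z L : cdiff f z L ->
  forall e : R, 0 < e -> exists2 d : R, 0 < d &
  forall w, cabs (w - z) < d -> cabs (f w - f z) < e.
Proof.
move=> /(_ 1 ltr01) [d d0 H] e e0.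
have K0 : 0 < 1 + cabs L by rewrite ltr_pwDl// cabs_ge0.
exists (Num.min d (e / (1 + cabs L))); first by rewrite lt_min d0 divr_gt0.
move=> w; rewrite lt_min ltr_pdivlMr// => /andP[/H].
rewrite subrKC => H1 H2.
rewrite -[f w - f z](subrK (L * (w - z))) (le_lt_trans (cabsD _ _))//.
rewrite (le_lt_trans _ H2)// [leRHS]mulrDr mulr1 cabsM [cabs L * _]mulrC lerD2r.
by rewrite (le_trans H1)// mul1r.
Qed.

Lemma entire_cont f : entire f -> ccont f.
Proof. by move=> /entireP h z; exact: cdiff_cont (h z). Qed.

Lemma cdiff_cst c z : cdiff (fun=> c) z 0.
Proof. by apply: is_derive_cdiff; exact: is_derive_cst. Qed.

Lemma cdiff_id z : cdiff id z 1.
Proof. by apply: is_derive_cdiff; exact: is_derive_id. Qed.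

Lemma cdiffD f g z L M : cdiff f z L -> cdiff g z M ->
  cdiff (fun w => f w + g w) z (L + M).
Proof.
move=> /cdiff_is_derive hf /cdiff_is_derive hg; by apply: is_derive_cdiff.
Qed.

Lemma cdiffM f g z L M : cdiff f z L -> cdiff g z M ->
  cdiff (fun w => f w * g w) z (L * g z + f z * M).
Proof.
move=> /cdiff_is_derive hf /cdiff_is_derive hg; apply: is_derive_cdiff.
apply: (is_derive_eq (@is_deriveM _ _ (f : R[i]^o -> R[i]^o) (g : R[i]^o ->
  R[i]^o) z 1 L M hf hg)).
by rewrite /GRing.scale /= addrC [g z * L]mulrC.
Qed.

Lemma cdiffZ c f z L : cdiff f z L -> cdiff (fun w => c * f w) z (c * L).
Proof. by move=> h; have := cdiffM (cdiff_cst c z) h; rewrite mul0r add0r. Qed.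

Lemma cdiff_comp f g z L M : cdiff g z M -> cdiff f (g z) L ->
  cdiff (fun w => f (g w)) z (L * M).
Proof.
move=> hg hf e e0.
have K0 : 0 < 1 + cabs M by rewrite ltr_pwDl// cabs_ge0.
have L0 : 0 < 1 + cabs L by rewrite ltr_pwDl// cabs_ge0.
(* Each remainder receives half of [e]: the increment of [g] is at most [(1 + |M|) |h|], and the
   remainder of [g] is multiplied by [|L|]. *)
pose e1 := e / 2 / (1 + cabs M).
pose e2 := Num.min 1 (e / 2 / (1 + cabs L)).
have e10 : 0 < e1 by rewrite !divr_gt0.
have e20 : 0 < e2 by rewrite lt_min ltr01 !divr_gt0.
have [d1 d10 H1] := hf _ e10.
have [d2 d20 H2] := hg _ e20.
have [d3 d30 H3] := cdiff_cont hg d10.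
exists (Num.min d2 d3); first by rewrite lt_min d20.
move=> h; rewrite lt_min => /andP[/H2 {}H2 hd3].
have := H3 (z + h); rewrite addrAC subrr add0r => /(_ hd3) /H1.
rewrite subrKC => {}H1.
have -> : f (g (z + h)) - f (g z) - L * M * h =
  (f (g (z + h)) - f (g z) - L * (g (z + h) - g z)) +
  L * (g (z + h) - g z - M * h) by ring.
rewrite (le_trans (cabsD _ _))// cabsM.
have B1 : cabs (g (z + h) - g z) <= (1 + cabs M) * cabs h.
  rewrite -[g (z + h) - g z](subrK (M * h)) (le_trans (cabsD _ _))//.
  by rewrite cabsM mulrDl lerD2r (le_trans H2)// ler_wpM2r ?cabs_ge0// ge_min lexx.
have -> : e * cabs h = e / 2 * cabs h + e / 2 * cabs h by field.
apply: lerD.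
  rewrite (le_trans H1)// /e1 -mulrA; apply: ler_wpM2l.
    by rewrite divr_ge0// ltW.
  by rewrite [X in X <= _]mulrC ler_pdivrMr// mulrC.
apply: (@le_trans _ _ (cabs L * (e / 2 / (1 + cabs L) * cabs h))).
  rewrite ler_wpM2l ?cabs_ge0// (le_trans H2)// ler_wpM2r ?cabs_ge0//.
  by rewrite ge_min lexx orbT.
rewrite mulrA ler_wpM2r ?cabs_ge0// mulrCA; apply: ler_piMr.
  by rewrite divr_ge0// ltW.
by rewrite ler_pdivrMr// mul1r lerDr.
Qed.

Lemma entireM f g : entire f -> entire g -> entire (fun z => f z * g z).
Proof.
move=> /entireP hf /entireP hg.
by apply: entireI => z; exact: cdiffM.
Qed.

Lemma entireD f g : entire f -> entire g -> entire (fun z => f z + g z).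
Proof.
move=> /entireP hf /entireP hg.
by apply: entireI => z; exact: cdiffD.
Qed.

Lemma entire_cst (c : R[i]) : entire (fun=> c).
Proof. exact: (@entireI _ (fun=> 0) (cdiff_cst c)). Qed.

Lemma entire_id : entire (fun z : R[i] => z).
Proof. exact: (@entireI _ (fun=> 1) cdiff_id). Qed.

Lemma entireX n : entire (fun z : R[i] => z ^+ n).
Proof.
elim: n => [|n ih]; last first.
  have -> : (fun z : R[i] => z ^+ n.+1) = (fun z => z * z ^+ n).
    by apply/funext => z; rewrite exprS.
  exact: (entireM entire_id ih).
have -> : (fun z : R[i] => z ^+ 0) = (fun=> 1).
  by apply/funext => z; rewrite expr0.
exact: entire_cst.
Qed.

Lemma entire_comp f g : entire f -> entire g -> entire (fun z => f (g z)).
Proof.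
move=> /entireP hf /entireP hg.
by apply: entireI => z; exact: cdiff_comp.
Qed.

End ComplexDerivative.

Section ComplexExponential.
Context (R : realType).
Implicit Types (z w : R[i]).

Lemma Re_cexp z : Re (cexp z) = expR (Re z) * cos (Im z).
Proof. by rewrite /cexp cReM /= mul0r subr0. Qed.

Lemma Im_cexp z : Im (cexp z) = expR (Re z) * sin (Im z).
Proof. by rewrite /cexp cImM /= mul0r addr0. Qed.

Lemma cexp0 : cexp (0 : R[i]) = 1.
Proof.
by apply: complex_ReIm; rewrite ?Re_cexp ?Im_cexp /= expR0 ?cos0 ?sin0 mul1r.
Qed.

Lemma cexpD z w : cexp (z + w) = cexp z * cexp w.
Proof.
apply: complex_ReIm.
  by rewrite [RHS]cReM !(Re_cexp, Im_cexp) cReD cImD expRD cosD; ring.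
by rewrite [RHS]cImM !(Re_cexp, Im_cexp) cReD cImD expRD sinD; ring.
Qed.

Lemma cabs_cexp z : cabs (cexp z) = expR (Re z).
Proof.
rewrite cabsM cabsR (ger0_norm (expR_ge0 _)) /= cos2Dsin2 sqrtr1 mulr1//.
Qed.

Lemma cexpN z : cexp (- z) = (cexp z)^-1.
Proof.
have z0 : cexp z != 0 by rewrite -cabs_gt0 cabs_cexp expR_gt0.
by apply: (mulIf z0); rewrite -cexpD addNr cexp0 mulVf.
Qed.

Lemma cexp_2pi z : cexp (z + (0 +i* (2 * pi))) = cexp z.
Proof.
apply: complex_ReIm; rewrite !(Re_cexp, Im_cexp) cReD cImD /= addr0.
  by rewrite mulr_natl cosD2pi.
by rewrite mulr_natl sinD2pi.
Qed.

Lemma cdiff_cexp0 : cdiff (@cexp R) 0 1.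
Proof.
(* With [t] the modulus of the increment, the four errors [A1] to [A4] add up to at most [9 e1 t],
   so [e / 16] is enough. *)
move=> e e0; pose e1 := Num.min 1 (e / 16).
have e10 : 0 < e1 by rewrite lt_min ltr01 divr_gt0.
have e11 : e1 <= 1 by rewrite ge_min lexx.
have e1e : e1 <= e / 16 by rewrite ge_min lexx orbT.
clearbody e1.
have [d1 d10 H1] := is_derive_expansion (is_derive_expR (0 : R)) e10.
have [d2 d20 H2] := is_derive_expansion (is_derive_cos (0 : R)) e10.
have [d3 d30 H3] := is_derive_expansion (is_derive_sin (0 : R)) e10.
exists (Num.min e1 (Num.min d1 (Num.min d2 d3))).
  by rewrite !lt_min e10 d10 d20 d30.
case=> a b; rewrite !lt_min => /and4P[he h1 h2 h3].
have la : `|a| <= cabs (a +i* b) := Re_le_cabs (a +i* b).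
have lb : `|b| <= cabs (a +i* b) := Im_le_cabs (a +i* b).
have := H1 a (le_lt_trans la h1); rewrite add0r expR0 [1 * a]mul1r => {}H1.
have := H2 b (le_lt_trans lb h2); rewrite add0r cos0 sin0 oppr0 mul0r subr0 => {}H2.
have := H3 b (le_lt_trans lb h3); rewrite add0r sin0 cos0 [1 * b]mul1r subr0 => {}H3.
set t := cabs (a +i* b) in h1 h2 h3 he la lb *.
have t0 : 0 <= t := cabs_ge0 _.
have E2 : `|expR a - 1| <= 2 * t.
  rewrite -[X in `|X|](subrK a) (le_trans (ler_normD _ _))//.
  have := ler_piMl (normr_ge0 a) e11; lra.
have E3 : `|expR a| <= 3.
  rewrite -[X in `|X|](subrK 1) (le_trans (ler_normD _ _))// normr1; lra.
rewrite ?add0r ?cexp0 ?mul1r (le_trans (cabs_le_ReIm _))//.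
rewrite !(cReB, cImB) Re_cexp Im_cexp /= subr0.
have -> : expR a * cos b - 1 - a = (expR a - 1 - a) + expR a * (cos b - 1) by ring.
have -> : expR a * sin b - b = expR a * (sin b - b) + (expR a - 1) * b by ring.
have A1 : `|expR a * (cos b - 1)| <= 3 * (e1 * t).
  rewrite normrM ler_pM// (le_trans H2)// ler_wpM2l// ltW//.
have A2 : `|expR a * (sin b - b)| <= 3 * (e1 * t).
  rewrite normrM ler_pM// (le_trans H3)// ler_wpM2l// ltW//.
have A3 : `|(expR a - 1) * b| <= 2 * t * e1.
  rewrite normrM ler_pM// (le_trans lb)// ltW//.
have A4 : `|expR a - 1 - a| <= e1 * t.
  rewrite (le_trans H1)// ler_wpM2l// ltW//.
have A5 : e1 * t <= e / 16 * t by rewrite ler_wpM2r.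
apply: le_trans (lerD (ler_normD _ _) (ler_normD _ _)) _.
have : 0 <= e * t by rewrite mulr_ge0// ltW.
lra.
Qed.

Lemma cdiff_cexp z : cdiff (@cexp R) z (cexp z).
Proof.
move=> e e0.
have K0 : 0 < cabs (cexp z) by rewrite cabs_cexp expR_gt0.
have [|d d0 H] := cdiff_cexp0 (e := e / cabs (cexp z)); first exact: divr_gt0.
exists d => // h /H; rewrite add0r cexp0 mul1r => {}H.
have -> : cexp (z + h) - cexp z - cexp z * h = cexp z * (cexp h - 1 - h).
  by rewrite cexpD; ring.
rewrite cabsM (le_trans (ler_wpM2l (ltW K0) H))//.
by rewrite mulrA mulrCA divff ?gt_eqF// mulr1.
Qed.

Lemma entire_cexp : entire (@cexp R).
Proof. exact: (@entireI _ _ (@cexp R) cdiff_cexp). Qed.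

End ComplexExponential.

(** * Goursat's theorem and mean values *)

Section SegmentIntegral.
Context (R : realType).
Local Notation mu := (@lebesgue_measure R).
Implicit Types (h g : R -> R) (a b c : R).

Definition segint a b h : R := \int[mu]_(x in `[a, b]) h x.

Lemma cont_integrable h a b : continuous h -> mu.-integrable `[a, b] (EFin \o h).
Proof.
move=> ch; apply: continuous_compact_integrable; first exact: segment_compact.
exact: continuous_subspaceT.
Qed.

Lemma segint_cat h a b c : continuous h -> a <= b -> b <= c ->
  segint a c h = segint a b h + segint b c h.
Proof.
move=> ch ab bc; rewrite /segint.
have := @Rintegral_itvB R h (BLeft a) (BRight c) b (cont_integrable a c ch).
rewrite !bnd_simp => /(_ ab bc).
rewrite Rintegral_itv_obnd_cbnd => [<-|]; first by rewrite addrC subrK.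
apply: integrableS (cont_integrable a c ch) => //.
by apply: subset_itvr; rewrite bnd_simp.
Qed.

Lemma segintB h g a b : continuous h -> continuous g ->
  segint a b (fun x => h x - g x) = segint a b h - segint a b g.
Proof. by move=> ch cg; apply: RintegralB => //; exact: cont_integrable. Qed.

Lemma segint_cst a b c : a <= b -> segint a b (fun=> c) = c * (b - a).
Proof.
move=> ab; rewrite /segint Rintegral_cst//= lebesgue_measure_itv /= lte_fin.
by case: ltgtP ab => //= -> _; rewrite subrr.
Qed.

Lemma segint_bound h a b c B : continuous h -> a <= b ->
  (forall x, a <= x <= b -> `|h x - c| <= B) ->
  `|segint a b h - c * (b - a)| <= B * (b - a).
Proof.
move=> ch ab hB; rewrite -(segint_cst c ab) -(segint_cst B ab) -segintB//; last first.
  by move=> x; exact: cvg_cst.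
have chc : continuous (fun x => h x - c).
  by move=> x; apply: cvgB; [exact: ch|exact: cvg_cst].
have cc : continuous (fun _ : R => B) by move=> x; exact: cvg_cst.
have cn : continuous (fun x => `|h x - c|) by move=> x;
  exact: (continuous_comp (chc x) (@norm_continuous _ R^o _)).
apply: (@le_trans _ _ (segint a b (fun x => `|h x - c|))).
  by apply: le_normr_Rintegral => //; exact: cont_integrable.
apply: le_Rintegral => //; exact: cont_integrable.
Qed.

End SegmentIntegral.

(* [P dx + Q dy] is closed at every point: [p2] is both dP/dy and dQ/dx. *)
Definition closed_form (R : realType) (P Q : R -> R -> R) :=
  forall x0 y0 : R, exists p1 p2 q2 : R, forall e : R, 0 < e ->
  exists2 d : R, 0 < d & forall x y, `|x - x0| <= d -> `|y - y0| <= d ->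
   `|P x y - P x0 y0 - p1 * (x - x0) - p2 * (y - y0)| <= e * (`|x - x0| + `|y - y0|) /\
   `|Q x y - Q x0 y0 - p2 * (x - x0) - q2 * (y - y0)| <= e * (`|x - x0| + `|y - y0|).

Section Goursat.
Context (R : realType) (P Q : R -> R -> R).
Hypotheses (cP : forall y, continuous (P^~ y)) (cQ : forall x, continuous (Q x)).
Hypothesis closedPQ : closed_form P Q.

(** The integral of [P dx + Q dy] along the boundary of [[a, a + s] x [b, b + t]], counterclockwise,
    with opposite sides under one integral sign. *)
Definition circulation (a b s t : R) :=
  segint a (a + s) (fun x => P x b - P x (b + t)) +
  segint b (b + t) (fun y => Q (a + s) y - Q a y).

Lemma circulation_split a b s t : 0 <= s -> 0 <= t ->
  circulation a b (s + s) (t + t) = circulation a b s t + circulation (a + s) b s t +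
    circulation a (b + t) s t + circulation (a + s) (b + t) s t.
Proof.
move=> s0 t0; rewrite /circulation !segintB//.
have as1 : a <= a + s by rewrite lerDl.
have as2 : a + s <= a + (s + s) by rewrite lerD2l lerDl.
have bt1 : b <= b + t by rewrite lerDl.
have bt2 : b + t <= b + (t + t) by rewrite lerD2l lerDl.
rewrite !(@segint_cat _ (P^~ _) a (a + s) (a + (s + s)))//.
rewrite !(@segint_cat _ (Q _) b (b + t) (b + (t + t)))//.
rewrite !addrA; ring.
Qed.

(** The affine parts contribute [- p2 t s] on the horizontal sides and [p2 s t] on the vertical
    ones; they cancel because the same [p2] occurs in [P] and in [Q], and only the remainders are
    left. *)
Lemma circulation_local x0 y0 e : 0 < e -> exists2 d : R, 0 < d & forall a b s t,
  0 <= s -> 0 <= t -> s <= d -> t <= d ->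
  a <= x0 <= a + s -> b <= y0 <= b + t ->
  `|circulation a b s t| <= e * (s + t) * (s + t).
Proof.
move=> e0; have [p1 [p2 [q2 H]]] := closedPQ x0 y0.
have [|d d0 {}H] := H (e / 2); first by rewrite divr_gt0.
exists d => // a b s t s0 t0 sd td /andP[ax xa] /andP[bY yb].
have bx x : a <= x <= a + s -> `|x - x0| <= s.
  by rewrite ler_norml => /andP[]; lra.
have by_ y : b <= y <= b + t -> `|y - y0| <= t.
  by rewrite ler_norml => /andP[]; lra.
have e20 : 0 <= e / 2 by rewrite divr_ge0// ltW.
have HP x y : a <= x <= a + s -> b <= y <= b + t ->
   `|P x y - P x0 y0 - p1 * (x - x0) - p2 * (y - y0)| <= e / 2 * (s + t) /\
   `|Q x y - Q x0 y0 - p2 * (x - x0) - q2 * (y - y0)| <= e / 2 * (s + t).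
  move=> hx hy; have hxs := bx _ hx; have hyt := by_ _ hy.
  have [h1 h2] := H x y (le_trans hxs sd) (le_trans hyt td).
  by split; [apply: le_trans h1 _|apply: le_trans h2 _]; rewrite ler_wpM2l// lerD.
have ba : b <= b <= b + t by rewrite lexx lerDl.
have bb : b <= b + t <= b + t by rewrite lexx lerDl t0.
have aa : a <= a <= a + s by rewrite lexx lerDl.
have ab : a <= a + s <= a + s by rewrite lexx lerDl s0.
have I1 : `|segint a (a + s) (fun x => P x b - P x (b + t)) - (- p2 * t) * (a + s - a)|
   <= e * (s + t) * (a + s - a).
  apply: segint_bound; [|by case/andP: ab|].
    by move=> x; apply: cvgB; exact: cP.
  move=> x hx; have [h1 _] := HP x b hx ba; have [h2 _] := HP x (b + t) hx bb.
  have -> : P x b - P x (b + t) - - p2 * t =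
    (P x b - P x0 y0 - p1 * (x - x0) - p2 * (b - y0)) -
    (P x (b + t) - P x0 y0 - p1 * (x - x0) - p2 * (b + t - y0)) by ring.
  rewrite (le_trans (ler_normB _ _))// (le_trans (lerD h1 h2))//.
  by rewrite -mulrDl -splitr.
have I2 : `|segint b (b + t) (fun y => Q (a + s) y - Q a y) - (p2 * s) * (b + t - b)|
   <= e * (s + t) * (b + t - b).
  apply: segint_bound; [|by case/andP: bb|].
    by move=> y; apply: cvgB; exact: cQ.
  move=> y hy; have [_ h1] := HP (a + s) y ab hy; have [_ h2] := HP a y aa hy.
  have -> : Q (a + s) y - Q a y - p2 * s =
    (Q (a + s) y - Q x0 y0 - p2 * (a + s - x0) - q2 * (y - y0)) -
    (Q a y - Q x0 y0 - p2 * (a - x0) - q2 * (y - y0)) by ring.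
  rewrite (le_trans (ler_normB _ _))// (le_trans (lerD h1 h2))//.
  by rewrite -mulrDl -splitr.
rewrite /circulation; set A := segint _ _ _ in I1 *; set B := segint _ _ _ in I2 *.
have -> : A + B = (A - - p2 * t * (a + s - a)) + (B - p2 * s * (b + t - b)) by ring.
rewrite (le_trans (ler_normD _ _))// (le_trans (lerD I1 I2))//.
rewrite -mulrDr; by have -> : a + s - a + (b + t - b) = s + t by ring.
Qed.

(* Bisection: a nonzero circulation loses at most a factor 4 per step, whereas
   [circulation_local] makes it [o(4^-n)] near the limit point. *)
Lemma circulation_eq0 a b s t : 0 <= s -> 0 <= t -> circulation a b s t = 0.
Proof.
move=> s0 t0; apply/eqP; apply: contraT => c0; exfalso.
pose S n := s / 2 ^+ n; pose T n := t / 2 ^+ n.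
have S0 n : 0 <= S n by rewrite divr_ge0// exprn_ge0.
have T0 n : 0 <= T n by rewrite divr_ge0// exprn_ge0.
have SS n : S n = S n.+1 + S n.+1.
  by rewrite /S exprS; field; rewrite expf_neq0.
have TS n : T n = T n.+1 + T n.+1.
  by rewrite /T exprS; field; rewrite expf_neq0.
(* One of the four quarters carries at least a quarter of the modulus. *)
have step n (p : R * R) : exists q : R * R,
    (q.1 = p.1 \/ q.1 = p.1 + S n.+1) /\ (q.2 = p.2 \/ q.2 = p.2 + T n.+1) /\
    `|circulation p.1 p.2 (S n) (T n)| <= 4 * `|circulation q.1 q.2 (S n.+1) (T n.+1)|.
  case: p => x y /=; rewrite (SS n) (TS n) circulation_split//.
  set A := circulation x y _ _; set B := circulation _ y _ _; set C := circulation x _ _ _.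
  set D := circulation _ _ _ _.
  have N : `|A + B + C + D| <= `|A| + `|B| + `|C| + `|D|.
    apply: (le_trans (ler_normD _ _)); rewrite lerD2r.
    by apply: (le_trans (ler_normD _ _)); rewrite lerD2r ler_normD.
  have [hA|hA] := leP `|A + B + C + D| (4 * `|A|).
    by exists (x, y); split; [left|split; [left|]].
  have [hB|hB] := leP `|A + B + C + D| (4 * `|B|).
    by exists (x + S n.+1, y); split; [right|split; [left|]].
  have [hC|hC] := leP `|A + B + C + D| (4 * `|C|).
    by exists (x, y + T n.+1); split; [left|split; [right|]].
  exists (x + S n.+1, y + T n.+1); split; [by right|split; [by right|]].
  by rewrite -/D; lra.
have [f Hf] := choice (fun np : nat * (R * R) => step np.1 np.2).
pose p := fix p n := if n is m.+1 then f (m, p m) else (a, b).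
have p1 n : (p n.+1).1 = (p n).1 \/ (p n.+1).1 = (p n).1 + S n.+1.
  by have [] := Hf (n, p n).
have p2 n : (p n.+1).2 = (p n).2 \/ (p n.+1).2 = (p n).2 + T n.+1.
  by have [_ []] := Hf (n, p n).
have pc n : `|circulation a b s t| <= 4 ^+ n * `|circulation (p n).1 (p n).2 (S n) (T n)|.
  elim: n => [|n ih]; first by rewrite expr0 mul1r /S /T expr0 !divr1.
  rewrite (le_trans ih)// exprSr -mulrA ler_wpM2l ?exprn_ge0//.
  by have [_ []] := Hf (n, p n).
(* Nested intervals: the left ends increase and the right ends decrease, so the supremum of the left
   ends lies in every interval. *)
have lim (u U : nat -> R) : (forall n, 0 <= U n) -> (forall n, U n = U n.+1 + U n.+1) ->
    (forall n, u n.+1 = u n \/ u n.+1 = u n + U n.+1) ->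
    exists x, forall n, u n <= x <= u n + U n.
  move=> U0 UU uu.
  have up n : u n <= u n.+1 by have := U0 n.+1; case: (uu n) => ->; lra.
  have dn n : u n.+1 + U n.+1 <= u n + U n.
    by have := U0 n.+1; rewrite (UU n); case: (uu n) => ->; lra.
  have upm m n : (m <= n)%N -> u m <= u n.
    by apply: (@homo_leq _ u (fun x y => x <= y)) => // x y z; exact: le_trans.
  have dnm m n : (m <= n)%N -> u n + U n <= u m + U m.
    by apply: (@homo_leq _ (fun n => u n + U n) (fun x y => y <= x)) => // x y z h1 h2;
      exact: le_trans h2 h1.
  have um m n : u m <= u n + U n.
    have [mn|nm] := leqP m n.
      by rewrite (le_trans (upm _ _ mn))// lerDl.
    by rewrite (le_trans _ (dnm _ _ (ltnW nm)))// lerDl.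
  have hs : has_sup (range u).
    by split; [exists (u 0%N), 0%N|exists (u 0%N + U 0%N) => _ [m _ <-]].
  exists (sup (range u)) => n; apply/andP; split.
    by apply: (sup_upper_bound hs); exists n.
  by apply: ge_sup; [case: hs|move=> _ [m _ <-]].
have [x0 hx] := lim (fun n => (p n).1) S S0 SS p1.
have [y0 hy] := lim (fun n => (p n).2) T T0 TS p2.
have c0' : 0 < `|circulation a b s t| by rewrite normr_gt0.
have K0 : 0 < (s + t) * (s + t) + 1 by rewrite ltr_wpDl// mulr_ge0 ?addr_ge0.
(* With [K = (s + t)^2], the powers of 4 cancel and the estimate becomes [C <= C K / (K + 1)]; the
   added 1 makes this contradictory. *)
have [|d d0 Hd] := @circulation_local x0 y0 (`|circulation a b s t| / ((s + t) * (s + t) + 1)).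
  exact: divr_gt0.
have [n nd] : exists n : nat, (s + t) / 2 ^+ n <= d.
  have [n hn] : exists n : nat, (s + t) / d < n%:R.
    exists (Num.bound ((s + t) / d)).
    by apply: archi_boundP; rewrite divr_ge0 ?addr_ge0// ltW.
  exists n; rewrite ler_pdivrMr ?exprn_gt0// mulrC -ler_pdivrMr//.
  rewrite (le_trans (ltW hn))// -natrX ler_nat.
  exact/ltnW/ltn_expl.
have Snd : S n <= d.
  by rewrite (le_trans _ nd)// ler_wpM2r ?invr_ge0 ?exprn_ge0// lerDl.
have Tnd : T n <= d.
  by rewrite (le_trans _ nd)// ler_wpM2r ?invr_ge0 ?exprn_ge0// lerDr.
have := Hd _ _ _ _ (S0 n) (T0 n) Snd Tnd (hx n) (hy n).
have := pc n.
set c := circulation (p n).1 _ _ _; set C := `|circulation a b s t| => h1 h2.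
have h3 : C <= 4 ^+ n * (C / ((s + t) * (s + t) + 1) * (S n + T n) * (S n + T n)).
  by rewrite (le_trans h1)// ler_wpM2l// exprn_ge0.
have h4 : 4 ^+ n * (C / ((s + t) * (s + t) + 1) * (S n + T n) * (S n + T n)) =
   C * (((s + t) * (s + t)) / ((s + t) * (s + t) + 1)).
  rewrite /S /T (_ : 4 = 2 * 2); last by ring.
  rewrite exprMn; field.
  by rewrite expf_neq0//= gt_eqF.
move: h3; rewrite h4 leNgt => /negP; apply.
rewrite gtr_pMr// ltr_pdivrMr// mul1r ltrDl//.
Qed.

End Goursat.

(** * Mean value property and Cauchy's first estimate from Goursat's theorem *)

Section MeanValue.
Context (R : realType).
Implicit Types (f g : R[i] -> R[i]).

Lemma cont_id : continuous (id : R -> R).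
Proof. by move=> t; exact: cvg_id. Qed.

Lemma cont_cst (c : R) : continuous (fun _ : R => c).
Proof. by move=> t; exact: cvg_cst. Qed.

Lemma cabs_rect (a b : R) : cabs (a +i* b) <= `|a| + `|b|.
Proof. exact: cabs_le_ReIm. Qed.

Lemma ccont_path f (a b : R -> R) : ccont f -> continuous a -> continuous b ->
  continuous (fun t => Re (f (a t +i* b t))) /\
  continuous (fun t => Im (f (a t +i* b t))).
Proof.
move=> cf ca cb.
have H t e : 0 < e -> \forall s \near t,
    cabs (f (a s +i* b s) - f (a t +i* b t)) < e.
  move=> e0; have [d d0 hd] := cf (a t +i* b t) e e0.
  have d20 : 0 < d / 2 by rewrite divr_gt0.
  near=> s; apply: hd.
  have -> : a s +i* b s - (a t +i* b t) = (a s - a t) +i* (b s - b t) by [].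
  rewrite (le_lt_trans (cabs_rect _ _))// (splitr d) ltrD// distrC.
    by near: s; move/cvgrPdist_lt : (ca t); apply.
  by near: s; move/cvgrPdist_lt : (cb t); apply.
split=> t; apply/cvgrPdist_lt => e /(H t) {}H; near=> s.
  rewrite -cReB (le_lt_trans (Re_le_cabs _))// cabsBC; near: s; exact: H.
rewrite -cImB (le_lt_trans (Im_le_cabs _))// cabsBC; near: s; exact: H.
Unshelve. all: by end_near. Qed.

(** [Im g dx + Re g dy] is the imaginary part of [g dz], closed by the Cauchy-Riemann equations. On
    [[x, 0] x [0, 2 pi]] the horizontal sides cancel by periodicity, and the vertical sides are the
    two integrals. *)
Lemma goursat_periodic g (x : R) : entire g ->
  (forall z, g (z + (0 +i* (2 * pi))) = g z) -> x <= 0 ->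
  segint 0 (2 * pi) (fun y => Re (g (x +i* y))) =
  segint 0 (2 * pi) (fun y => Re (g (0 +i* y))).
Proof.
move=> eg pg x0; have cg := entire_cont eg; move/entireP : eg => dg.
pose P (x y : R) := Im (g (x +i* y)); pose Q (x y : R) := Re (g (x +i* y)).
have cP y : continuous (P^~ y).
  by have [] := @ccont_path g id (fun=> y) cg cont_id (@cont_cst _).
have cQ y : continuous (Q y).
  by have [] := @ccont_path g (fun=> y) id cg (@cont_cst _) cont_id.
have cl : closed_form P Q.
  move=> a b; have := dg (a +i* b); set L := cderiv 1 g _ => D.
  exists (Im L), (Re L), (- Im L) => e e0; have [d d0 H] := D e e0.
  exists (d / 4) => [|s t hs ht]; first by rewrite divr_gt0.
  have hst : cabs ((s - a) +i* (t - b)) < d.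
    by rewrite (le_lt_trans (cabs_rect _ _))//; lra.
  have := H _ hst.
  have -> : a +i* b + ((s - a) +i* (t - b)) = s +i* t.
    by apply: complex_ReIm => /=; rewrite addrC subrK.
  move=> {}H; have {}H := le_trans H (ler_wpM2l (ltW e0) (cabs_rect _ _)).
  split; apply: le_trans H.
    apply: le_trans (Im_le_cabs _); rewrite le_eqVlt; apply/orP; left; apply/eqP.
    by congr `| _ |; rewrite !cImB cImM /= /P; ring.
  apply: le_trans (Re_le_cabs _); rewrite le_eqVlt; apply/orP; left; apply/eqP.
  by congr `| _ |; rewrite !cReB cReM /= /Q; ring.
have pi0 : 0 <= 2 * pi :> R by rewrite mulr_ge0// pi_ge0.
have nx0 : 0 <= - x by rewrite oppr_ge0.
have := @circulation_eq0 _ P Q cP cQ cl x 0 (- x) (2 * pi) nx0 pi0.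
rewrite /circulation subrr add0r.
have -> : (fun x : R => P x 0 - P x (2 * pi)) = fun=> 0.
  apply/funext => s; rewrite /P -(pg (s +i* 0)).
  have -> : s +i* 0 + (0 +i* (2 * pi)) = s +i* (2 * pi).
    by apply: complex_ReIm => /=; rewrite ?addr0 ?add0r.
  by rewrite subrr.
rewrite segint_cst// mul0r add0r segintB// => /eqP.
by rewrite subr_eq0 => /eqP.
Qed.

(* [x -> -oo] in [goursat_periodic]; to be applied to [f \o cexp], for which this
   is the limit of [f] at the origin. *)
Lemma goursat_limit g (c : R) : entire g ->
  (forall z, g (z + (0 +i* (2 * pi))) = g z) ->
  (forall e : R, 0 < e -> exists2 x : R, x <= 0 &
    forall y, `|Re (g (x +i* y)) - c| <= e) ->
  segint 0 (2 * pi) (fun y => Re (g (0 +i* y))) = 2 * pi * c.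
Proof.
move=> eg pg H; have pi0 : 0 < 2 * pi :> R by rewrite mulr_gt0// pi_gt0.
apply/eqP; rewrite -subr_eq0 -normr_le0; apply/ler_addgt0Pl => e e0.
rewrite addr0.
have [|x x0 hx] := H (e / (2 * pi)); first exact: divr_gt0.
rewrite -(goursat_periodic eg pg x0).
have := @segint_bound _ (fun y => Re (g (x +i* y))) 0 (2 * pi) c (e / (2 * pi)).
rewrite subr0 divfK ?gt_eqF// [c * _]mulrC; apply => //; last exact: ltW.
have [//] := @ccont_path g (fun=> x) id (entire_cont eg) (@cont_cst _) cont_id.
Qed.

Definition unit_circle (t : R) : R[i] := cos t +i* sin t.

Lemma cexp_unit_circle t : cexp (0 +i* t) = unit_circle t.
Proof. by apply: complex_ReIm; rewrite ?Re_cexp ?Im_cexp /= expR0 mul1r. Qed.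

Lemma cabs_unit_circle t : cabs (unit_circle t) = 1.
Proof. by rewrite /= cos2Dsin2 sqrtr1. Qed.

Lemma small_exp (d : R) : 0 < d -> exists2 x : R, x <= 0 &
  forall y, cabs (cexp (x +i* y)) < d.
Proof.
move=> d0; exists (Num.min 0 (ln (d / 2))); first by rewrite ge_min lexx.
move=> y; rewrite cabs_cexp /=.
apply: (@le_lt_trans _ _ (expR (ln (d / 2)))).
  by rewrite ler_expR ge_min lexx orbT.
rewrite lnK ?posrE ?divr_gt0//; lra.
Qed.

Lemma mean_value f : entire f ->
  segint 0 (2 * pi) (fun y => Re (f (unit_circle y))) = 2 * pi * Re (f 0).
Proof.
move=> ef; pose g z := f (cexp z).
have eg : entire g by exact: (entire_comp ef (@entire_cexp R)).
have -> : (fun y => Re (f (unit_circle y))) = (fun y => Re (g (0 +i* y))).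
  by apply/funext => y; rewrite /g cexp_unit_circle.
apply: goursat_limit => // [z|]; first by rewrite /g cexp_2pi.
move=> e e0; have [d d0 H] := entire_cont ef 0 e0.
have [x x0 hx] := small_exp d0; exists x => // y.
rewrite -cReB (le_trans (Re_le_cabs _))// ltW//; apply: H.
by rewrite subr0.
Qed.

(** The quotient [(f w - f 0) / w] is never extended across 0: at [w = e^z] it is entire and
    periodic in [z], it tends to the derivative of [f] at 0 as [Re z -> -oo], and it is at most
    [2 B] on the unit circle. *)
Lemma Re_cauchy1 f (B : R) : entire f -> (forall w, cabs w <= 1 -> cabs (f w) <= B) ->
  `|Re (cderiv 1 f 0)| <= 2 * B.
Proof.
move=> ef fB; have B0 : 0 <= B by apply: le_trans (cabs_ge0 (f 0)) (fB _ _); rewrite cabs0.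
pose g z := (f (cexp z) - f 0) * cexp (- z).
have eN : entire (fun z : R[i] => - z).
  rewrite (_ : (fun z => _) = fun z => -1 * z); last by apply/funext => z; rewrite mulN1r.
  exact: (entireM (@entire_cst R _) (@entire_id R)).
have eg : entire g.
  apply: (entireM _ (entire_comp (@entire_cexp R) eN)).
  exact: (entireD (entire_comp ef (@entire_cexp R)) (@entire_cst R _)).
have pi0 : 0 < 2 * pi :> R by rewrite mulr_gt0// pi_gt0.
have I : segint 0 (2 * pi) (fun y => Re (g (0 +i* y))) = 2 * pi * Re (cderiv 1 f 0).
  apply: goursat_limit => // [z|e e0].
    by rewrite /g cexp_2pi !cexpN cexp_2pi.
  have /entireP /(_ 0 e e0) [d d0 H] := ef.
  have [x x0 hx] := small_exp d0; exists x => // y.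
  rewrite -cReB (le_trans (Re_le_cabs _))//.
  have := H _ (hx y); rewrite add0r /g; set w := cexp _ => {}H.
  have w0 : 0 < cabs w by rewrite cabs_cexp expR_gt0.
  rewrite -(ler_pM2r w0) -cabsM cexpN -/w mulrBl mulfVK//.
  by rewrite -cabs_gt0.
have := @segint_bound _ (fun y => Re (g (0 +i* y))) 0 (2 * pi) 0 (2 * B).
rewrite I mul0r !subr0 normrM gtr0_norm// [2 * B * _]mulrC ler_pM2l//; apply => //.
- have [//] := @ccont_path g (fun=> 0) id (entire_cont eg) (@cont_cst _) cont_id.
- exact: ltW.
- move=> y _; rewrite subr0 (le_trans (Re_le_cabs _))// /g cabsM cexpN cexp_unit_circle.
  rewrite cabsV cabs_unit_circle invr1 mulr1 (le_trans (cabsB _ _))// mulr_natl mulr2n lerD//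
    fB//.
    by rewrite cabs_unit_circle.
  by rewrite cabs0.
Qed.

Lemma cauchy_estimate1 f (z : R[i]) (r B : R) : entire f -> 0 < r ->
  (forall w, cabs (w - z) <= r -> cabs (f w) <= B) ->
  cabs (cderiv 1 f z) <= 4 / r * B.
Proof.
move=> ef r0 fB.
(* A unimodular factor gives access to the imaginary part too: [c = 1] and [c = - i] are used, and
   the two bounds add up to the constant 4. *)
have A (c : R[i]) : cabs c = 1 -> `|Re (c * cderiv 1 f z)| <= 2 / r * B.
  move=> c1; pose g w := c * f (z + r%:C * w).
  have ea : entire (fun w => z + r%:C * w).
    exact: (entireD (@entire_cst R _) (entireM (@entire_cst R _) (@entire_id R))).
  have eg : entire g by exact: (entireM (@entire_cst R _) (entire_comp ef ea)).
  have dg : cderiv 1 g 0 = r%:C * (c * cderiv 1 f z).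
    have -> : cderiv 1 g = fun w => c * (cderiv 1 f (z + r%:C * w) * (0 + r%:C * 1)).
      apply: cderivE => w; apply: cdiffZ; apply: cdiff_comp.
        by apply: cdiffD; [exact: cdiff_cst|apply: cdiffZ; exact: cdiff_id].
      by move/entireP : ef.
    by rewrite mulr0 addr0; ring.
  have := @Re_cauchy1 g B eg; rewrite dg [Re (r%:C * _)]cReM [Re r%:C]/= [Im r%:C]/=
    mul0r subr0 normrM gtr0_norm// => H.
  rewrite -(ler_pM2l r0) (le_trans (H _))//; last first.
    by rewrite mulrA mulrCA divff ?gt_eqF// mulr1.
  move=> w w1; rewrite /g cabsM c1 mul1r fB// addrAC subrr add0r cabsM cabsR gtr0_norm//.
  by rewrite ler_piMr// ltW.
have := A 1; rewrite mul1r cabs1 => /(_ erefl) A1.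
have := A (0 +i* -1); rewrite cReM /= mul0r sub0r mulN1r opprK.
rewrite expr0n add0r sqrrN expr1n sqrtr1 => /(_ erefl) A2.
rewrite (le_trans (cabs_le_ReIm _))// (le_trans (lerD A1 A2))//.
by rewrite -mulrDl -mulrDl; rewrite -natrD.
Qed.

End MeanValue.

(** * Lebesgue measure on the plane *)

Section PlaneMeasurability.
Context (R : realType).
Implicit Types (h : plane R -> R) (f g : R[i] -> R[i]) (p q : plane R).

(** Open sets reach the product sigma-algebra as countable unions of boxes with rational centres and
    half-widths [1 / (n + 1)]. *)
Lemma plane_open_measurable (O : set (plane R)) :
  (forall p, O p -> exists2 d : R, 0 < d & forall q,
     `|q.1 - p.1| < d -> `|q.2 - p.2| < d -> O q) -> measurable O.
Proof.
move=> oO.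
pose box (i : rat * rat * nat) : set (plane R) :=
  `]ratr i.1.1 - i.2.+1%:R^-1, ratr i.1.1 + i.2.+1%:R^-1[%classic `*`
  `]ratr i.1.2 - i.2.+1%:R^-1, ratr i.1.2 + i.2.+1%:R^-1[%classic.
have mbox i : measurable (box i) by exact: measurableX.
rewrite (_ : O = \bigcup_(i : rat * rat * nat)
    [set p | box i p /\ box i `<=` O]); last first.
  apply/seteqP; split=> [p Op|p [i _ [bp sO]]]; last exact: sO.
  have [d d0 H] := oO _ Op.
  (* A box of half-width [1 / (n + 1)] that contains [p] stays within [2 / (n + 1) < d] of it. *)
  pose n := Num.bound (2 / d).
  have nd : 2 * n.+1%:R^-1 < d.
    rewrite ltr_pdivrMr// mulrC -ltr_pdivrMr//.
    rewrite (@lt_trans _ _ n%:R) ?ltr_nat//.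
    by apply: archi_boundP; rewrite divr_ge0// ltW.
  have aux (e x y z : R) : 2 * e < d -> x - e < y -> y < x + e ->
      y - e < z -> z < y + e -> `|z - x| < d.
    by move=> *; rewrite ltr_norml; apply/andP; split; lra.
  have {}aux x y z := aux _ x y z nd.
  have n0 : 0 < n.+1%:R^-1 :> R by rewrite invr_gt0.
  have [|q1 hq1] := @rat_in_itvoo R (p.1 - n.+1%:R^-1) (p.1 + n.+1%:R^-1).
    by rewrite ltrD2l gtrN.
  have [|q2 hq2] := @rat_in_itvoo R (p.2 - n.+1%:R^-1) (p.2 + n.+1%:R^-1).
    by rewrite ltrD2l gtrN.
  move: hq1 hq2; rewrite !in_itv /= => /andP[h1 h2] /andP[h3 h4].
  exists (q1, q2, n) => //; split.
    by split; rewrite /= in_itv /= ltrBlDr ?h2 ?h4 -ltrBlDr ?h1 ?h3.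
  move=> q [] /=; rewrite !in_itv /= => /andP[k1 k2] /andP[k3 k4].
  by apply: H; [exact: aux h1 h2 k1 k2|exact: aux h3 h4 k3 k4].
apply: countable_bigcupT_measurable => // i.
have [sO|sO] := pselect (box i `<=` O).
  rewrite (_ : [set p | _] = box i)//.
  by apply/seteqP; split=> [p []|p bp].
rewrite (_ : [set p | _] = set0)//.
by apply/seteqP; split=> [p []|p []].
Qed.

Lemma plane_cont_measurable h :
  (forall p e, 0 < e -> exists2 d : R, 0 < d & forall q,
     `|q.1 - p.1| < d -> `|q.2 - p.2| < d -> `|h q - h p| < e) ->
  measurable_fun setT h.
Proof.
move=> ch mD; apply: (measurability _ (RGenOInfty.measurableE R)) => //.
move=> /= _ [_ [a ->] <-]; rewrite setTI preimage_itvoy.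
apply: plane_open_measurable => p /= ap.
have [|d d0 H] := ch p (h p - a); first by rewrite subr_gt0.
exists d => // q h1 h2; have := H q h1 h2.
by rewrite ltr_norml => /andP[+ _]; lra.
Qed.

Lemma toC_near (p : plane R) (e : R) : 0 < e -> exists2 d : R, 0 < d &
  forall q : plane R, `|q.1 - p.1| < d -> `|q.2 - p.2| < d -> cabs (toC q - toC p) < e.
Proof.
move=> e0; exists (e / 2); first by rewrite divr_gt0.
move=> q h1 h2; rewrite (le_lt_trans (cabs_rect (q.1 - p.1) (q.2 - p.2)))//.
by rewrite (splitr e) ltrD.
Qed.

Lemma ccont_measurable f : ccont f ->
  measurable_fun setT (fun p : plane R => Re (f (toC p))) /\
  measurable_fun setT (fun p : plane R => Im (f (toC p))).
Proof.
move=> cf; split; apply: plane_cont_measurable => p e e0;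
  have [d d0 H] := cf (toC p) e e0; have [d' d'0 H'] := toC_near p d0;
  exists d' => // q h1 h2.
  by rewrite -cReB (le_lt_trans (Re_le_cabs _))// H// H'.
by rewrite -cImB (le_lt_trans (Im_le_cabs _))// H// H'.
Qed.

Lemma measurable_cabs d (T : measurableType d) (h : T -> R[i]) :
  measurable_fun setT (fun t => Re (h t)) -> measurable_fun setT (fun t => Im (h t)) ->
  measurable_fun setT (fun t => cabs (h t)).
Proof.
move=> m1 m2.
have -> : (fun t => cabs (h t)) = (fun t => Num.sqrt (Re (h t) ^+ 2 + Im (h t) ^+ 2)).
  by apply/funext => t; rewrite -cabs_sqr sqrtr_sqr ger0_norm// cabs_ge0.
have ms : measurable_fun setT (@Num.sqrt R).
  by apply: continuous_measurable_fun; exact: sqrt_continuous.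
apply: (measurableT_comp ms).
by apply: measurable_funD; apply: measurable_funX.
Qed.

Lemma ccont_measurable_cabs f : ccont f ->
  measurable_fun setT (fun p : plane R => cabs (f (toC p))).
Proof. by move=> /ccont_measurable[m1 m2]; exact: measurable_cabs. Qed.

Lemma measurable_disk z r : measurable (disk z r : set (plane R)).
Proof.
apply: plane_open_measurable => p pz.
have [|d d0 H] := toC_near p (e := r - cabs (toC p - z)); first by rewrite subr_gt0.
exists d => // q h1 h2; rewrite /disk /=.
rewrite (le_lt_trans (cabs_tri (toC p) _ _))//.
by have := H q h1 h2; lra.
Qed.

End PlaneMeasurability.

Section Invariance.
Context (R : realType).
Local Notation mu := (@lebesgue_measure R).
Local Notation mu2 := (@lebesgue2 R).
Implicit Types (phi psi : plane R -> plane R).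
Local Open Scope ereal_scope.

(** The image of Lebesgue measure under a translation gives half-open intervals their length, so
    uniqueness identifies it. *)
Lemma integral_translation (c : R) (F : R -> \bar R) :
  measurable_fun setT F -> (forall x, 0 <= F x) ->
  \int[mu]_x F (x + c)%R = \int[mu]_x F x.
Proof.
move=> mF F0.
have mphi : measurable_fun setT (fun x : measurableTypeR R => (x + c)%R : measurableTypeR R).
  by apply: measurable_funD.
transitivity (\int[pushforward mu (fun x : measurableTypeR R => (x + c)%R :
  measurableTypeR R)]_(y in setT) F y).
  by rewrite ge0_integral_pushforward.
apply: eq_measure_integral => A mA _; apply/esym/lebesgue_measure_unique => //.
move=> _ [[a b] _ <-]; rewrite /pushforward.
transitivity (mu `](a - c)%R, (b - c)%R]); last first.
  congr (mu _); apply/seteqP.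
  by split=> x /=; rewrite !in_itv /= ltrBlDr lerBrDr.
rewrite /= !lebesgue_measure_itv /= !lte_fin ltrD2r.
by case: ifPn => // _; rewrite -!EFinB; congr EFin; ring.
Qed.

(** Phrased with nonnegative integrals instead of measures of sets: Tonelli then applies to shears
    directly, and composition is immediate. *)
Definition preserving phi := measurable_fun setT phi /\
  forall F : plane R -> \bar R, measurable_fun setT F -> (forall p, 0 <= F p) ->
    \int[mu2]_p F (phi p) = \int[mu2]_p F p.

Lemma preserving_comp phi psi : preserving phi -> preserving psi ->
  preserving (phi \o psi).
Proof.
move=> [m1 h1] [m2 h2]; split; first exact: measurableT_comp.
move=> F mF F0; rewrite -(h1 F mF F0).
have mFp : measurable_fun setT (F \o phi) by exact: measurableT_comp.
by rewrite -(h2 _ mFp (fun p => F0 (phi p))).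
Qed.

Lemma preserving_integrable phi (F : plane R -> R) : preserving phi ->
  mu2.-integrable setT (EFin \o F) -> mu2.-integrable setT (EFin \o (F \o phi)).
Proof.
move=> [mp hp] /integrableP[mF fF]; apply/integrableP; split.
  exact: measurableT_comp mF mp.
rewrite [ltLHS](_ : _ = \int[mu2]_p `|(F (phi p))%:E|)//.
rewrite (hp (fun p => `|(F p)%:E|))//.
exact: measurableT_comp.
Qed.

Lemma preserving_Rintegral phi (F : plane R -> R) : preserving phi ->
  measurable_fun setT F ->
  (\int[mu2]_p F (phi p) = \int[mu2]_p F p)%R.
Proof.
move=> [mp hp] /measurable_EFinP mF; congr fine.
rewrite integralE [RHS]integralE; congr (_ - _).
- rewrite -[RHS](hp ((EFin \o F)^\+) (measurable_funepos mF) (fun=> funepos_ge0 _ _)).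
  by apply: eq_integral => p _; rewrite !funeposE.
- rewrite -[RHS](hp ((EFin \o F)^\-) (measurable_funeneg mF) (fun=> funeneg_ge0 _ _)).
  by apply: eq_integral => p _; rewrite !funenegE.
Qed.

(** By Tonelli this is a one-dimensional translation on each horizontal line. The two kinds of
    shears generate all the translations and rotations used below. *)
Lemma preserving_shear1 (a : R -> R) : measurable_fun setT a ->
  preserving (fun p => ((p.1 + a p.2)%R, p.2)).
Proof.
move=> ma.
have mphi : measurable_fun setT (fun p : plane R => ((p.1 + a p.2)%R, p.2) : plane R).
  apply: measurable_fun_pair; last exact: measurable_snd.
  apply: measurable_funD; first exact: measurable_fst.
  exact: (measurableT_comp ma measurable_snd).
split=> // F mF F0; rewrite /lebesgue2.
rewrite fubini_tonelli2//; last exact: (measurableT_comp mF mphi).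
rewrite [RHS]fubini_tonelli2//; apply: eq_integral => y _.
rewrite /fubini_G (@integral_translation (a y) (fun x => F (x, y)))//.
exact: measurableT_comp.
Qed.

Lemma preserving_shear2 (a : R -> R) : measurable_fun setT a ->
  preserving (fun p => (p.1, (p.2 + a p.1)%R)).
Proof.
move=> ma.
have mphi : measurable_fun setT (fun p : plane R => (p.1, (p.2 + a p.1)%R) : plane R).
  apply: measurable_fun_pair; first exact: measurable_fst.
  apply: measurable_funD; first exact: measurable_snd.
  exact: (measurableT_comp ma measurable_fst).
split=> // F mF F0; rewrite /lebesgue2.
rewrite fubini_tonelli1//; last exact: (measurableT_comp mF mphi).
rewrite [RHS]fubini_tonelli1//; apply: eq_integral => x _.
rewrite /fubini_F (@integral_translation (a x) (fun y => F (x, y)))//.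
exact: measurableT_comp.
Qed.

Definition ofC (z : R[i]) : plane R := (Re z, Im z).

Lemma ofCK : cancel ofC (@toC R). Proof. by case. Qed.

Definition translate (w : R[i]) (p : plane R) : plane R := ofC (toC p + w)%R.
Definition rotate (w : R[i]) (p : plane R) : plane R := ofC (w * toC p)%R.

Lemma preserving_trans w : preserving (translate w).
Proof.
have P := preserving_comp (@preserving_shear1 (fun=> Re w) (@measurable_cst _ _ _ _ _ _))
  (@preserving_shear2 (fun=> Im w) (@measurable_cst _ _ _ _ _ _)).
refine (@eq_ind _ _ preserving P _ _); apply/funext => -[x y].
by rewrite /translate /ofC /toC /= cReD cImD.
Qed.

(* A rotation other than -1 is a product of three shears. *)
Lemma preserving_rot w : cabs w = 1%R -> preserving (rotate w).
Proof.
suff H (v : R[i]) : cabs v = 1%R -> (Re v + 1 != 0)%R -> preserving (rotate v).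
  (* The exceptional rotation [-1] is the square of the rotation by [i]. *)
  move=> w1; have [w0|] := eqVneq (Re w + 1)%R 0%R; last exact: H.
  have i1 : cabs ((0%R +i* 1%R) : R[i]) = 1%R by rewrite /= expr0n add0r expr1n sqrtr1.
  have iN : (Re ((0%R +i* 1%R) : R[i]) + 1 != 0)%R by rewrite /= add0r oner_eq0.
  have P := preserving_comp (H _ i1 iN) (H _ i1 iN).
    have rew : Re w = (-1)%R by apply/eqP; rewrite -addr_eq0 w0.
  have := cabs_sqr w; rewrite w1 rew sqrrN expr1n => /eqP.
  rewrite -subr_eq0 opprD addNKr oppr_eq0 expf_eq0 /= => /eqP imw.
  refine (@eq_ind _ _ preserving P _ _).
  apply/funext => -[x y]; rewrite /rotate /ofC /toC /= !cReM !cImM /= imw rew.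
  by congr pair; ring.
case: v => c s v1 /= c0.
have cs : (c ^+ 2 + s ^+ 2 = 1)%R by have := cabs_sqr (c +i* s); rewrite v1 expr1n.
(* This is [- tan (theta / 2)] when [v = cos theta + i sin theta]. *)
pose t := (- (s / (c + 1)))%R.
have mm (k : R) : measurable_fun setT (fun y : R => k * y)%R.
  by apply: measurable_funM => //; exact: measurable_cst.
have P := preserving_comp (preserving_comp (preserving_shear1 (mm t)) (preserving_shear2 (mm s)))
  (preserving_shear1 (mm t)).
refine (@eq_ind _ _ preserving P _ _); apply/funext => -[x y]; rewrite /rotate /ofC /toC /= /t.
have ss : (s * s = (1 - c) * (c + 1))%R by rewrite -expr2 (_ : s ^+ 2 = 1 - c ^+ 2)%R;
  [ring|rewrite -cs; ring].
have key : (s * (s / (c + 1)) = 1 - c)%R by rewrite mulrA ss mulfK.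
congr pair.
  transitivity (x - (s / (c + 1)) * y - (s / (c + 1)) * y - s * (s / (c + 1)) * x
     + (s * (s / (c + 1))) * (s / (c + 1)) * y)%R; first by ring.
  by rewrite key; field.
transitivity (y + s * x - s * (s / (c + 1)) * y)%R; first by ring.
by rewrite key; ring.
Qed.

End Invariance.

Section RealIntegrability.
Context d (T : measurableType d) (R : realType) (m : {measure set T -> \bar R}).
Implicit Types (f g : T -> R).

Definition rint f := m.-integrable setT (fun x => (f x)%:E).

Lemma rint_measurable f : rint f -> measurable_fun setT f.
Proof. by move=> /integrableP[/measurable_EFinP]. Qed.

Lemma rint_le f g : measurable_fun setT f -> (forall x, `|f x| <= g x) ->
  rint g -> rint f.
Proof.
move=> /measurable_EFinP mf fg; apply: le_integrable => // x _ /=.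
by rewrite lee_fin (le_trans (fg x))// ler_norm.
Qed.

Lemma rintD f g : rint f -> rint g -> rint (fun x => f x + g x).
Proof. by move=> hf hg; have := integrableD measurableT hf hg. Qed.

Lemma rintZ c f : rint f -> rint (fun x => c * f x).
Proof. by move=> hf; have := integrableZl measurableT c hf. Qed.

Lemma rintN f : rint f -> rint (fun x => - f x).
Proof. by move=> hf; have := rintZ (-1) hf; under eq_fun do rewrite mulN1r. Qed.

Lemma rintB f g : rint f -> rint g -> rint (fun x => f x - g x).
Proof. by move=> hf hg; apply: rintD => //; exact: rintN. Qed.

Lemma rint_norm f : rint f -> rint (fun x => `|f x|).
Proof. by move=> h; have := integrable_norm h. Qed.

Lemma rint_EFin f : rint f -> (\int[m]_x (f x)%:E)%E = (\int[m]_x f x)%:E.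
Proof. by move=> hf; rewrite fineK// integrable_fin_num. Qed.

Lemma ge0_rint f : measurable_fun setT f -> (forall x, 0 <= f x) ->
  (\int[m]_x (f x)%:E < +oo)%E -> rint f.
Proof.
move=> mf f0 foo; apply/integrableP; split; first exact/measurable_EFinP.
by under eq_integral do rewrite /= ger0_norm//.
Qed.

End RealIntegrability.

Section ComplexIntegral.
Context (R : realType) (m : {measure set (plane R) -> \bar R}).
Implicit Types (h g : R[i] -> R[i]).

Definition cmeasurable h := measurable_fun setT (fun p : plane R => Re (h (toC p))) /\
  measurable_fun setT (fun p : plane R => Im (h (toC p))).

Lemma cmeasurable_cabs h : cmeasurable h -> measurable_fun setT (fun p :
  plane R => cabs (h (toC p))).
Proof. by case; exact: measurable_cabs. Qed.

Lemma cmeasM h g : cmeasurable h -> cmeasurable g -> cmeasurable (fun z => h z * g z).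
Proof.
move=> [h1 h2] [g1 g2]; split.
  under eq_fun do rewrite cReM.
  by apply: measurable_funB; apply: measurable_funM.
under eq_fun do rewrite cImM.
by apply: measurable_funD; apply: measurable_funM.
Qed.

Lemma cmeasD h g : cmeasurable h -> cmeasurable g -> cmeasurable (fun z => h z + g z).
Proof.
move=> [h1 h2] [g1 g2]; split.
  under eq_fun do rewrite cReD.
  exact: measurable_funD.
under eq_fun do rewrite cImD.
exact: measurable_funD.
Qed.

Lemma cmeasJ h : cmeasurable h -> cmeasurable (fun z => conjc (h z)).
Proof.
move=> [h1 h2]; split.
  rewrite (_ : (fun p => _) = (fun p => Re (h (toC p))))//.
  by apply/funext => p; rewrite cReJ.
rewrite (_ : (fun p => _) = (fun p => - Im (h (toC p)))); first exact: measurableT_comp.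
by apply/funext => p; rewrite cImJ.
Qed.

Lemma cmeasurable_cst c : cmeasurable (fun=> c).
Proof. by split; exact: measurable_cst. Qed.

Lemma cmeasR (W : R[i] -> R) : measurable_fun setT (fun p : plane R => W (toC p)) ->
  cmeasurable (fun z => (W z)%:C).
Proof. by move=> mW; split => //=; exact: measurable_cst. Qed.

Lemma ccont_cmeasurable h : ccont h -> cmeasurable h.
Proof. exact: ccont_measurable. Qed.

Lemma entire_cmeasurable h : entire h -> cmeasurable h.
Proof. by move=> /entire_cont /ccont_cmeasurable. Qed.

Lemma cintegrable_le h (G : plane R -> R) : cmeasurable h ->
  (forall p, cabs (h (toC p)) <= G p) -> rint m G -> cintegrable m h.
Proof.
move=> [h1 h2] hG rG; split; apply: (rint_le _ _ rG) => // p.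
  exact: le_trans (Re_le_cabs _) (hG p).
exact: le_trans (Im_le_cabs _) (hG p).
Qed.

Lemma cintegrableZ c h : cintegrable m h -> cintegrable m (fun z => c * h z).
Proof.
move=> [h1 h2]; split.
  by under eq_fun do rewrite cReM; exact: (rintB (rintZ _ h1) (rintZ _ h2)).
by under eq_fun do rewrite cImM; exact: (rintD (rintZ _ h2) (rintZ _ h1)).
Qed.

Lemma cintegralD h g : cintegrable m h -> cintegrable m g ->
  cintegral m (fun z => h z + g z) = cintegral m h + cintegral m g.
Proof.
move=> [h1 h2] [g1 g2]; apply: complex_ReIm; rewrite ?cReD ?cImD /=.
  by under eq_Rintegral do rewrite cReD; exact: RintegralD.
by under eq_Rintegral do rewrite cImD; exact: RintegralD.
Qed.

Lemma cintegralZ c h : cintegrable m h ->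
  cintegral m (fun z => c * h z) = c * cintegral m h.
Proof.
move=> [h1 h2]; apply: complex_ReIm; rewrite ?cReM ?cImM /=.
  under eq_Rintegral do rewrite cReM.
  by rewrite RintegralB ?RintegralZl//; exact: rintZ.
under eq_Rintegral do rewrite cImM.
by rewrite RintegralD ?RintegralZl//; exact: rintZ.
Qed.

Lemma cintegral_le h (G : plane R -> R) : cmeasurable h ->
  (forall p, cabs (h (toC p)) <= G p) -> rint m G ->
  cabs (cintegral m h) <= 2 * \int[m]_p G p.
Proof.
move=> mh hG rG; have [h1 h2] := cintegrable_le mh hG rG.
rewrite (le_trans (cabs_le_ReIm _))//= mulr_natl mulr2n lerD//.
  rewrite (le_trans (le_normr_Rintegral _ h1))//.
  apply: le_Rintegral => //; first exact: rint_norm h1.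
  by move=> p _; exact: le_trans (Re_le_cabs _) (hG p).
rewrite (le_trans (le_normr_Rintegral _ h2))//.
apply: le_Rintegral => //; first exact: rint_norm h2.
by move=> p _; exact: le_trans (Im_le_cabs _) (hG p).
Qed.

Lemma cintegralJ h : cintegrable m h ->
  cintegral m (fun z => conjc (h z)) = conjc (cintegral m h).
Proof.
move=> [h1 h2]; apply: complex_ReIm => /=.
  by apply: eq_Rintegral => p _; rewrite cReJ.
under eq_Rintegral do rewrite cImJ -mulN1r.
by rewrite RintegralZl// mulN1r.
Qed.

Lemma cintegralR (W : R[i] -> R) :
  cintegral m (fun z => (W z)%:C) = (\int[m]_p W (toC p))%:C.
Proof.
apply: complex_ReIm => //=.
by rewrite Rintegral_cst// mul0r.
Qed.

End ComplexIntegral.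

Section SigmaFinite.
Context (R : realType).
Local Notation mu := (@lebesgue_measure R).

Lemma lebesgue2_sigma_finite : sigma_finite setT (@lebesgue2 R).
Proof.
pose F n : set (measurableTypeR R) := `[- n%:R, n%:R]%classic.
exists (fun n => F n `*` F n).
  apply/seteqP; split=> // -[x y] _; pose k := Num.bound (`|x| + `|y|).
  have xyk : `|x| + `|y| < k%:R by apply: archi_boundP; rewrite addr_ge0.
  exists k => //; split; rewrite /F /= in_itv /= -ler_norml ltW// (le_lt_trans _ xyk)//.
    by rewrite lerDl.
  by rewrite lerDr.
move=> n; split; first by apply: measurableX; exact: measurable_itv.
have mF : measurable (F n) by exact: measurable_itv.
rewrite [ltLHS](_ : _ = mu (F n) * mu (F n))%E; last exact: product_measure1E.
rewrite lte_mul_pinfty//.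
  by rewrite lebesgue_measure_itv /=; case: ifP => // _; rewrite -EFinB fin_numE.
by rewrite lebesgue_measure_itv /=; case: ifP => // _; rewrite -EFinB ltry.
Qed.

(* A copy of [lebesgue2], with the sigma-finite structure that Fubini requires. *)
Definition lebesgue2_sfinite : set (plane R) -> \bar R := @lebesgue2 R.
HB.instance Definition _ := Measure.copy lebesgue2_sfinite (@lebesgue2 R).
HB.instance Definition _ :=
  @Measure_isSigmaFinite.Build _ _ _ lebesgue2_sfinite lebesgue2_sigma_finite.

End SigmaFinite.

(** * Mean values with respect to a radial weight *)

Section RadialMean.
Context (R : realType).
Local Notation mu := (@lebesgue_measure R).
Local Notation mu2 := (@lebesgue2 R).
Variable W : R[i] -> R.
Hypotheses (mW : measurable_fun setT (fun p : plane R => W (toC p)))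
  (W0 : forall z, 0 <= W z) (iW : rint mu2 (fun p => W (toC p)))
  (rW : forall w z, cabs w = 1 -> W (w * z) = W z).

Lemma measurable_rot_unit_circle : measurable_fun setT
  (fun x : measurableTypeR R * plane R => rotate (unit_circle x.1) x.2).
Proof.
have mc : measurable_fun setT (fun x : measurableTypeR R * plane R => cos x.1).
  apply: (measurableT_comp (continuous_measurable_fun (@continuous_cos R))).
  exact: measurable_fst.
have ms : measurable_fun setT (fun x : measurableTypeR R * plane R => sin x.1).
  apply: (measurableT_comp (continuous_measurable_fun (@continuous_sin R))).
  exact: measurable_fst.
have m1 : measurable_fun setT (fun x : measurableTypeR R * plane R => x.2.1).
  exact: (measurableT_comp measurable_fst measurable_snd).
have m2 : measurable_fun setT (fun x : measurableTypeR R * plane R => x.2.2).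
  exact: (measurableT_comp measurable_snd measurable_snd).
apply: measurable_fun_pair.
  under eq_fun do rewrite cReM /=.
  by apply: measurable_funB; apply: measurable_funM.
under eq_fun do rewrite cImM /=.
by apply: measurable_funD; apply: measurable_funM.
Qed.

(** Rotating the argument of [f] does not change the integral, since [W] is radial. Averaging over
    all angles and exchanging the integrals, the mean value property on each circle replaces [f] by
    [f 0]. *)
Lemma radial_mean_Re f : entire f -> rint mu2 (fun p => cabs (f (toC p)) * W (toC p)) ->
  \int[mu2]_p (Re (f (toC p)) * W (toC p)) = Re (f 0) * \int[mu2]_p W (toC p).
Proof.
move=> ef fW; have [mf _] := entire_cmeasurable ef.
pose A := `[0, 2 * pi]%classic : set (measurableTypeR R).
pose F p := Re (f (toC p)) * W (toC p).
have mF : measurable_fun setT F by exact: measurable_funM.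
have iF : rint mu2 F.
  apply: (rint_le mF _ fW) => p; rewrite normrM (ger0_norm (W0 _)).
  by rewrite ler_wpM2r ?W0// Re_le_cabs.
(* An indicator restricts the angle to [[0, 2 pi]], so that Fubini is used on the whole product
   space. *)
pose G (x : measurableTypeR R * plane R) := \1_A x.1 * F (rotate (unit_circle x.1) x.2).
have GE t p : G (t, p) = \1_A t * (Re (f (unit_circle t * toC p)) * W (toC p)).
  by rewrite /G /F /= ofCK rW// cabs_unit_circle.
have mG : measurable_fun setT G.
  apply: measurable_funM.
    by apply: (measurableT_comp (measurable_indic _) measurable_fst); exact: measurable_itv.
  exact: (measurableT_comp mF measurable_rot_unit_circle).
have pr (t : R) : preserving (rotate (unit_circle t)) := preserving_rot (cabs_unit_circle t).
have pi20 : 0 <= 2 * pi :> R by rewrite mulr_ge0// pi_ge0.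
have intA : (\int[mu]_t (\1_A t)%:E = (2 * pi)%:E)%E.
  rewrite integral_indic//; last exact: measurable_itv.
 rewrite setIT /A /= lebesgue_measure_itv/= lte_fin.
  by rewrite mulr_gt0 ?pi_gt0// oppr0 adde0.
have iG : (mu \x (@lebesgue2_sfinite R))%E.-integrable setT (fun x => (G x)%:E).
  have mGE : measurable_fun setT (fun x => (G x)%:E) by exact/measurable_EFinP.
  apply: (proj2 (@integrable12ltyP _ _ _ _ _ mu (@lebesgue2_sfinite R) _ mGE)).
  rewrite (_ : (\int[mu]_x _)%E = (\int[mu]_t ((\1_A t)%:E * (\int[mu2]_p `|F p|)%:E))%E).
    rewrite ge0_integralZr//; last by rewrite lee_fin Rintegral_ge0.
      by rewrite intA ltry.
    by apply/measurable_EFinP; apply: measurable_indic; exact: measurable_itv.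
  apply: eq_integral => t _.
  transitivity (\int[mu2]_p ((\1_A t)%:E * (`|F (rotate (unit_circle t) p)|)%:E))%E.
    by apply: eq_integral => p _ /=; rewrite normrM ger0_norm.
  rewrite ge0_integralZl//; last first.
    apply/measurable_EFinP; apply: (measurableT_comp (@normr_measurable R setT)).
    exact: (measurableT_comp mF (pr t).1).
  congr (_ * _)%E.
  rewrite ((pr t).2 (fun p => `|F p|%:E))//; last by apply/measurable_EFinP;
    exact: measurableT_comp.
  by rewrite rint_EFin//; exact: rint_norm.
have : (\int[mu]_x \int[mu2]_y (G (x, y))%:E = \int[mu2]_y \int[mu]_x (G (x, y))%:E)%E.
  exact: (Fubini iG).
have i1A : rint mu (\1_A : R -> R).
  by apply: ge0_rint; rewrite ?intA ?ltry//; apply: measurable_indic; exact: measurable_itv.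
have R1A : \int[mu]_t (\1_A t : R) = 2 * pi.
  by apply: EFin_inj; rewrite -rint_EFin.
have iFr t : rint mu2 (fun p => F (rotate (unit_circle t) p)) :=
  preserving_integrable (pr t) iF.
have -> : (\int[mu]_x \int[mu2]_y (G (x, y))%:E)%E = (2 * pi * \int[mu2]_p F p)%:E.
  transitivity (\int[mu]_t (\1_A t * (\int[mu2]_p F p))%:E)%E.
    apply: eq_integral => t _; rewrite rint_EFin; last exact: (rintZ (\1_A t) (iFr t)).
    rewrite -(preserving_Rintegral (pr t) mF) -RintegralZl//.
    exact: iFr.
  rewrite rint_EFin; first by rewrite RintegralZr// R1A.
  by under eq_fun do rewrite mulrC; exact: rintZ.
have seg p : \int[mu]_t (\1_A t * Re (f (unit_circle t * toC p))) = 2 * pi * Re (f 0).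
  have := @mean_value _ (fun z => f (z * toC p)).
  rewrite mul0r => <-; last first.
    exact: (entire_comp ef (entireM (@entire_id R) (@entire_cst R _))).
  rewrite /segint [RHS]Rintegral_mkcond; apply: eq_Rintegral => t _.
  by rewrite indicE patchE; case: ifPn; rewrite ?mul1r ?mul0r.
have -> : (\int[mu2]_y \int[mu]_x (G (x, y))%:E)%E =
    (2 * pi * (Re (f 0) * \int[mu2]_p W (toC p)))%:E.
  transitivity (\int[mu2]_p (2 * pi * Re (f 0) * W (toC p))%:E)%E.
    apply: eq_integral => p _; rewrite -(seg p).
    have ip : rint mu (fun t => \1_A t * Re (f (unit_circle t * toC p))).
      have eg : entire (fun z => f (z * toC p)).
        exact: (entire_comp ef (entireM (@entire_id R) (@entire_cst R _))).
      have [cg _] := ccont_path (entire_cont eg) (@continuous_cos R) (@continuous_sin R).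
      have mA : measurable A by exact: measurable_itv.
      pose u (t : measurableTypeR R) := (Re (f (unit_circle t * toC p)))%:E.
      have H : mu.-integrable setT (u \_ A).
        by apply/(integrable_mkcond u mA); exact: cont_integrable 0 (2 * pi) cg.
      apply: eq_integrable H => // t _.
      by rewrite patchE indicE; case: ifPn; rewrite ?mul1r ?mul0r.
    transitivity (\int[mu]_t (\1_A t * Re (f (unit_circle t * toC p)) * W (toC p))%:E)%E.
      by apply: eq_integral => t _; rewrite GE mulrA.
    rewrite rint_EFin; last by under eq_fun do rewrite mulrC; exact: rintZ.
    by rewrite RintegralZr.
  by rewrite rint_EFin; [rewrite RintegralZl// mulrA|exact: rintZ].
have pi2 : 2 * pi != 0 :> R by rewrite mulf_neq0// gt_eqF// pi_gt0.
by case=> E; apply: (mulfI pi2).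
Qed.

End RadialMean.

(** * The Gaussian measure and the Fock space inner product *)

Section GaussianWeight.
Context (R : realType).
Local Notation mu := (@lebesgue_measure R).
Local Notation mu2 := (@lebesgue2 R).
Implicit Types (f g h : R[i] -> R[i]) (z w v : R[i]).

Definition gauss_density z : R := pi^-1 * gauss z.

Lemma gauss_density_gt0 z : 0 < gauss_density z.
Proof. by rewrite mulr_gt0 ?invr_gt0 ?pi_gt0// expR_gt0. Qed.

Lemma gauss_density_ge0 z : 0 <= gauss_density z. Proof. exact/ltW/gauss_density_gt0. Qed.

Lemma measurable_gauss : measurable_fun setT (fun p : plane R => gauss (toC p)).
Proof.
apply: (measurableT_comp (@measurable_expR R)).
apply: measurableT_comp => //; apply: measurable_funX.
exact: ccont_measurable_cabs (entire_cont (@entire_id R)).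
Qed.

Lemma measurable_gauss_density : measurable_fun setT (fun p : plane R => gauss_density (toC p)).
Proof. by apply: measurable_funM => //; exact: measurable_gauss. Qed.

Lemma gaussE (p : plane R) : gauss (toC p) = gauss_fun p.1 * gauss_fun p.2.
Proof. by rewrite /gauss cabs_sqr /gauss_fun -expRD opprD. Qed.

Lemma integral_gauss_density : (\int[mu2]_p (gauss_density (toC p))%:E)%E = 1%E.
Proof.
have mg : measurable_fun setT (fun p : plane R => (gauss_density (toC p))%:E).
  by apply/measurable_EFinP; exact: measurable_gauss_density.
rewrite [LHS](@fubini_tonelli1 _ _ _ _ _ mu mu _ mg); last first.
  by move=> p; rewrite lee_fin gauss_density_ge0.
have g0 (x : R) : (0 <= (gauss_fun x)%:E)%E by rewrite lee_fin gauss_fun_ge0.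
have mgf : measurable_fun setT (fun x : R => (gauss_fun x)%:E).
  by apply/measurable_EFinP; exact: measurable_gauss_fun.
have spi : Num.sqrt pi * Num.sqrt pi = pi :> R.
  by rewrite -expr2 sqr_sqrtr// pi_ge0.
transitivity (\int[mu]_x ((pi^-1 * Num.sqrt pi)%:E * (gauss_fun x)%:E))%E.
  apply: eq_integral => x _; rewrite /fubini_F.
  transitivity (\int[mu]_y ((pi^-1 * gauss_fun x)%:E * (gauss_fun y)%:E))%E.
    by apply: eq_integral => y _; rewrite /gauss_density gaussE /= mulrA.
  rewrite ge0_integralZl//; last first.
    by rewrite lee_fin mulr_ge0 ?gauss_fun_ge0// invr_ge0 pi_ge0.
  by rewrite integralT_gauss -!EFinM mulrAC.
rewrite ge0_integralZl//; last by rewrite lee_fin mulr_ge0 ?sqrtr_ge0// invr_ge0 pi_ge0.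
by rewrite integralT_gauss -EFinM -mulrA spi mulVf// gt_eqF// pi_gt0.
Qed.

Lemma rint_gauss_density : rint mu2 (fun p => gauss_density (toC p)).
Proof.
by apply: ge0_rint; [exact: measurable_gauss_density|move=> p; exact: gauss_density_ge0|
  rewrite integral_gauss_density ltry].
Qed.

Lemma Rint_gauss_density : \int[mu2]_p gauss_density (toC p) = 1.
Proof. by apply: EFin_inj; rewrite -rint_EFin ?integral_gauss_density//;
  exact: rint_gauss_density. Qed.

Lemma gauss_density_rot w z : cabs w = 1 -> gauss_density (w * z) = gauss_density z.
Proof. by move=> w1; rewrite /gauss_density /gauss cabsM w1 mul1r. Qed.

Lemma cabs2_sub z w : cabs (z - w) ^+ 2 = cabs z ^+ 2 + cabs w ^+ 2 - 2 * Re (z * conjc w).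
Proof. by rewrite !cabs_sqr cReB cImB cReM cReJ cImJ; ring. Qed.

Lemma gauss_density_shift z w : gauss_density (z - w) = gauss_density z * expR (2 * Re (z *
  conjc w) - cabs w ^+ 2).
Proof. by rewrite /gauss_density /gauss -mulrA -expRD cabs2_sub; congr (_ * expR _); ring. Qed.

Lemma radial_mean (W : R[i] -> R) f :
  measurable_fun setT (fun p : plane R => W (toC p)) -> (forall z, 0 <= W z) ->
  rint mu2 (fun p => W (toC p)) -> (forall w z, cabs w = 1 -> W (w * z) = W z) ->
  entire f -> rint mu2 (fun p => cabs (f (toC p)) * W (toC p)) ->
  cintegral mu2 (fun z => f z * (W z)%:C) = f 0 * (\int[mu2]_p W (toC p))%:C.
Proof.
move=> mW W0 iW rW ef fW.
have H1 := radial_mean_Re mW W0 iW rW ef fW.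
(* Multiplication by [- i] exchanges the parts: [Re (c * f z) = Im (f z)]. *)
pose c : R[i] := 0 +i* -1.
have c1 : cabs c = 1 by rewrite /= expr0n add0r sqrrN expr1n sqrtr1.
have ecf : entire (fun z => c * f z) by exact: (entireM (@entire_cst R _) ef).
have H2 := @radial_mean_Re _ W mW W0 iW rW _ ecf.
have Rec z : Re (c * f z) = Im (f z) by rewrite cReM /= mul0r sub0r mulN1r opprK.
apply: complex_ReIm; rewrite ?cReM ?cImM /= ?mulr0 ?subr0 ?add0r ?addr0.
  by rewrite -H1; apply: eq_Rintegral => p _; rewrite cReM /= mulr0 subr0.
rewrite -Rec -H2.
  by apply: eq_Rintegral => p _; rewrite Rec cImM /= mulr0 add0r.
by under eq_fun do rewrite cabsM c1 mul1r.
Qed.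

Lemma cintegral_shift (H : R[i] -> R[i]) c : cmeasurable H ->
  cintegral mu2 (fun z => H (z + c)) = cintegral mu2 H.
Proof.
move=> [m1 m2]; apply: complex_ReIm => /=.
  rewrite -(preserving_Rintegral (preserving_trans c) m1).
  by apply: eq_Rintegral => p _; rewrite /translate ofCK.
rewrite -(preserving_Rintegral (preserving_trans c) m2).
by apply: eq_Rintegral => p _; rewrite /translate ofCK.
Qed.

Lemma rint_shift (u : R[i] -> R) c : rint mu2 (fun p => u (toC p)) ->
  rint mu2 (fun p => u (toC p + c)).
Proof.
move=> hu; have := preserving_integrable (preserving_trans c) hu.
by rewrite /rint /comp /=; under eq_fun do rewrite /translate ofCK.
Qed.

(** Square integrability is separated from holomorphy because majorants such as [expR (s * cabs z)],
    which are not entire, also enter inner products. *)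
Definition l2f h := cmeasurable h /\ rint mu2 (fun p => cabs (h (toC p)) ^+ 2 *
  gauss_density (toC p)).
Definition sqnorm h : R := \int[mu2]_p (cabs (h (toC p)) ^+ 2 * gauss_density (toC p)).

Lemma sqnorm_ge0 h : 0 <= sqnorm h.
Proof. by apply: Rintegral_ge0 => p _; rewrite mulr_ge0 ?gauss_density_ge0// exprn_ge0//
  cabs_ge0. Qed.

Lemma fock_norm2E h : l2f h -> fock_norm2 h = (sqnorm h)%:E.
Proof. by move=> [_ hh]; rewrite /fock_norm2 rint_EFin. Qed.

Lemma fockP f : fock f <-> entire f /\ l2f f.
Proof.
split=> [[ef foo]|[ef l2]]; last first.
  by split=> //; rewrite fock_norm2E// ltry.
have mf := entire_cmeasurable ef; split=> //; split=> //; apply: ge0_rint => //.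
  apply: measurable_funM; last exact: measurable_gauss_density.
  by apply: measurable_funX; exact: cmeasurable_cabs.
by move=> p; rewrite mulr_ge0 ?gauss_density_ge0// exprn_ge0// cabs_ge0.
Qed.

Lemma fock_normE h : l2f h -> fock_norm h = Num.sqrt (sqnorm h).
Proof. by move=> hh; rewrite /fock_norm fock_norm2E. Qed.

Lemma fock_norm_sqr h : l2f h -> fock_norm h ^+ 2 = sqnorm h.
Proof. by move=> hh; rewrite fock_normE// sqr_sqrtr// sqnorm_ge0. Qed.

Lemma fock_norm_ge0 h : 0 <= fock_norm h.
Proof. exact: sqrtr_ge0. Qed.

Lemma l2f_le h (G : plane R -> R) : cmeasurable h ->
  (forall p, cabs (h (toC p)) ^+ 2 * gauss_density (toC p) <= G p) -> rint mu2 G -> l2f h.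
Proof.
move=> mh hG iG; split=> //; apply: (rint_le _ _ iG).
  apply: measurable_funM; last exact: measurable_gauss_density.
  by apply: measurable_funX; exact: cmeasurable_cabs.
by move=> p; rewrite ger0_norm// mulr_ge0 ?gauss_density_ge0// exprn_ge0// cabs_ge0.
Qed.

Lemma sqr_lin_le (x y t u : R) : 0 <= u -> u <= x * y + t ->
  u ^+ 2 <= 2 * x ^+ 2 * y ^+ 2 + 2 * t ^+ 2.
Proof.
move=> u0 ut; apply: (@le_trans _ _ ((x * y + t) ^+ 2)).
  by rewrite lerXn2r// nnegrE// (le_trans u0).
by have := sqr_ge0 (x * y - t); rewrite !expr2; nra.
Qed.

(** Stands in for the Cauchy-Schwarz inequality: it is integrated with a free scale [s], and
    [le_2sqrt] optimizes [s] afterwards. *)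
Lemma amgm_scaled (s x y t : R) : 0 < s -> 0 <= t ->
  x * y * t <= 2^-1 * (s * (x ^+ 2 * t) + s^-1 * (y ^+ 2 * t)).
Proof.
move=> s0 t0; have si : 0 < s^-1 by rewrite invr_gt0.
have -> : 2^-1 * (s * (x ^+ 2 * t) + s^-1 * (y ^+ 2 * t)) =
    2^-1 * s^-1 * (s * x - y) ^+ 2 * t + x * y * t.
  by field; rewrite gt_eqF.
rewrite lerDr; apply: mulr_ge0 => //; apply: mulr_ge0; last exact: sqr_ge0.
by apply: mulr_ge0; [rewrite invr_ge0|exact: ltW].
Qed.

Lemma l2f_lin (a : R[i]) f g : l2f f -> l2f g -> l2f (fun z => a * f z + g z).
Proof.
move=> [mf hf] [mg hg].
apply: (@l2f_le _ (fun p => 2 * cabs a ^+ 2 * (cabs (f (toC p)) ^+ 2 * gauss_density (toC p))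
    + 2 * (cabs (g (toC p)) ^+ 2 * gauss_density (toC p)))).
- exact: (cmeasD (cmeasM (cmeasurable_cst _) mf) mg).
- move=> p; cbv beta.
  have -> : 2 * cabs a ^+ 2 * (cabs (f (toC p)) ^+ 2 * gauss_density (toC p)) +
      2 * (cabs (g (toC p)) ^+ 2 * gauss_density (toC p)) =
    (2 * cabs a ^+ 2 * cabs (f (toC p)) ^+ 2 + 2 * cabs (g (toC p)) ^+ 2) *
      gauss_density (toC p).
    by ring.
  apply: ler_wpM2r; first exact: gauss_density_ge0.
  apply: sqr_lin_le; rewrite ?cabs_ge0// -cabsM; exact: cabsD.
- exact: (rintD (rintZ _ hf) (rintZ _ hg)).
Qed.

Lemma l2f_cst0 : l2f (fun=> 0).
Proof.
apply: (@l2f_le _ (fun p => gauss_density (toC p)));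
  [exact: cmeasurable_cst| |exact: rint_gauss_density].
by move=> p; rewrite cabs0 expr0n mul0r gauss_density_ge0.
Qed.

Lemma l2f_sub f g : l2f f -> l2f g -> l2f (fun z => f z - g z).
Proof.
move=> hf hg; have := l2f_lin (-1) hg hf.
by under eq_fun do rewrite mulN1r addrC.
Qed.

Lemma l2f_prod f g : l2f f -> l2f g ->
  rint mu2 (fun p => cabs (f (toC p)) * cabs (g (toC p)) * gauss_density (toC p)).
Proof.
move=> [mf hf] [mg hg].
apply: (rint_le _ _ (rintD hf hg)) => [|p].
  apply: measurable_funM; last exact: measurable_gauss_density.
  by apply: measurable_funM; exact: cmeasurable_cabs.
rewrite ger0_norm; last exact:
  (mulr_ge0 (mulr_ge0 (cabs_ge0 _) (cabs_ge0 _)) (gauss_density_ge0 _)).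
apply: (le_trans (amgm_scaled _ _ ltr01 (gauss_density_ge0 _))).
rewrite invr1 !mul1r; set A := _ + _.
have A0 : 0 <= A by apply: addr_ge0; apply: mulr_ge0;
  rewrite ?gauss_density_ge0// exprn_ge0// cabs_ge0.
by rewrite mulrC ler_pdivrMr// ler_peMr// ler1n.
Qed.

Definition inner_integrand f g z := f z * conjc (g z) * (gauss_density z)%:C.

Lemma cmeasurable_gauss_density : cmeasurable (fun z => (gauss_density z)%:C).
Proof. by apply: cmeasR; exact: measurable_gauss_density. Qed.

Lemma cmeasurable_inner_integrand f g : cmeasurable f -> cmeasurable g ->
  cmeasurable (inner_integrand f g).
Proof. by move=> mf mg; apply: (cmeasM (cmeasM mf (cmeasJ mg)) cmeasurable_gauss_density). Qed.

Lemma cabs_inner_integrand f g z : cabs (inner_integrand f g z) = cabs (f z) * cabs (g z) *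
  gauss_density z.
Proof. by rewrite !cabsM cabs_conj cabsR ger0_norm// gauss_density_ge0. Qed.

Lemma cintegrable_inner_integrand f g : l2f f -> l2f g -> cintegrable mu2 (inner_integrand f g).
Proof.
move=> hf hg; apply:
  (cintegrable_le (cmeasurable_inner_integrand hf.1 hg.1) _ (l2f_prod hf hg)).
by move=> p; rewrite cabs_inner_integrand.
Qed.

Lemma fock_inner_linl a f1 f2 g : l2f f1 -> l2f f2 -> l2f g ->
  fock_inner (fun z => a * f1 z + f2 z) g = a * fock_inner f1 g + fock_inner f2 g.
Proof.
move=> h1 h2 hg; rewrite -cintegralZ -?cintegralD; try exact: cintegrable_inner_integrand;
  last first.
  by apply: cintegrableZ; exact: cintegrable_inner_integrand.
by congr cintegral; apply/funext => z; ring.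
Qed.

Lemma fock_innerC f g : l2f f -> l2f g -> fock_inner g f = conjc (fock_inner f g).
Proof.
move=> hf hg; rewrite -cintegralJ; last exact: cintegrable_inner_integrand.
congr cintegral; apply/funext => z.
by rewrite /inner_integrand !cJM cJK conjc_real; congr (_ * _); rewrite mulrC.
Qed.

Lemma fock_inner_linr a f g1 g2 : l2f f -> l2f g1 -> l2f g2 ->
  fock_inner f (fun z => a * g1 z + g2 z) = conjc a * fock_inner f g1 + fock_inner f g2.
Proof.
move=> hf h1 h2; rewrite fock_innerC//; last exact: l2f_lin.
by rewrite fock_inner_linl// cJD cJM -!fock_innerC.
Qed.

Lemma fock_inner_norm f : fock_inner f f = (sqnorm f)%:C.
Proof.
rewrite /sqnorm -(cintegralR mu2 (fun z => cabs (f z) ^+ 2 * gauss_density z)).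
by congr cintegral; apply/funext => z; rewrite mulcJ -rmorphM.
Qed.

(** The best scale is [b / a], with [a = sqrt A] and [b = sqrt B]. As either may vanish, both are
    shifted by a small [d], at a cost of [d (a + b)], which stays below [e]. *)
Lemma le_2sqrt (x A B : R) : 0 <= A -> 0 <= B ->
  (forall s, 0 < s -> x <= s * A + B / s) -> x <= 2 * (Num.sqrt A * Num.sqrt B).
Proof.
move=> A0 B0 H; apply/ler_addgt0Pr => e e0.
pose a := Num.sqrt A; pose b := Num.sqrt B.
have a0 : 0 <= a := sqrtr_ge0 _. have b0 : 0 <= b := sqrtr_ge0 _.
have AE : A = a ^+ 2 by rewrite sqr_sqrtr.
have BE : B = b ^+ 2 by rewrite sqr_sqrtr.
rewrite -/a -/b; clearbody a b.
have ab0 : 0 < a + b + 2 by rewrite ltr_wpDl// addr_ge0.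
pose d := Num.min 1 (e / (a + b + 2)).
have d0 : 0 < d by rewrite lt_min ltr01 divr_gt0.
have d1 : d <= 1 by rewrite ge_min lexx.
have de : d * (a + b + 2) <= e.
  by rewrite -ler_pdivlMr// ge_min lexx orbT.
clearbody d; have ad0 : 0 < a + d by lra.
have bd0 : 0 < b + d by lra.
apply: (le_trans (H ((b + d) / (a + d)) (divr_gt0 bd0 ad0))).
have k1 : (b + d) / (a + d) * A <= (b + d) * a.
  rewrite -mulrA ler_wpM2l ?(ltW bd0)// AE mulrC ler_pdivrMr// expr2 ler_wpM2l// lerDl;
    exact: ltW.
have k2 : B / ((b + d) / (a + d)) <= b * (a + d).
  rewrite invf_div mulrA ler_pdivrMr// BE.
  have -> : b * (a + d) * (b + d) = b ^+ 2 * (a + d) + d * (b * (a + d)) by ring.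
  by rewrite lerDl mulr_ge0 ?(ltW d0)// mulr_ge0// ltW.
apply: (le_trans (lerD k1 k2)).
have -> : (b + d) * a + b * (a + d) = 2 * (a * b) + (d * (a + b + 2) - 2 * d) by ring.
rewrite lerD2l; lra.
Qed.

(* The constant 2, enough here, comes from bounding the real and the imaginary
   parts separately. *)
Lemma cauchy_schwarz f g : l2f f -> l2f g ->
  cabs (fock_inner f g) <= 2 * (fock_norm f * fock_norm g).
Proof.
move=> hf hg; rewrite !fock_normE//; apply: le_2sqrt; rewrite ?sqnorm_ge0// => s s0.
pose G p := 2^-1 * (s * (cabs (f (toC p)) ^+ 2 * gauss_density (toC p)) +
   s^-1 * (cabs (g (toC p)) ^+ 2 * gauss_density (toC p))).
have iG : rint mu2 G.
  exact: (rintZ _ (rintD (rintZ _ hf.2) (rintZ _ hg.2))).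
have E : 2 * \int[mu2]_p G p = s * sqnorm f + sqnorm g / s.
  rewrite RintegralZl//; last exact: (rintD (rintZ _ hf.2) (rintZ _ hg.2)).
  rewrite mulrA divff// mul1r RintegralD//; [|exact: (rintZ _ hf.2)|exact: (rintZ _ hg.2)].
  rewrite !RintegralZl//; [|exact: hg.2|exact: hf.2].
  by rewrite [sqnorm g / s]mulrC.
rewrite -E; apply: (cintegral_le (cmeasurable_inner_integrand hf.1 hg.1)) iG => p.
by rewrite cabs_inner_integrand amgm_scaled// gauss_density_ge0.
Qed.

End GaussianWeight.

(** * The reproducing kernel *)

Section ComplexLimits.
Context (R : realType).
Implicit Types (u v : nat -> R[i]) (l : R[i]).

Definition ccvg u l := forall e : R, 0 < e -> \forall n \near \oo, cabs (u n - l) < e.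

Lemma ccvg_bound u l (C : R) (x : R) : 0 <= x < 1 ->
  (forall n, cabs (u n - l) <= C * x ^+ n) -> ccvg u l.
Proof.
move=> /andP[x0 x1] H e e0.
have : (fun n => C * x ^+ n) @ \oo --> C * 0.
  by apply: cvgMl_tmp; apply: cvg_expr; rewrite ger0_norm.
rewrite mulr0 => /cvgrPdist_lt /(_ e e0); apply: filterS => n.
by rewrite sub0r normrN; apply: le_lt_trans; rewrite (le_trans (H n))// ler_norm.
Qed.

Lemma ccvg_unique u l l' : ccvg u l -> ccvg u l' -> l = l'.
Proof.
move=> h h'; apply/eqP; rewrite -subr_eq0 -cabs_eq0 eq_le cabs_ge0 andbT.
apply/ler_addgt0Pr => e e0; rewrite add0r.
have e20 : 0 < e / 2 by rewrite divr_gt0.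
near \oo => n.
rewrite (le_trans (cabs_tri (u n) _ _))// (splitr e) lerD// ltW//.
  by rewrite cabsBC; near: n; exact: h.
by near: n; exact: h'.
Unshelve. all: by end_near. Qed.

Lemma ccvg_ReIm u l : ccvg u l <->
  ((fun n => Re (u n)) @ \oo --> Re l /\ (fun n => Im (u n)) @ \oo --> Im l).
Proof.
split=> [h|[h1 h2] e e0].
  split; apply/cvgrPdist_lt => e e0; have := h e e0; apply: filterS => n.
    by rewrite -cReB cabsBC; apply: le_lt_trans; exact: Re_le_cabs.
  by rewrite -cImB cabsBC; apply: le_lt_trans; exact: Im_le_cabs.
have e20 : 0 < e / 2 by rewrite divr_gt0.
near=> n; rewrite cabsBC (le_lt_trans (cabs_le_ReIm _))// (splitr e) ltrD// ?cReB ?cImB.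
  by near: n; move/cvgrPdist_lt : h1; apply.
by near: n; move/cvgrPdist_lt : h2; apply.
Unshelve. all: by end_near. Qed.

Lemma ccvgMl c u l : ccvg u l -> ccvg (fun n => c * u n) (c * l).
Proof.
move=> h e e0.
have k0 : 0 < cabs c + 1 by rewrite ltr_wpDl// cabs_ge0.
have := h (e / (cabs c + 1)) (divr_gt0 e0 k0); apply: filterS => n.
rewrite ltr_pdivlMr// -mulrBr cabsM => H; apply: le_lt_trans H.
by rewrite mulrC ler_wpM2l ?cabs_ge0// lerDl.
Qed.

End ComplexLimits.

Section ExpSeries.
Context (R : realType).
Implicit Types (f g : R[i] -> R[i]) (z w u : R[i]).

Lemma cdiff_real_line g z (t : R) L : cdiff g (t%:C * z) L ->
  is_derive (t : R^o) 1 (fun s : R^o => Re (g (s%:C * z))) (Re (L * z)).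
Proof.
move=> H; apply: expansion_is_derive => e e0.
have k0 : 0 < cabs z + 1 by rewrite ltr_wpDl// cabs_ge0.
have [d d0 {}H] := H _ (divr_gt0 e0 k0).
exists (d / (cabs z + 1)) => [|h hd]; first exact: divr_gt0.
have hz : cabs (h%:C * z) <= `|h| * (cabs z + 1).
  by rewrite cabsM cabsR ler_wpM2l// lerDl.
have := H (h%:C * z); rewrite -mulrDl -rmorphD /=.
rewrite (le_lt_trans hz) -?ltr_pdivlMr// => /(_ isT) {}H.
have -> : Re (g ((t + h)%:C * z)) - Re (g (t%:C * z)) - Re (L * z) * h =
    Re (g ((t + h)%:C * z) - g (t%:C * z) - L * (h%:C * z)).
  by rewrite !cReB; congr (_ - _); rewrite !cReM !cImM /=; ring.
rewrite (le_trans (Re_le_cabs _))// (le_trans H)//.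
rewrite (le_trans (ler_wpM2l _ hz))// ?divr_ge0 ?(ltW e0) ?(ltW k0)//.
by rewrite mulrCA divfK ?gt_eqF// mulrC.
Qed.

(** The mean value theorem on the segment from 0 to [z], for the real part because it fails for
    complex values. [cdiff_sub_le] adds the imaginary part, whence its factor 2. *)
Lemma Re_mean_value_le g g' z (B : R) : (forall w, cdiff g w (g' w)) ->
  (forall w, cabs w <= cabs z -> cabs (g' w) <= B) ->
  `|Re (g z) - Re (g 0)| <= B * cabs z.
Proof.
move=> dg gB; pose F (s : R^o) : R^o := Re (g (s%:C * z)).
have dF (s : R) : is_derive (s : R^o) 1 F (Re (g' (s%:C * z) * z)).
  exact: cdiff_real_line.
have cF : {within `[0, 1], continuous F}.
  apply: continuous_subspaceT => s; apply/differentiable_continuous/derivable1_diffP.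
  by have [] := dF s.
have [c] := MVT_segment (@ler01 R) (fun s _ => dF s) cF.
rewrite in_itv /= => /andP[c0 c1]; rewrite /F mul1r mul0r subr0 mulr1 => ->.
rewrite (le_trans (Re_le_cabs _))// cabsM ler_wpM2r ?cabs_ge0// gB//.
by rewrite cabsM cabsR ger0_norm// ler_piMl ?cabs_ge0.
Qed.

Lemma cdiff_sub_le g g' z (B : R) : (forall w, cdiff g w (g' w)) ->
  (forall w, cabs w <= cabs z -> cabs (g' w) <= B) ->
  cabs (g z - g 0) <= 2 * (B * cabs z).
Proof.
move=> dg gB; pose c : R[i] := 0 +i* -1.
have c1 : cabs c = 1 by rewrite /= expr0n add0r sqrrN expr1n sqrtr1.
have H1 := Re_mean_value_le dg gB.
have H2 : `|Re (c * g z) - Re (c * g 0)| <= B * cabs z.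
  apply: (@Re_mean_value_le (fun z => c * g z) (fun z => c * g' z)).
    by move=> w; exact: cdiffZ.
  by move=> w hw; rewrite cabsM c1 mul1r gB.
have Rec w : Re (c * w) = Im w by rewrite cReM /= mul0r sub0r mulN1r opprK.
rewrite (le_trans (cabs_le_ReIm _))// cReB cImB mulr_natl mulr2n lerD//.
by rewrite -!Rec.
Qed.

Lemma cdiffX n z : cdiff (fun w => w ^+ n.+1) z (n.+1%:R * z ^+ n).
Proof.
elim: n => [|n ih].
  rewrite expr0 mulr1; have := cdiff_id z.
  by congr (cdiff _ _ _); apply/funext => w; rewrite expr1.
have := cdiffM (cdiff_id z) ih.
rewrite (_ : 1 * _ + _ = n.+2%:R * z ^+ n.+1).
  by congr (cdiff _ _ _); apply/funext => w; rewrite exprS.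
by rewrite mul1r mulrCA -exprS -[n.+2%:R]natr1 mulrDl mul1r addrC.
Qed.

Definition cexp_sum n z := \sum_(i < n) (i`!%:R^-1) * z ^+ i.

Lemma natc_neq0 n : (n.+1%:R : R[i]) != 0.
Proof. by rewrite pnatr_eq0. Qed.

Lemma cdiff_cexp_sum n z : cdiff (cexp_sum n.+1) z (cexp_sum n z).
Proof.
elim: n => [|n ih].
  rewrite /cexp_sum big_ord0; have := cdiff_cst (1 : R[i]) z.
  congr (cdiff _ _ _); apply/funext => w.
  by rewrite big_ord1 expr0 mulr1 fact0 invr1.
have := cdiffD ih (cdiffZ (n.+1`!%:R^-1) (cdiffX n z)).
have -> : cexp_sum n z + n.+1`!%:R^-1 * (n.+1%:R * z ^+ n) = cexp_sum n.+1 z.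
  rewrite /cexp_sum big_ord_recr /=; congr (_ + _).
  rewrite mulrA; congr (_ * _).
  by rewrite factS natrM invfM mulrAC mulVf ?natc_neq0// mul1r.
by congr (cdiff _ _ _); apply/funext => w; rewrite /cexp_sum [RHS]big_ord_recr.
Qed.

(** A single term of the series of [expR (2 r)]; doubling [r] is what produces the geometric factor.
    All comparisons of powers with factorials go through this bound. *)
Lemma pow_fact_le (r : R) n : 0 <= r -> r ^+ n / n`!%:R <= (2^-1) ^+ n * expR (2 * r).
Proof.
move=> r0; have r20 : 0 <= 2 * r by rewrite mulr_ge0.
have H : (2 * r) ^+ n / n`!%:R <= expR (2 * r).
  case: n => [|n]; first by rewrite expr0 fact0 divr1 (le_trans _ (expR_ge1Dx _))// lerDl.
  by rewrite (le_trans _ (expR_ge1Dxn n r20))// lerDr.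
have := ler_wpM2l (_ : 0 <= (2^-1 : R) ^+ n) H; rewrite exprn_ge0 ?invr_ge0// => /(_ isT).
by rewrite mulrA -exprMn mulrA mulVf// mul1r.
Qed.

Lemma cabs_natV n : cabs (n%:R^-1 : R[i]) = n%:R^-1.
Proof. by rewrite cabsV -[n%:R](rmorph_nat (real_complex R)) cabsR ger0_norm. Qed.

Lemma cexp_sum_bound n z : cabs (cexp_sum n z) <= 2 * expR (2 * cabs z).
Proof.
rewrite (le_trans (cabs_sum _ _ _))//.
apply: (@le_trans _ _ (\sum_(i < n) (2^-1) ^+ i * expR (2 * cabs z))).
  apply: ler_sum => i _; rewrite cabsM cabs_natV cabsX mulrC.
  exact: pow_fact_le (cabs_ge0 _).
rewrite -big_distrl /= ler_wpM2r ?expR_ge0//.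
have : (1 - 2^-1) * \sum_(i < n) (2^-1 : R) ^+ i = 1 - 2^-1 ^+ n.
  rewrite -opprB mulNr -subrX1 opprB//.
have : 0 <= (2^-1 : R) ^+ n by rewrite exprn_ge0// invr_ge0.
set s := \sum_(_ < _) _; set t := _ ^+ n; lra.
Qed.

(** In place of a Taylor remainder: the product of [exp (- w)] with the partial sum equals 1 at 0
    and has a small derivative, hence stays close to 1. *)
Lemma cexp_sum_cvg z : ccvg (fun n => cexp_sum n.+1 z) (cexp z).
Proof.
have eN : forall w, cdiff (fun w : R[i] => - w) w (-1).
  move=> w; have := cdiffZ (-1) (cdiff_id w); rewrite mulr1.
  by congr (cdiff _ _ _); apply/funext => v; rewrite mulN1r.
pose r := cabs z.
have r0 : 0 <= r := cabs_ge0 z.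
apply: (@ccvg_bound _ _ _ (2 * expR (4 * r) * r) 2^-1).
  by rewrite invr_ge0 ler0n invf_lt1// ltr1n.
(* [g' w] is a single term of the series, by cancellation. *)
move=> n; pose g w := cexp (- w) * cexp_sum n.+1 w.
have dg w : cdiff g w (- (cexp (- w) * (n`!%:R^-1 * w ^+ n))).
  have := cdiffM (cdiff_comp (eN w) (cdiff_cexp (- w))) (cdiff_cexp_sum n w).
  congr (cdiff _ _ _); rewrite mulrN1 mulNr [cexp_sum n.+1 w]big_ord_recr /=.
  by rewrite -/(cexp_sum n w); ring.
have := @cdiff_sub_le g _ z (expR r * ((2^-1) ^+ n * expR (2 * r))) dg.
have -> : g 0 = 1.
  rewrite /g oppr0 cexp0 mul1r /cexp_sum big_ord_recl expr0 mulr1 fact0 invr1 big1 ?addr0//.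
  by move=> i _; rewrite exprS mul0r mulr0.
move=> H.
have -> : cexp_sum n.+1 z - cexp z = cexp z * (g z - 1).
  rewrite mulrBr mulr1 /g mulrA -cexpD subrr cexp0 mul1r//.
rewrite cabsM cabs_cexp.
have e1 : expR (Re z) <= expR r by rewrite ler_expR (le_trans (ler_norm _))// Re_le_cabs.
apply: (le_trans (ler_pM (expR_ge0 _) (cabs_ge0 _) e1 (H _))).
  move=> w wz; rewrite cabsN cabsM cabs_cexp ler_pM ?cabs_ge0 ?expR_ge0//.
    by rewrite ler_expR cReN (le_trans (ler_norm _))// normrN (le_trans (Re_le_cabs _)).
  rewrite cabsM cabs_natV cabsX mulrC; apply: le_trans (pow_fact_le n r0).
  by rewrite ler_wpM2r ?invr_ge0// lerXn2r// nnegrE// cabs_ge0.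
rewrite -/r (_ : 4 * r = r + r + 2 * r); last by ring.
rewrite !expRD le_eqVlt; apply/orP; left; apply/eqP; ring.
Qed.

End ExpSeries.

Section DominatedConvergence.
Context (R : realType) (m : {measure set (plane R) -> \bar R}).

Lemma rint_dominated (F : nat -> plane R -> R) (f G : plane R -> R) :
  (forall n, measurable_fun setT (F n)) -> measurable_fun setT f ->
  (forall p, (fun n => F n p) @ \oo --> f p) -> (forall n p, `|F n p| <= G p) ->
  rint m G -> (fun n => \int[m]_p F n p) @ \oo --> \int[m]_p f p.
Proof.
move=> mF mf Ff FG iG.
have [] := @dominated_convergence _ _ _ m setT measurableT
  (fun n p => (F n p)%:E) (fun p => (f p)%:E) (fun p => (G p)%:E).
- by move=> n; exact/measurable_EFinP.
- exact/measurable_EFinP.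
- by apply: aeW => p _; apply: cvg_EFin; [exact: nearW|exact: Ff].
- exact: iG.
- by apply: aeW => p n _ /=; rewrite lee_fin.
move=> intf _ H.
by move: H; rewrite (rint_EFin intf) => /fine_cvg.
Qed.

Lemma cintegral_dominated (H : nat -> R[i] -> R[i]) h (G : plane R -> R) :
  (forall n, cmeasurable (H n)) -> cmeasurable h ->
  (forall z, ccvg (fun n => H n z) (h z)) ->
  (forall n p, cabs (H n (toC p)) <= G p) -> rint m G ->
  ccvg (fun n => cintegral m (H n)) (cintegral m h).
Proof.
move=> mH [m1 m2] Hh HG iG; apply/ccvg_ReIm; split => /=.
  apply: (@rint_dominated _ _ G) => //.
  - by move=> n; case: (mH n).
  - by move=> p; have /ccvg_ReIm[] := Hh (toC p).
  - by move=> n p; exact: le_trans (Re_le_cabs _) (HG n p).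
apply: (@rint_dominated _ _ G) => //.
- by move=> n; case: (mH n).
- by move=> p; have /ccvg_ReIm[] := Hh (toC p).
- by move=> n p; exact: le_trans (Im_le_cabs _) (HG n p).
Qed.

End DominatedConvergence.

(** * Gaussian integrability of exponentials and the reproducing formula *)

Section Reproducing.
Context (R : realType).
Local Notation mu2 := (@lebesgue2 R).
Implicit Types (f g h : R[i] -> R[i]) (z w v : R[i]).

(** Completing the square: up to the factor [expR (cabs v ^+ 2)] the integrand is the Gaussian
    centred at [v]. *)
Lemma rint_kernel v :
  rint mu2 (fun p => expR (2 * Re (toC p * conjc v)) * gauss_density (toC p)).
Proof.
have := rintZ (expR (cabs v ^+
  2)) (@rint_shift R (@gauss_density R) (- v) (@rint_gauss_density R)).
apply: eq_integrable => // p _; congr EFin.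
rewrite gauss_density_shift mulrCA -expRD mulrC; congr (expR _ * _).
by ring.
Qed.

(** [|z| <= |x| + |y|], and the right side is one of the four signed sums of [x] and [y]; so the
    integrand is at most the sum of four functions of the form treated in [rint_kernel]. *)
Lemma rint_expabs (s : R) : 0 <= s ->
  rint mu2 (fun p => expR (s * cabs (toC p)) * gauss_density (toC p)).
Proof.
move=> s0; pose K (a b : R) (p : plane R) :=
  expR (2 * Re (toC p * conjc ((a * s / 2) +i* (b * s / 2)))) * gauss_density (toC p).
have iK a b : rint mu2 (K a b) := rint_kernel _.
have KE a b p : K a b p = expR (s * (a * p.1 + b * p.2)) * gauss_density (toC p).
  by congr (expR _ * _); rewrite cReM /toC /=; field.
apply: (rint_le _ _ (rintD (rintD (iK 1 1) (iK 1 (-1))) (rintD (iK (-1) 1) (iK (-1) (-1))))).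
  apply: measurable_funM; last exact: measurable_gauss_density.
  apply: (measurableT_comp (@measurable_expR R)); apply: measurable_funM => //.
  exact: ccont_measurable_cabs (entire_cont (@entire_id R)).
move=> p; rewrite !KE.
have E0 x : 0 <= expR x * gauss_density (toC p) by
  rewrite mulr_ge0 ?expR_ge0 ?gauss_density_ge0.
rewrite ger0_norm//.
have key x : s * cabs (toC p) <= x -> expR (s * cabs (toC p)) * gauss_density (toC p) <=
  expR x * gauss_density (toC p).
  by move=> h; rewrite ler_wpM2r ?gauss_density_ge0// ler_expR.
have abs : s * cabs (toC p) <= s * (`|p.1| + `|p.2|).
  by rewrite ler_wpM2l// cabs_le_ReIm.
have A1 := E0 (s * (1 * p.1 + 1 * p.2)). have A2 := E0 (s * (1 * p.1 + -1 * p.2)).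
have A3 := E0 (s * (-1 * p.1 + 1 * p.2)). have A4 := E0 (s * (-1 * p.1 + -1 * p.2)).
have abs2 : s * cabs (toC p) <= s * (1 * p.1 + 1 * p.2) \/
    s * cabs (toC p) <= s * (1 * p.1 + -1 * p.2) \/
    s * cabs (toC p) <= s * (-1 * p.1 + 1 * p.2) \/
    s * cabs (toC p) <= s * (-1 * p.1 + -1 * p.2).
  rewrite !mul1r !mulN1r; move: abs.
  have [h1|h1] := lerP 0 p.1; have [h2|h2] := lerP 0 p.2;
    rewrite ?(ger0_norm h1) ?(ltr0_norm h1) ?(ger0_norm h2) ?(ltr0_norm h2); tauto.
by case: abs2 => [|[|[|]]] /key /le_trans; apply; lra.
Qed.

Lemma l2f_exp h (C s : R) : cmeasurable h -> 0 <= s ->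
  (forall z, cabs (h z) <= C * expR (s * cabs z)) -> l2f h.
Proof.
move=> mh s0 hC.
apply: (l2f_le mh _ (rintZ (C ^+ 2) (rint_expabs (_ : 0 <= 2 * s)))) => [p|];
  last by rewrite mulr_ge0.
rewrite mulrA ler_wpM2r ?gauss_density_ge0//.
apply: (@le_trans _ _ ((C * expR (s * cabs (toC p))) ^+ 2)).
  by rewrite lerXn2r// nnegrE ?cabs_ge0// (le_trans (cabs_ge0 _) (hC _)).
by rewrite exprMn -expRM_natl mulrA.
Qed.

Lemma fockX n : fock (fun z : R[i] => z ^+ n).
Proof.
apply/fockP; split; first exact: entireX.
apply: (@l2f_exp _ n`!%:R 2) => //; first exact: entire_cmeasurable (@entireX R n).
move=> z; rewrite cabsX.
have f0 : 0 < n`!%:R :> R by rewrite ltr0n fact_gt0.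
rewrite mulrC -ler_pdivrMr//; apply: (le_trans (pow_fact_le n (cabs_ge0 z))).
by rewrite ler_piMl ?expR_ge0// exprn_ile1// ?invr_ge0// invf_le1// ler1n.
Qed.

Lemma Re_le_norm z : Re z <= cabs z.
Proof. exact: le_trans (ler_norm _) (Re_le_cabs _). Qed.

Lemma fock_kernelP w : fock (fock_kernel w).
Proof.
have ek : entire (fock_kernel w).
  exact: (entire_comp (@entire_cexp R) (entireM (@entire_id R) (@entire_cst R _))).
apply/fockP; split=> //.
apply: (@l2f_exp _ 1 (cabs w)) => //; [exact: entire_cmeasurable|exact: cabs_ge0|].
move=> z; rewrite mul1r cabs_cexp ler_expR (le_trans (Re_le_norm _))//.
by rewrite cabsM cabs_conj mulrC.
Qed.

Lemma cexpJ z : conjc (cexp z) = cexp (conjc z).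
Proof.
by apply: complex_ReIm; rewrite ?cReJ ?cImJ ?Re_cexp ?Im_cexp cReJ cImJ
  ?cosN// sinN mulrN.
Qed.

Lemma cexpR (a : R) : cexp a%:C = (expR a)%:C.
Proof. by apply: complex_ReIm; rewrite ?Re_cexp ?Im_cexp /= ?cos0 ?sin0 ?mulr1 ?mulr0. Qed.

(** The Weyl translate [h] of [f] is entire and has the value [f w] at 0. Its product with the
    centred Gaussian is, up to the shift by [w], the integrand of the inner product with the kernel,
    so the radial mean of [h] is the claim. *)
Lemma fock_reproducing f w : fock f -> fock_inner f (fock_kernel w) = f w.
Proof.
move=> /fockP[ef lf].
pose h z := f (z + w) * cexp (- (z * conjc w)).
have eh : entire h.
  apply: entireM; first exact: (entire_comp ef (entireD (@entire_id R) (@entire_cst R _))).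
  apply: (entire_comp (@entire_cexp R)).
  have := entireM (@entire_id R) (@entire_cst R (- conjc w)).
  by congr entire; apply/funext => z; rewrite mulrN.
have hE z : h z * (gauss_density z)%:C = inner_integrand f (fock_kernel w) (z + w).
  have gE : gauss_density (z + w) = gauss_density z * expR (2 * Re (z *
    conjc (- w)) - cabs (- w) ^+ 2).
    by rewrite -gauss_density_shift opprK.
  have cE : cexp (- (z * conjc w)) = conjc (cexp ((z + w) * conjc w)) *
      (expR (2 * Re (z * conjc (- w)) - cabs (- w) ^+ 2))%:C.
    rewrite -cexpR cexpJ -cexpD cabsN cabs_sqr; congr cexp.
    by apply: complex_ReIm; rewrite ?(cReN, cImN, cReM, cImM, cReD, cImD, cReJ, cImJ) /=; ring.
  by rewrite /inner_integrand /fock_kernel /h gE cE rmorphM /=; ring.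
have lh : l2f h.
  apply: (l2f_le (entire_cmeasurable eh) _ (rintZ (expR (cabs w ^+ 2))
    (@rint_shift R (fun z => cabs (f z) ^+ 2 * gauss_density z) w lf.2))) => p.
  have -> : gauss_density (toC p + w) = gauss_density (toC p - - w) by rewrite opprK.
  rewrite gauss_density_shift /h cabsM cabs_cexp exprMn -expRM_natl.
  rewrite le_eqVlt; apply/orP; left; apply/eqP.
  rewrite !(mulrCA (expR (cabs w ^+ 2))) -expRD -mulrA; congr (_ * _).
  rewrite mulrC; congr (_ * expR _).
  rewrite cabsN !(cReN, cReM, cReJ, cImJ, cImN); ring.
have l1 : l2f (fun=> 1 : R[i]) by have /fockP[_] := fockX 0; under eq_fun do rewrite expr0.
have := radial_mean (@measurable_gauss_density R) (@gauss_density_ge0 R) (@rint_gauss_density R) (@gauss_density_rot R) eh.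
rewrite Rint_gauss_density mulr1 /h add0r mul0r oppr0 cexp0 mulr1 => <-; last first.
  by have := l2f_prod lh l1; under eq_fun do rewrite cabs1 mulr1.
rewrite /fock_inner -(cintegral_shift w (cmeasurable_inner_integrand lf.1 _)).
  by congr cintegral; apply/funext => z; rewrite -hE.
by have /fockP[_ []] := fock_kernelP w.
Qed.

End Reproducing.

(** * Power series and Parseval's identity *)

Section PowerSeries.
Context (R : realType).
Implicit Types (a b : nat -> R[i]) (z w : R[i]).

Definition partial_series a N z := \sum_(i < N) a i * z ^+ i.

(** Infinite radius of convergence, stated as boundedness of the terms at every radius: the bound at
    radius [2 (r + 1)] yields geometric decay on the disk of radius [r]. *)
Definition entire_coef a := forall L : R, 0 < L -> exists C : R, forall n,
  cabs (a n) * L ^+ n <= C.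

(* Meaningful only when the series converges, as it does under [entire_coef]. *)
Definition power_series a z : R[i] :=
  limn (fun n => Re (partial_series a n z)) +i* limn (fun n => Im (partial_series a n z)).

Lemma sum_half_le n : \sum_(i < n) (2^-1 : R) ^+ i <= 2.
Proof.
have : (1 - 2^-1) * \sum_(i < n) (2^-1 : R) ^+ i = 1 - 2^-1 ^+ n.
  by rewrite -opprB mulNr -subrX1 opprB.
have : 0 <= (2^-1 : R) ^+ n by rewrite exprn_ge0// invr_ge0.
set s := \sum_(_ < _) _; set t := _ ^+ n; lra.
Qed.

Lemma entire_coef_term a (r : R) : entire_coef a -> 0 <= r -> exists2 C : R, 0 <= C &
  forall n z, cabs z <= r -> cabs (a n * z ^+ n) <= C * 2^-1 ^+ n.
Proof.
move=> ea r0; have [|C HC] := ea (2 * (r + 1)); first by rewrite mulr_gt0// ltr_wpDl.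
exists C => [|n z zr]; first by have := HC 0%N; rewrite expr0 mulr1; apply: le_trans;
  exact: cabs_ge0.
have h0 : 0 < (2^-1 : R) ^+ n by rewrite exprn_gt0// invr_gt0.
apply: le_trans (ler_wpM2r (ltW h0) (HC n)).
rewrite cabsM cabsX -mulrA -exprMn ler_wpM2l ?cabs_ge0//.
have -> : 2 * (r + 1) / 2 = r + 1 by field.
by rewrite lerXn2r// ?nnegrE ?cabs_ge0//; [rewrite addr_ge0|rewrite (le_trans zr)// lerDl].
Qed.

Lemma partial_series_bound a (r : R) : entire_coef a -> 0 <= r -> exists2 B : R, 0 <= B &
  forall n z, cabs z <= r -> cabs (partial_series a n z) <= B.
Proof.
move=> ea r0; have [C C0 HC] := entire_coef_term ea r0.
exists (C * 2) => [|n z zr]; first by rewrite mulr_ge0.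
rewrite (le_trans (cabs_sum _ _ _))//.
apply: (le_trans (ler_sum _ (fun (i : 'I_n) _ => HC i z zr))).
by rewrite -big_distrr /= ler_wpM2l// sum_half_le.
Qed.

Lemma power_series_cvg a z : entire_coef a ->
  ccvg (fun n => partial_series a n z) (power_series a z).
Proof.
move=> ea; have [C C0 HC] := entire_coef_term ea (cabs_ge0 z).
have cv (p : R[i] -> R) : (forall u v, p (u + v) = p u + p v) -> p 0 = 0 ->
    (forall u, `|p u| <= cabs u) -> cvgn (fun n => p (partial_series a n z)).
  move=> pD p0 pc.
  have -> : (fun n => p (partial_series a n z)) = series (fun i => p (a i * z ^+ i)).
    apply/funext => n; rewrite /partial_series /series /= big_mkord.
    by rewrite (big_morph p pD p0).
  apply: normed_cvg; apply: (@series_le_cvg _ _ (fun n => C * 2^-1 ^+ n)).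
  - by move=> n; exact: normr_ge0.
  - by move=> n; rewrite mulr_ge0// exprn_ge0// invr_ge0.
  - by move=> n /=; apply: le_trans (pc _) (HC n z (lexx _)).
  - apply: is_cvg_geometric_series; rewrite ger0_norm ?invr_ge0//.
    by rewrite invf_lt1// ltr1n.
by apply/ccvg_ReIm; split;
  [exact: (cv _ (@cReD R) erefl (@Re_le_cabs R))|exact: (cv _ (@cImD R) erefl (@Im_le_cabs R))].
Qed.

Lemma ccvg_le (u : nat -> R[i]) l (B : R) : ccvg u l -> (forall n, cabs (u n) <= B) ->
  cabs l <= B.
Proof.
move=> ul uB; apply/ler_addgt0Pr => e e0; near \oo => n.
rewrite -[l](subrK (u n)) (le_trans (cabsD _ _))// addrC lerD// ltW// cabsBC.
by near: n; exact: ul.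
Unshelve. all: by end_near. Qed.

Lemma ccvgD (u v : nat -> R[i]) l m : ccvg u l -> ccvg v m ->
  ccvg (fun n => u n + v n) (l + m).
Proof.
move=> hu hv e e0; have e20 : 0 < e / 2 by rewrite divr_gt0.
near=> n; have -> : u n + v n - (l + m) = (u n - l) + (v n - m) by ring.
rewrite (le_lt_trans (cabsD _ _))// (splitr e) ltrD//; near: n; [exact: hu|exact: hv].
Unshelve. all: by end_near. Qed.

Lemma ccvg_shift (u : nat -> R[i]) l : ccvg u l -> ccvg (fun n => u n.+1) l.
Proof.
move=> h e e0; have [N _ HN] := h e e0; exists N => // n /= Nn.
by apply: HN => /=; exact: leqW.
Qed.

Definition dcoef a n : R[i] := n.+1%:R * a n.+1.

(** The factor [n + 1 <= 2^(n + 1)] is paid for by doubling the radius. *)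
Lemma entire_coef_dcoef a : entire_coef a -> entire_coef (dcoef a).
Proof.
move=> ea L L0; have L20 : 0 < 2 * L by rewrite mulr_gt0.
have [C HC] := ea _ L20; exists (C / L) => n.
rewrite ler_pdivlMr// -mulrA -exprSr cabsM.
have -> : cabs (n.+1%:R : R[i]) = n.+1%:R.
  by rewrite -[n.+1%:R](rmorph_nat (real_complex R)) cabsR ger0_norm.
apply: le_trans (HC n.+1); rewrite mulrAC mulrC ler_wpM2l ?cabs_ge0// exprMn.
by rewrite ler_wpM2r ?exprn_ge0 ?(ltW L0)// -natrX ler_nat ltnW// ltn_expl.
Qed.

Lemma cdiff_partial_series a N z :
  cdiff (partial_series a N.+1) z (partial_series (dcoef a) N z).
Proof.
elim: N => [|n ih].
  rewrite /partial_series big_ord0; have := cdiff_cst (a 0%N) z.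
  congr (cdiff _ _ _); apply/funext => w.
  by rewrite big_ord1 expr0 mulr1.
have := cdiffD ih (cdiffZ (a n.+1) (cdiffX n z)).
have -> : partial_series (dcoef a) n z + a n.+1 * (n.+1%:R * z ^+ n) =
  partial_series (dcoef a) n.+1 z.
  by rewrite /partial_series big_ord_recr /= /dcoef; congr (_ + _); ring.
by congr (cdiff _ _ _); apply/funext => w; rewrite /partial_series [RHS]big_ord_recr.
Qed.

(** Two mean value inequalities bound the first-order remainder of every partial sum by [4 B |h|^2],
    where [B] bounds the partial sums of the second derivative on the disk of radius [|z| + 1]. As
    [B] does not depend on [N], the bound passes to the limit. *)
Lemma cdiff_power_series a z : entire_coef a ->
  cdiff (power_series a) z (power_series (dcoef a) z).
Proof.
move=> ea e e0.
have ed := entire_coef_dcoef ea; have edd := entire_coef_dcoef ed.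
have r0 : 0 <= cabs z + 1 by rewrite addr_ge0// cabs_ge0.
have [B B0 HB] := partial_series_bound edd r0.
exists (Num.min 1 (e / (4 * B + 1))).
  by rewrite lt_min ltr01 divr_gt0// ltr_wpDl// mulr_ge0.
move=> h; rewrite lt_min => /andP[h1 h2].
(* Differentiating a partial sum drops one term: the lengths are [N.+2], [N.+1] and [N]. *)
have K N : cabs (partial_series a N.+2 (z +
  h) - partial_series a N.+2 z - partial_series (dcoef a) N.+1 z * h)
    <= 2 * ((2 * (B * cabs h)) * cabs h).
  pose g w := partial_series a N.+2 (z + w) + (- partial_series a N.+2 z +
    - partial_series (dcoef a) N.+1 z * w).
  have ds w : cdiff (fun w => z + w) w 1.
    by have := cdiffD (cdiff_cst z w) (cdiff_id w); rewrite add0r.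
  have dg w : cdiff g w (partial_series (dcoef a) N.+1 (z + w) +
    - partial_series (dcoef a) N.+1 z).
    have := cdiffD (cdiff_comp (ds w) (cdiff_partial_series a N.+1 (z + w)))
      (cdiffD (cdiff_cst (- partial_series a N.+2 z) w) (cdiffZ (- partial_series (dcoef a) N.+1 z) (cdiff_id w))).
    by rewrite add0r !mulr1.
  have dd w : cdiff (fun w => partial_series (dcoef a) N.+1 (z +
    w)) w (partial_series (dcoef (dcoef a)) N (z + w)).
    by have := cdiff_comp (ds w) (cdiff_partial_series (dcoef a) N (z + w)); rewrite mulr1.
  have := @cdiff_sub_le _ g _ h (2 * (B * cabs h)) dg.
  rewrite /g addr0 mulr0 addr0 subrr subr0 mulNr addrA; apply=> w wh.
  have := @cdiff_sub_le _ _ _ w B dd; rewrite addr0 => H.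
  apply: (le_trans (H _)); last by rewrite ler_wpM2l// ler_wpM2l.
  move=> v vw; apply: HB; rewrite (le_trans (cabsD _ _))// lerD2l.
  by rewrite (le_trans vw)// (le_trans wh)// ltW.
have L := ccvgD (ccvgD (ccvg_shift (ccvg_shift (power_series_cvg (z + h) ea)))
   (ccvgMl (-1) (ccvg_shift (ccvg_shift (power_series_cvg z ea)))))
   (ccvgMl (- h) (ccvg_shift (power_series_cvg z ed))).
have := ccvg_le L (B := 2 * ((2 * (B * cabs h)) * cabs h)) _.
rewrite !mulN1r mulNr [h * _]mulrC => H; apply: (le_trans (H _)).
  by move=> n; rewrite mulN1r mulNr [h * _]mulrC; exact: K.
rewrite mulrA ler_wpM2r ?cabs_ge0//.
move: h2; rewrite ltr_pdivlMr ?ltr_wpDl ?mulr_ge0//.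
have := cabs_ge0 h; set t := cabs h; nra.
Qed.

Definition dcoefn k a := iter k dcoef a.

Lemma entire_coef_dcoefn k a : entire_coef a -> entire_coef (dcoefn k a).
Proof. by move=> ea; elim: k => [//|k ih]; exact: entire_coef_dcoef. Qed.

Lemma cderiv0 (f : R[i] -> R[i]) : cderiv 0 f = f.
Proof. by rewrite /cderiv derive1n0. Qed.

Lemma cderivS n (f : R[i] -> R[i]) : cderiv n.+1 f = cderiv 1 (cderiv n f).
Proof. by rewrite /cderiv derive1nS derive1n1. Qed.

Lemma cderiv_power_series k a : entire_coef a ->
  cderiv k (power_series a) = power_series (dcoefn k a).
Proof.
move=> ea; elim: k => [|k ih]; first by rewrite cderiv0.
rewrite cderivS ih; apply: cderivE => z.
exact: cdiff_power_series (entire_coef_dcoefn k ea).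
Qed.

Lemma entire_power_series a : entire_coef a -> entire (power_series a).
Proof. by move=> ea; apply: entireI => z; exact: cdiff_power_series. Qed.

Lemma pser0 a : entire_coef a -> power_series a 0 = a 0%N.
Proof.
move=> ea; apply: (ccvg_unique (ccvg_shift (power_series_cvg 0 ea))) => e e0.
exists 0%N => // n _ /=; rewrite /partial_series big_ord_recl expr0 mulr1 big1 ?addr0.
  by rewrite subrr cabs0.
by move=> i _; rewrite exprS mul0r mulr0.
Qed.

Lemma dcoefn_fact k a n : dcoefn k a n * n`!%:R = (n + k)`!%:R * a (n + k)%N.
Proof.
elim: k n => [|k ih] n; first by rewrite addn0 mulrC.
rewrite /dcoefn iterS -/(dcoefn k a) /dcoef addnS -addSn -ih factS natrM.
by ring.
Qed.

Lemma cderiv_pser0 k a : entire_coef a -> cderiv k (power_series a) 0 = k`!%:R * a k.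
Proof.
move=> ea; rewrite cderiv_power_series// pser0; last exact: entire_coef_dcoefn.
by have := dcoefn_fact k a 0; rewrite fact0 mulr1 add0n.
Qed.

End PowerSeries.

Section FockSeries.
Context (R : realType).
Local Notation mu2 := (@lebesgue2 R).
Implicit Types (f g h : R[i] -> R[i]) (z w : R[i]) (a c : nat -> R[i]).

Definition monomial (n : nat) z : R[i] := z ^+ n.

(* Indeed [z^n] is orthogonal to the other monomials and has squared norm [n!]. *)
Definition taylor_coef f n : R[i] := n`!%:R^-1 * fock_inner f (monomial n).

Lemma fock_monomial n : fock (monomial n). Proof. exact: fockX. Qed.
Lemma fock_l2f f : fock f -> l2f f. Proof. by move=> /fockP[]. Qed.
Lemma l2f_monomial n : l2f (monomial n). Proof. exact/fock_l2f/fock_monomial. Qed.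
Lemma fock_entire f : fock f -> entire f. Proof. by case. Qed.

Lemma fock_lin (b : R[i]) f g : fock f -> fock g -> fock (fun z => b * f z + g z).
Proof.
move=> /fockP[ef lf] /fockP[eg lg]; apply/fockP; split; last exact: l2f_lin.
exact: (entireD (entireM (@entire_cst R _) ef) eg).
Qed.

Lemma fock0 : fock (fun=> 0 : R[i]).
Proof. by apply/fockP; split; [exact: entire_cst|exact: l2f_cst0]. Qed.

Lemma fock_sub f g : fock f -> fock g -> fock (fun z => f z - g z).
Proof.
move=> hf hg; have := fock_lin (-1) hg hf.
by congr fock; apply/funext => z; rewrite mulN1r addrC.
Qed.

Lemma fock_partial_series c N : fock (partial_series c N).
Proof.
elim: N => [|n ih].
  by have := fock0; congr fock; apply/funext => z; rewrite /partial_series big_ord0.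
have := fock_lin (c n) (fock_monomial n) ih.
by congr fock; apply/funext => z; rewrite /partial_series big_ord_recr /= addrC.
Qed.

Lemma fock_inner0r f : fock_inner f (fun=> 0 : R[i]) = 0.
Proof.
rewrite /fock_inner (_ : (fun z => _) = (fun=> (0 : R)%:C)).
  by rewrite (cintegralR mu2 (fun=> 0)) Rintegral_cst// mul0r.
by apply/funext => z; rewrite conjc0 mulr0 mul0r.
Qed.

Lemma fock_inner_partial_series f c N : l2f f ->
  fock_inner f (partial_series c N) = \sum_(i < N) conjc (c i) * fock_inner f (monomial i).
Proof.
move=> lf; elim: N => [|n ih].
  rewrite big_ord0 -(fock_inner0r f); congr fock_inner.
  by apply/funext => z; rewrite /partial_series big_ord0.
rewrite big_ord_recr /= -ih addrC -fock_inner_linr//; last 2 first.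
- exact: l2f_monomial.
- exact/fock_l2f/fock_partial_series.
by congr fock_inner; apply/funext => z; rewrite /partial_series big_ord_recr /= addrC.
Qed.

(** [L^n |z|^n / n! <= expR (2 L |z|)], and the right side is square integrable for the Gaussian;
    hence one integral, independent of [n], controls every term. *)
Lemma taylor_coef_entire_coef f : l2f f -> entire_coef (taylor_coef f).
Proof.
move=> lf L L0; have L20 : 0 <= 2 * L by rewrite mulr_ge0// ltW.
pose E z : R[i] := (expR (2 * L * cabs z))%:C.
have mE : cmeasurable E.
  apply: cmeasR; apply: (measurableT_comp (@measurable_expR R)).
  apply: measurable_funM => //.
  exact: ccont_measurable_cabs (entire_cont (@entire_id R)).
have cE z : cabs (E z) = expR (2 * L * cabs z) by rewrite cabsR ger0_norm ?expR_ge0.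
have lE : l2f E by apply: (@l2f_exp _ _ 1 (2 * L)) => // z; rewrite mul1r cE.
pose G p := cabs (f (toC p)) * cabs (E (toC p)) * gauss_density (toC p).
have iG : rint mu2 G := l2f_prod lf lE.
exists (2 * \int[mu2]_p G p) => n.
have f0 : 0 < n`!%:R :> R by rewrite ltr0n fact_gt0.
have Ln : 0 < L ^+ n by rewrite exprn_gt0.
have k0 : 0 < n`!%:R / L ^+ n by rewrite divr_gt0.
have := cintegral_le (cmeasurable_inner_integrand lf.1 (l2f_monomial n).1) _ (rintZ (n`!%:R / L ^+ n) iG).
rewrite RintegralZl// => H.
rewrite cabsM cabs_natV mulrAC mulrC.
apply: (le_trans (ler_wpM2r _ (H _))); first by rewrite mulr_ge0 ?invr_ge0 ?ltW.
  move=> p; rewrite cabs_inner_integrand /G.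
  have -> : n`!%:R / L ^+ n * (cabs (f (toC p)) * cabs (E (toC p)) * gauss_density (toC p)) =
    cabs (f (toC p)) * (n`!%:R / L ^+ n * cabs (E (toC p))) * gauss_density (toC p) by ring.
  have Lz : 0 <= cabs (toC p) * L by rewrite mulr_ge0 ?cabs_ge0// ltW.
  have key : (cabs (toC p) * L) ^+ n / n`!%:R <= cabs (E (toC p)).
    rewrite (le_trans (pow_fact_le n Lz))// cE.
    rewrite [cabs _ * L]mulrC mulrA ler_piMl ?expR_ge0// exprn_ile1 ?invr_ge0//.
    by rewrite invf_le1// ler1n.
  rewrite ler_wpM2r ?gauss_density_ge0// ler_wpM2l ?cabs_ge0// /monomial cabsX.
  by rewrite mulrAC ler_pdivlMr// -exprMn [n`!%:R * _]mulrC -ler_pdivrMr.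
rewrite le_eqVlt; apply/orP; left; apply/eqP.
by field; rewrite !gt_eqF.
Qed.

Lemma conjc_natV n : conjc (n%:R^-1 : R[i]) = n%:R^-1.
Proof. by rewrite conjc_inv conjc_nat. Qed.

Lemma ccvgJ (u : nat -> R[i]) l : ccvg u l -> ccvg (fun n => conjc (u n)) (conjc l).
Proof.
move=> h e /h; apply: filterS => n.
by rewrite -(rmorphB (@conjc R)) cabs_conj.
Qed.

Lemma ccvg_cabs (u : nat -> R[i]) l : ccvg u l -> (fun n => cabs (u n)) @ \oo --> cabs l.
Proof.
move=> h; apply/cvgrPdist_lt => e /h; apply: filterS => n.
apply: le_lt_trans; rewrite ler_norml; apply/andP; split.
  by rewrite lerNl opprB cabs_sub.
by rewrite cabsBC cabs_sub.
Qed.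

(** The kernel is expanded, not [f]. The inner products of [f] with the partial sums of the kernel
    at [w] are the partial sums of the series at [w]; dominated convergence and the reproducing
    formula identify their limit as [f w]. *)
Lemma fock_power_series f : fock f -> f = power_series (taylor_coef f).
Proof.
move=> hf; have lf := fock_l2f hf; apply/funext => w.
apply: (@ccvg_unique _ (fun n => partial_series (taylor_coef f) n.+1 w)); last first.
  exact: ccvg_shift (power_series_cvg _ (taylor_coef_entire_coef lf)).
pose c i : R[i] := i`!%:R^-1 * conjc w ^+ i.
have cE n z : cexp_sum n (z * conjc w) = partial_series c n z.
  by apply: eq_bigr => i _; rewrite /c exprMn; ring.
have sE n : partial_series (taylor_coef f) n w = fock_inner f (partial_series c n).
  rewrite fock_inner_partial_series//; apply: eq_bigr => i _.
  rewrite /c /taylor_coef cJM conjc_natV -(rmorphXn (@conjc R)) cJK.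
  ring.
have -> : (fun n => partial_series (taylor_coef f) n.+1 w) =
  (fun n => fock_inner f (partial_series c n.+1)).
  by apply/funext => n; rewrite sE.
rewrite -(fock_reproducing w hf).
have lk := fock_l2f (fock_kernelP w).
pose E z : R[i] := (2 * expR (2 * cabs w * cabs z))%:C.
have mE : cmeasurable E.
  apply: cmeasR; apply: measurable_funM => //.
  apply: (measurableT_comp (@measurable_expR R)).
  apply: measurable_funM => //.
  exact: ccont_measurable_cabs (entire_cont (@entire_id R)).
have cabsE z : cabs (E z) = 2 * expR (2 * cabs w * cabs z).
  by rewrite cabsR ger0_norm// mulr_ge0// expR_ge0.
have lE : l2f E.
  apply: (@l2f_exp _ _ 2 (2 * cabs w)) => //; first by rewrite mulr_ge0// cabs_ge0.
  by move=> z; rewrite cabsE.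
apply: (cintegral_dominated _ _ _ _ (l2f_prod lf lE)).
- move=> n; apply: cmeasurable_inner_integrand; first exact: lf.1.
  exact: (fock_l2f (fock_partial_series _ _)).1.
- exact: cmeasurable_inner_integrand lf.1 lk.1.
- move=> z; have H : ccvg (fun n => partial_series c n.+1 z) (fock_kernel w z).
    have := cexp_sum_cvg (z * conjc w).
    by congr ccvg; apply/funext => n; rewrite cE.
  have := ccvgMl (f z * (gauss_density z)%:C) (ccvgJ H).
  by congr ccvg; [apply/funext => n|]; rewrite /inner_integrand mulrAC.
- move=> n p; rewrite cabs_inner_integrand ler_wpM2r ?gauss_density_ge0// ler_wpM2l ?cabs_ge0//.
  rewrite -cE cabsE (le_trans (cexp_sum_bound _ _))// cabsM cabs_conj.
  by rewrite [cabs (toC p) * _]mulrC mulrA.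
Qed.

Definition delta_coef (n i : nat) : R[i] := (i == n)%:R.

Lemma entire_coef_delta_coef n : entire_coef (delta_coef n).
Proof.
move=> L L0; exists (L ^+ n) => i; rewrite /delta_coef; case: eqP => [->|_].
  by rewrite cabs1 mul1r.
by rewrite cabs0 mul0r exprn_ge0// ltW.
Qed.

Lemma partial_series_delta_coef n N z : (n < N)%N -> partial_series (delta_coef n) N z = z ^+ n.
Proof.
move=> nN; rewrite /partial_series (bigD1 (Ordinal nN))//= /delta_coef eqxx mul1r big1 ?addr0//.
by move=> i /eqP ni; case: eqP => [e|_]; [case: ni; exact: val_inj|rewrite mul0r].
Qed.

Lemma monomial_power_series n : monomial n = power_series (delta_coef n).
Proof.
apply/funext => z; apply:
  (ccvg_unique _ (power_series_cvg z (entire_coef_delta_coef n))) => e e0.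
by exists n.+1 => // N /= nN; rewrite partial_series_delta_coef// subrr cabs0.
Qed.

Lemma fact_neq0 n : (n`!%:R : R[i]) != 0.
Proof. by rewrite pnatr_eq0 -lt0n fact_gt0. Qed.

(** Both sides are determined by the derivatives of [f] at 0. *)
Lemma taylor_coef_unique f a n : fock f -> entire_coef a -> f = power_series a ->
  taylor_coef f n = a n.
Proof.
move=> hf ea fa; apply: (mulfI (fact_neq0 n)).
by rewrite -!cderiv_pser0//; [rewrite -fock_power_series//
  fa|exact/taylor_coef_entire_coef/fock_l2f].
Qed.

Lemma fock_inner_taylor_coef f n : fock_inner f (monomial n) = n`!%:R * taylor_coef f n.
Proof. by rewrite /taylor_coef mulrA mulfV ?fact_neq0// mul1r. Qed.

(** Orthogonality without polar coordinates: a monomial is its own power series, and uniqueness of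
    the coefficients computes the inner products by which [taylor_coef] is defined. *)
Lemma fock_inner_monomial n m : fock_inner (monomial n) (monomial m) = m`!%:R * (m == n)%:R.
Proof.
by rewrite fock_inner_taylor_coef (taylor_coef_unique _ (fock_monomial n) (entire_coef_delta_coef n) (monomial_power_series n)).
Qed.

Definition coef_sqnorm a N : R := \sum_(i < N) i`!%:R * cabs (a i) ^+ 2.

Lemma sqnorm_lin (b : R[i]) f g : l2f f -> l2f g ->
  (sqnorm (fun z => b * f z + g z))%:C =
  b * conjc b * (sqnorm f)%:C + b * fock_inner f g + conjc b * fock_inner g f + (sqnorm g)%:C.
Proof.
move=> lf lg; rewrite -!fock_inner_norm fock_inner_linl ?fock_inner_linr//; try exact: l2f_lin.
ring.
Qed.

Lemma sqnorm_monomial n : sqnorm (monomial n) = n`!%:R.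
Proof.
apply: (@complexI R); rewrite -fock_inner_norm fock_inner_monomial eqxx mulr1.
by rewrite rmorph_nat.
Qed.

(** One monomial is removed at a time. The terms already subtracted are orthogonal to [monomial n],
    so the remainder [g] still has the same inner product with it as [f]. *)
Lemma bessel f N : l2f f -> sqnorm (fun z => f z - partial_series (taylor_coef f) N z) =
  sqnorm f - coef_sqnorm (taylor_coef f) N.
Proof.
move=> lf; elim: N => [|n ih].
  rewrite /coef_sqnorm big_ord0 subr0; congr sqnorm; apply/funext => z.
  by rewrite /partial_series big_ord0 subr0.
pose g z := f z - partial_series (taylor_coef f) n z.
have lg : l2f g by apply: l2f_sub => //; exact/fock_l2f/fock_partial_series.
have ge : fock_inner g (monomial n) = n`!%:R * taylor_coef f n.
  have -> : g = (fun z => -1 * partial_series (taylor_coef f) n z + f z).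
    by apply/funext => z; rewrite mulN1r addrC.
  rewrite fock_inner_linl//; [|exact/fock_l2f/fock_partial_series|exact: l2f_monomial].
  rewrite fock_innerC; [|exact: l2f_monomial|exact/fock_l2f/fock_partial_series].
  rewrite fock_inner_partial_series; last exact: l2f_monomial.
  rewrite big1 ?conjc0 ?mulr0 ?add0r ?fock_inner_taylor_coef//.
  by move=> i _; rewrite fock_inner_monomial ltn_eqF// !mulr0.
have := sqnorm_lin (- taylor_coef f n) (l2f_monomial n) lg.
rewrite (fock_innerC lg (l2f_monomial n)) ge sqnorm_monomial ih.
have -> : (fun z => - taylor_coef f n * monomial n z + g z) =
  (fun z => f z - partial_series (taylor_coef f) n.+1 z).
  by apply/funext => z; rewrite /g /partial_series big_ord_recr /= /monomial; ring.
move=> H; apply: (@complexI R); rewrite H /coef_sqnorm big_ord_recr /=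
  -/(coef_sqnorm (taylor_coef f) n).
have -> : (sqnorm f - (coef_sqnorm (taylor_coef f) n + n`!%:R * cabs (taylor_coef f n) ^+
  2))%:C =
    (sqnorm f - coef_sqnorm (taylor_coef f) n)%:C - n`!%:R * (taylor_coef f n *
      conjc (taylor_coef f n)).
  by rewrite mulcJ -(rmorph_nat (real_complex R)) -rmorphM -rmorphB opprD addrA.
have -> : (n`!%:R : R)%:C = n`!%:R by exact: (rmorph_nat (real_complex R)).
rewrite cJM conjc_nat (rmorphN (@conjc R)) /=; ring.
Qed.

Lemma bessel_le f N : l2f f -> coef_sqnorm (taylor_coef f) N <= sqnorm f.
Proof. by move=> lf; rewrite -subr_ge0 -bessel// sqnorm_ge0. Qed.

Lemma fatou_sqnorm (u : nat -> R[i] -> R[i]) h (B : R) : (forall n, l2f (u n)) ->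
  cmeasurable h ->
  (forall z, ccvg (fun n => u n z) (h z)) -> (forall n, sqnorm (u n) <= B) ->
  l2f h /\ sqnorm h <= B.
Proof.
move=> lu mh uh uB.
pose F n (p : plane R) := (cabs (u n (toC p)) ^+ 2 * gauss_density (toC p))%:E.
have mF n : measurable_fun setT (F n).
  apply/measurable_EFinP; apply: measurable_funM; last exact: measurable_gauss_density.
  by apply: measurable_funX; apply: cmeasurable_cabs; exact: (lu n).1.
have F0 n p : setT p -> (0%R <= F n p)%E.
  by rewrite lee_fin mulr_ge0 ?gauss_density_ge0// exprn_ge0// cabs_ge0.
have cF p : (fun n => F n p) @ \oo --> (cabs (h (toC p)) ^+ 2 * gauss_density (toC p))%:E.
  apply: cvg_EFin; first exact: nearW.
  have cu := ccvg_cabs (uh (toC p)).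
  by apply: cvgMr_tmp; rewrite expr2; under eq_fun do rewrite expr2; exact: cvgM.
have := @fatou _ _ _ mu2 setT measurableT F mF F0.
have -> : (fun p => limn_einf (F^~ p)) = (fun p => (cabs (h (toC p)) ^+ 2 *
  gauss_density (toC p))%:E).
  apply/funext => p; rewrite is_cvg_limn_einfE; last by apply/cvg_ex; eexists; exact: cF.
  exact: cvg_lim (cF p).
move=> H.
have HB : (\int[mu2]_p (cabs (h (toC p)) ^+ 2 * gauss_density (toC p))%:E <= B%:E)%E.
  apply: (le_trans H); rewrite limn_einf_lim; apply: lime_le.
    exact: is_cvg_einfs.
  near=> n; apply: (@le_trans _ _ (\int[mu2]_p F n p)%E).
    by apply: ereal_inf_lbound; exists n => //=.
  by rewrite rint_EFin ?lee_fin; [exact: uB|exact: (lu n).2].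
have lh : l2f h.
  split=> //; apply: ge0_rint.
  - apply: measurable_funM; last exact: measurable_gauss_density.
    by apply: measurable_funX; exact: cmeasurable_cabs.
  - by move=> p; rewrite mulr_ge0 ?gauss_density_ge0// exprn_ge0// cabs_ge0.
  - exact: le_lt_trans HB (ltry _).
by split=> //; rewrite -lee_fin -fock_norm2E// /fock_norm2.
Unshelve. all: by end_near. Qed.

Lemma coef_sqnorm_le a N M : (N <= M)%N -> coef_sqnorm a N <= coef_sqnorm a M.
Proof.
move=> NM; rewrite /coef_sqnorm -(big_mkord xpredT (fun i => i`!%:R * cabs (a i) ^+ 2)).
rewrite -(big_mkord xpredT (fun i => i`!%:R * cabs (a i) ^+ 2)).
rewrite [leRHS](big_cat_nat (leq0n N) NM) /=.
by rewrite lerDl sumr_ge0// => i _; rewrite mulr_ge0// exprn_ge0// cabs_ge0.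
Qed.

Lemma coef_sqnorm_entire_coef a (B : R) : (forall N, coef_sqnorm a N <= B) -> entire_coef a.
Proof.
move=> aB L L0; exists (Num.sqrt (B * expR (L ^+ 2 * 2))) => n.
have B0 : 0 <= B by have := aB 0%N; rewrite /coef_sqnorm big_ord0.
have an0 : 0 <= cabs (a n) * L ^+ n by rewrite mulr_ge0 ?cabs_ge0 ?exprn_ge0 ?ltW.
rewrite -[leLHS]ger0_norm// -sqrtr_sqr ler_sqrt ?mulr_ge0 ?expR_ge0//.
have f0 : 0 < n`!%:R :> R by rewrite ltr0n fact_gt0.
have H : n`!%:R * cabs (a n) ^+ 2 <= B.
  apply: le_trans (aB n.+1); rewrite /coef_sqnorm big_ord_recr /= lerDr sumr_ge0// => i _.
  by rewrite mulr_ge0// exprn_ge0// cabs_ge0.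
have -> : (cabs (a n) * L ^+ n) ^+ 2 = n`!%:R * cabs (a n) ^+ 2 * ((L ^+ 2) ^+ n / n`!%:R).
  by rewrite exprMn -!exprM mulnC; field; rewrite gt_eqF.
have L2 : 0 <= L ^+ 2 by rewrite exprn_ge0// ltW.
apply: ler_pM => //; first by rewrite mulr_ge0// exprn_ge0// cabs_ge0.
  by rewrite divr_ge0// exprn_ge0.
apply: (le_trans (pow_fact_le n L2)); rewrite [2 * _]mulrC ler_piMl ?expR_ge0//.
by rewrite exprn_ile1 ?invr_ge0// invf_le1// ler1n.
Qed.

Lemma sqnorm_partial_series a N : sqnorm (partial_series a N) = coef_sqnorm a N.
Proof.
have lp := fock_l2f (fock_partial_series a N).
apply: (@complexI R); rewrite -fock_inner_norm fock_inner_partial_series// rmorph_sum.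
apply: eq_bigr => i _ /=; rewrite fock_innerC//; last exact: l2f_monomial.
rewrite fock_inner_partial_series; last exact: l2f_monomial.
rewrite (bigD1 i)//= big1 ?addr0; last first.
  move=> j ji; rewrite fock_inner_monomial (_ : (j == i :> nat) = false) ?mulr0//.
  by apply/eqP => /val_inj/eqP; rewrite (negbTE ji).
rewrite fock_inner_monomial eqxx mulr1 !cJM cJK conjc_nat mulrA [conjc _ * _]mulrC mulcJ.
by rewrite mulrC -(rmorph_nat (real_complex R)) -rmorphM.
Qed.

(** Completeness of the space in terms of coefficients: the squared norms of the partial sums are
    bounded by [B], and Fatou's lemma carries the bound to the limit. *)
Lemma power_series_fock a (B : R) : (forall N, coef_sqnorm a N <= B) ->
  [/\ fock (power_series a), sqnorm (power_series a) <= B & forall n,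
    taylor_coef (power_series a) n = a n].
Proof.
move=> aB; have ea := coef_sqnorm_entire_coef aB.
have [lp nB] : l2f (power_series a) /\ sqnorm (power_series a) <= B.
  apply: (@fatou_sqnorm (partial_series a)).
  - by move=> n; exact/fock_l2f/fock_partial_series.
  - exact/entire_cmeasurable/entire_power_series.
  - by move=> z; exact: power_series_cvg.
  - by move=> n; rewrite sqnorm_partial_series.
have fp : fock (power_series a) by apply/fockP; split=> //; exact: entire_power_series.
by split=> // n; exact: taylor_coef_unique.
Qed.

(** Bessel's inequality bounds the coefficient sums by [sqnorm f]. The converse is
    [power_series_fock] with [B] equal to their supremum, as [f] is its own power series. *)
Lemma parseval f (e : R) : fock f -> 0 < e ->
  \forall N \near \oo, sqnorm (fun z => f z - partial_series (taylor_coef f) N z) < e.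
Proof.
move=> hf e0; have lf := fock_l2f hf.
have cw : coef_sqnorm (taylor_coef f) @ \oo --> sup (range (coef_sqnorm (taylor_coef f))).
  apply: nondecreasing_cvgn; first by move=> N M; exact: coef_sqnorm_le.
  by exists (sqnorm f) => _ [N _ <-]; exact: bessel_le.
have nf : sqnorm f <= sup (range (coef_sqnorm (taylor_coef f))).
  have H N : coef_sqnorm (taylor_coef f) N <= sup (range (coef_sqnorm (taylor_coef f))).
    apply: ub_le_sup; last by exists N.
    by exists (sqnorm f) => _ [M _ <-]; exact: bessel_le.
  by have [_ + _] := power_series_fock H; rewrite -fock_power_series.
move/cvgrPdist_lt : cw => /(_ e e0); apply: filterS => N H.
rewrite bessel//; apply: le_lt_trans (le_lt_trans (ler_norm _) H).
by rewrite lerB.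
Qed.

End FockSeries.

(** * Local estimates of derivatives *)

Section LocalEstimate.
Context (R : realType).
Local Notation mu := (@lebesgue_measure R).
Local Notation mu2 := (@lebesgue2 R).
Implicit Types (f g h : R[i] -> R[i]) (z w : R[i]).

(** The disk enters through an indicator, so that the same expression is a kernel in two variables
    when Tonelli is applied. *)
Definition local_energy f z (r : R) : R :=
  \int[mu2]_p (\1_(disk z r) p * (cabs (f (toC p)) ^+ 2 * gauss_density (toC p))).

Lemma disk_indicE z (r : R) (p : plane R) :
  \1_(disk z r) p = (if cabs (toC p - z) < r then 1 else 0) :> R.
Proof.
rewrite indicE; case: ifPn => h; first by rewrite mem_set.
by rewrite memNset//; apply/negP.
Qed.

Lemma measurable_indic_disk z (r : R) : measurable_fun setT (\1_(disk z r) : plane R -> R).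
Proof. by apply: measurable_indic; exact: measurable_disk. Qed.

Lemma rint_local f z r : l2f f ->
  rint mu2 (fun p => \1_(disk z r) p * (cabs (f (toC p)) ^+ 2 * gauss_density (toC p))).
Proof.
move=> [mf lf]; apply: (rint_le _ _ lf) => [|p].
  by apply: measurable_funM; [exact: measurable_indic_disk|exact: rint_measurable lf].
have e0 : 0 <= cabs (f (toC p)) ^+ 2 * gauss_density (toC p) by
  rewrite mulr_ge0 ?gauss_density_ge0// exprn_ge0// cabs_ge0.
by rewrite disk_indicE; case: ifP => _; rewrite ?mul1r ?mul0r ?normr0 ?ger0_norm.
Qed.

Lemma local_energy_ge0 f z r : 0 <= local_energy f z r.
Proof.
apply: Rintegral_ge0 => p _; rewrite disk_indicE.
by case: ifP => _; rewrite ?mul1r ?mul0r// mulr_ge0 ?gauss_density_ge0// exprn_ge0// cabs_ge0.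
Qed.

Lemma local_energy_le f z w (r s : R) : l2f f -> cabs (w - z) + r <= s ->
  local_energy f w r <= local_energy f z s.
Proof.
move=> lf rs; apply: le_Rintegral => //; [exact: rint_local|exact: rint_local|].
move=> p _; rewrite !disk_indicE.
have e0 : 0 <= cabs (f (toC p)) ^+ 2 * gauss_density (toC p) by
  rewrite mulr_ge0 ?gauss_density_ge0// exprn_ge0// cabs_ge0.
case: ifP => h1; case: ifPn => h2; rewrite ?mul1r ?mul0r//.
exfalso; move: h2; rewrite -leNgt leNgt => /negP; apply.
by rewrite (le_lt_trans (cabs_tri w _ _))//; lra.
Qed.

(** A radial weight for the mean value property. With radius 1/2, the disks around points at
    distance at most 1/2 from [z] stay in the unit disk of [z], as [local_cderiv] needs. *)
Definition half_disk z : R := if cabs z < 2^-1 then 1 else 0.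

Lemma half_diskE (p : plane R) : half_disk (toC p) = \1_(disk 0 2^-1) p.
Proof. by rewrite disk_indicE subr0. Qed.

Lemma measurable_half_disk : measurable_fun setT (fun p : plane R => half_disk (toC p)).
Proof. by under eq_fun do rewrite half_diskE; exact: measurable_indic_disk. Qed.

Lemma half_disk_ge0 z : 0 <= half_disk z. Proof. by rewrite /half_disk; case: ifP. Qed.

(** Its inverse is the value of the Gaussian density on the unit circle, a lower bound for the
    density inside. *)
Definition half_disk_cst : R := pi * expR 1.

Lemma half_disk_cst_gt0 : 0 < half_disk_cst. Proof. by rewrite mulr_gt0 ?pi_gt0 ?expR_gt0. Qed.

Lemma half_disk_le z : half_disk z <= half_disk_cst * gauss_density z.
Proof.
rewrite /half_disk; case: ifP => [h|_]; last by rewrite mulr_ge0 ?gauss_density_ge0// ltW//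
  half_disk_cst_gt0.
have -> : half_disk_cst * gauss_density z = expR (1 - cabs z ^+ 2).
  by rewrite /half_disk_cst /gauss_density /gauss mulrACA mulfV ?gt_eqF ?pi_gt0// mul1r -expRD.
rewrite -[leLHS]expR0 ler_expR subr_ge0.
by rewrite exprn_ile1 ?cabs_ge0// ltW// (lt_trans h)// invf_lt1// ltr1n.
Qed.

Lemma rint_half_disk : rint mu2 (fun p => half_disk (toC p)).
Proof.
apply: (rint_le measurable_half_disk _ (rintZ half_disk_cst (@rint_gauss_density R))) => p.
by rewrite ger0_norm ?half_disk_ge0// half_disk_le.
Qed.

(** Positivity is all that is used of this area, and the square [[0, 1/4]^2] inside the disk
    suffices for it. *)
Lemma int_half_disk_gt0 : 0 < \int[mu2]_p half_disk (toC p).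
Proof.
pose I := `[0, 4^-1]%classic : set (measurableTypeR R).
have mI : measurable I by exact: measurable_itv.
have mII : measurable (I `*` I : set (plane R)) by exact: measurableX.
have muI : mu I = (4^-1)%:E.
  by rewrite /I lebesgue_measure_itv /= lte_fin invr_gt0 ltr0n oppr0 adde0.
have muII : (mu2 (I `*` I) = (4^-1 * 4^-1)%:E)%E.
  by rewrite EFinM -muI; exact: product_measure1E.
have i1 : rint mu2 (\1_(I `*` I) : plane R -> R).
  apply: ge0_rint => //.
  by rewrite integral_indic// setIT [ltLHS]muII ltry.
apply: (@lt_le_trans _ _ (\int[mu2]_p (\1_(I `*` I) p : R))).
  rewrite /Rintegral integral_indic// setIT.
  by rewrite (_ : fine _ = 4^-1 * 4^-1); [rewrite mulr_gt0//
    invr_gt0|rewrite [X in fine X]muII].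
apply: le_Rintegral => //; first exact: rint_half_disk.
move=> p _; rewrite indicE; case: (boolP (p \in I `*` I)) => [|_]; last exact: half_disk_ge0.
move=> /set_mem -[]; rewrite /I /= !in_itv /= => /andP[a1 a2] /andP[b1 b2].
rewrite /half_disk ifT// -(ltr_pXn2r (n := 2)) ?nnegrE ?cabs_ge0 ?invr_ge0//.
rewrite cabs_sqr /=.
have x1 : p.1 ^+ 2 <= 4^-1 ^+ 2 by rewrite lerXn2r// nnegrE.
have x2 : p.2 ^+ 2 <= 4^-1 ^+ 2 by rewrite lerXn2r// nnegrE.
lra.
Qed.

Lemma twist_energy f w z : cabs (f (z + w) * cexp (- (z * conjc w))) ^+ 2 * gauss_density z =
  expR (cabs w ^+ 2) * (cabs (f (z + w)) ^+ 2 * gauss_density (z + w)).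
Proof.
have -> : gauss_density (z + w) = gauss_density z * expR (2 * Re (z *
  conjc (- w)) - cabs (- w) ^+ 2).
  by rewrite -gauss_density_shift opprK.
rewrite cabsM cabs_cexp exprMn -expRM_natl.
have -> : expR (2 * Re (- (z * conjc w))) =
    expR (cabs w ^+ 2) * expR (2 * Re (z * conjc (- w)) - cabs (- w) ^+ 2).
  rewrite -expRD; congr expR.
  by rewrite cabsN !(cReN, cReM, cReJ, cImJ, cImN); ring.
by ring.
Qed.

(** The mean value of [h] over the half disk and Cauchy-Schwarz bound [|f w|^2] by the energy of [h]
    there. That energy is [expR (cabs w ^+ 2)] times the energy of [f] around [w], and the factor
    cancels [gauss w]. *)
Lemma local_value : exists2 C : R, 0 <= C & forall f w, fock f ->
  cabs (f w) ^+ 2 * gauss w <= C * local_energy f w 2^-1.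
Proof.
pose A := \int[mu2]_p half_disk (toC p); have A0 : 0 < A := int_half_disk_gt0.
exists (4 * half_disk_cst / A) => [|f w hf]; first by rewrite divr_ge0 ?(ltW A0)// mulr_ge0//
  ltW// half_disk_cst_gt0.
have lf := fock_l2f hf; have ef := fock_entire hf.
(* The exponential factor recentres the Gaussian weight at [w]: see [twist_energy]. *)
pose h z := f (z + w) * cexp (- (z * conjc w)).
have eh : entire h.
  apply: entireM; first exact: (entire_comp ef (entireD (@entire_id R) (@entire_cst R _))).
  apply: (entire_comp (@entire_cexp R)).
  have := entireM (@entire_id R) (@entire_cst R (- conjc w)).
  by congr entire; apply/funext => z; rewrite mulrN.
have mh := entire_cmeasurable eh.
pose L p := half_disk (toC p - w) * (cabs (f (toC p)) ^+ 2 * gauss_density (toC p)).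
have LE : local_energy f w 2^-1 = \int[mu2]_p L p.
  by apply: eq_Rintegral => p _; rewrite disk_indicE.
have iL : rint mu2 L.
  by apply: eq_integrable (rint_local w 2^-1 lf) => // p _; rewrite /L disk_indicE.
have shE p : half_disk (toC p) * (cabs (h (toC p)) ^+ 2 * gauss_density (toC p)) =
    expR (cabs w ^+ 2) * L (translate w p).
  by rewrite /L /translate ofCK addrK twist_energy; ring.
clearbody L.
have iL' : rint mu2 (fun p => L (translate w p)) :=
  preserving_integrable (preserving_trans w) iL.
have EL : \int[mu2]_p (half_disk (toC p) * (cabs (h (toC p)) ^+ 2 * gauss_density (toC p))) =
    expR (cabs w ^+ 2) * local_energy f w 2^-1.
  transitivity (\int[mu2]_p (expR (cabs w ^+ 2) * L (translate w p))).
    by apply: eq_Rintegral => p _; exact: shE.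
  rewrite (RintegralZl _ measurableT iL') LE; congr (_ * _).
  exact: (preserving_Rintegral (preserving_trans w) (rint_measurable iL)).
pose V p := cabs (h (toC p)) ^+ 2 * half_disk (toC p).
have V0 p : 0 <= V p by rewrite mulr_ge0 ?half_disk_ge0// exprn_ge0// cabs_ge0.
have mV : measurable_fun setT V.
  apply: measurable_funM; last exact: measurable_half_disk.
  by apply: measurable_funX; exact: cmeasurable_cabs.
have iG : rint mu2 (fun p => half_disk_cst * (half_disk (toC p) * (cabs (h (toC p)) ^+ 2 *
  gauss_density (toC p)))).
  apply: rintZ; have := rintZ (expR (cabs w ^+ 2)) iL'.
  by apply: eq_integrable => // p _; rewrite shE.
have VG p : V p <= half_disk_cst * (half_disk (toC p) * (cabs (h (toC p)) ^+ 2 *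
  gauss_density (toC p))).
  rewrite /V; have := half_disk_le (toC p); rewrite /half_disk; case: ifP => _ H;
    rewrite ?mulr0 ?mul0r ?mulr0//.
  rewrite mulr1 mul1r mulrCA -[leLHS]mulr1 ler_wpM2l// exprn_ge0// cabs_ge0//.
have amg (s : R) p : 0 < s -> cabs (h (toC p) * (half_disk (toC p))%:C) <=
    2^-1 * (s * V p + s^-1 * half_disk (toC p)).
  move=> s0; rewrite cabsM cabsR ger0_norm ?half_disk_ge0//.
  by have := amgm_scaled (cabs (h (toC p))) 1 s0 (half_disk_ge0 (toC p));
    rewrite mulr1 expr1n mul1r.
clearbody V.
have iV : rint mu2 V by apply: (rint_le mV _ iG) => p; rewrite ger0_norm.
have VE : \int[mu2]_p V p <= half_disk_cst * (expR (cabs w ^+ 2) * local_energy f w 2^-1).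
  rewrite -EL -RintegralZl//; first exact: le_Rintegral.
  have := rintZ half_disk_cst^-1 iG; apply: eq_integrable => // p _; congr EFin.
  by rewrite mulrA mulVf ?mul1r// gt_eqF// half_disk_cst_gt0.
have iH (s : R) : rint mu2 (fun p => 2^-1 * (s * V p + s^-1 * half_disk (toC p))).
  by apply: rintZ; apply: rintD; apply: rintZ => //; exact: rint_half_disk.
have mhW : cmeasurable (fun z => h z * (half_disk z)%:C).
  by apply: cmeasM => //; apply: cmeasR; exact: measurable_half_disk.
have MV : cintegral mu2 (fun z => h z * (half_disk z)%:C) = f w * A%:C.
  rewrite radial_mean//.
  - by rewrite /h mul0r oppr0 cexp0 mulr1 add0r.
  - exact: measurable_half_disk.
  - exact: half_disk_ge0.
  - exact: rint_half_disk.
  - by move=> u z u1; rewrite /half_disk cabsM u1 mul1r.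
  - apply: (rint_le _ _ (iH 1)).
      by apply: measurable_funM; [exact: cmeasurable_cabs|exact: measurable_half_disk].
    move=> p; rewrite ger0_norm ?mulr_ge0 ?cabs_ge0 ?half_disk_ge0//.
    by have := amg 1 p ltr01; rewrite cabsM cabsR (ger0_norm (half_disk_ge0 _)).
(* Cauchy-Schwarz against the indicator, whose integral is [A]; squaring gives the 4 and, after
   division, the [1 / A] of the constant. *)
have B : cabs (f w) * A <= 2 * (Num.sqrt (\int[mu2]_p V p) * Num.sqrt A).
  apply: le_2sqrt => [||s s0]; [exact: Rintegral_ge0|exact: ltW|].
  have -> : cabs (f w) * A = cabs (f w * A%:C) by rewrite cabsM cabsR gtr0_norm.
  rewrite -MV; apply: (le_trans (cintegral_le mhW (fun p => amg s p s0) (iH s))).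
  rewrite RintegralZl//; last by apply: rintD; apply: rintZ => //; exact: rint_half_disk.
  rewrite RintegralD//; [|exact: rintZ|by apply: rintZ; exact: rint_half_disk].
  rewrite !RintegralZl//; last exact: rint_half_disk.
  by rewrite mulrA divff// mul1r [s^-1 * _]mulrC.
have B2 : cabs (f w) ^+ 2 * A <= 4 * \int[mu2]_p V p.
  rewrite -(ler_pM2r A0); have -> : cabs (f w) ^+ 2 * A * A = (cabs (f w) * A) ^+ 2 by ring.
  have := lerXn2r 2 _ _ B; rewrite !nnegrE mulr_ge0 ?cabs_ge0 ?(ltW A0)//.
  rewrite !mulr_ge0 ?sqrtr_ge0// => /(_ isT isT).
  rewrite !exprMn !sqr_sqrtr ?(ltW A0) ?Rintegral_ge0// mulrA.
  by have -> : (2 : R) ^+ 2 = 4 by ring.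
have g0 : 0 < gauss w by exact: expR_gt0.
have gE : expR (cabs w ^+ 2) * gauss w = 1 by rewrite -expRD subrr expR0.
rewrite -(ler_pM2r A0) mulrAC [leRHS](_ : _ = 4 * half_disk_cst * local_energy f w 2^-1);
  last by field; rewrite gt_eqF.
apply: (le_trans (ler_wpM2r (ltW g0) B2)).
apply: (le_trans (ler_wpM2r (ltW g0) (ler_wpM2l (_ : 0 <= 4) VE))) => //.
rewrite le_eqVlt; apply/orP; left; apply/eqP.
transitivity (4 * half_disk_cst * local_energy f w 2^-1 * (expR (cabs w ^+ 2) * gauss w));
  first by ring.
by rewrite gE mulr1.
Qed.

(** The first-order estimate is iterated, each derivative using up one more distance [r]. *)
Lemma cauchy_estimate j f z (r B : R) : (forall i, entire (cderiv i f)) -> 0 < r ->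
  (forall w, cabs (w - z) <= j%:R * r -> cabs (f w) <= B) ->
  cabs (cderiv j f z) <= (4 / r) ^+ j * B.
Proof.
move=> ef r0; elim: j z => [|j ih] z fB.
  by rewrite cderiv0 expr0 mul1r fB// subrr cabs0 mul0r.
rewrite cderivS exprS -mulrA; apply: cauchy_estimate1 => // w wz.
apply: ih => v vw; apply: fB; rewrite (le_trans (cabs_tri w _ _))//.
by rewrite -natr1 mulrDl mul1r lerD.
Qed.

Lemma fock_cderiv_entire f i : fock f -> entire (cderiv i f).
Proof.
move=> hf; have e := taylor_coef_entire_coef (fock_l2f hf).
by rewrite (fock_power_series hf) cderiv_power_series//; apply: entire_power_series;
  exact: entire_coef_dcoefn.
Qed.

Lemma local_cderiv j : exists2 C : R, 0 <= C & forall f z, fock f ->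
  cabs (cderiv j f z) ^+ 2 * gauss z <= C * (1 + cabs z ^+ 2) ^+ j * local_energy f z 1.
Proof.
have [C C0 HC] := local_value.
(* For the radius [r] chosen below, [4 / r = M (1 + |z|)], and [(1 + |z|)^2 <= 2 (1 + |z|^2)]. *)
pose M : R := 8 * j.+1%:R.
have M0 : 0 < M by rewrite mulr_gt0.
exists ((2 * M ^+ 2) ^+ j * (expR 2 * C)) => [|f z hf].
  by rewrite mulr_ge0 ?exprn_ge0 ?mulr_ge0 ?expR_ge0// ltW// exprn_gt0.
have lf := fock_l2f hf.
set t := cabs z; have t0 : 0 <= t := cabs_ge0 z.
(* On a disk of this radius [exp (|w|^2 - |z|^2)] stays bounded. *)
pose d : R := (2 * (1 + t))^-1.
have t1 : 0 < 1 + t by lra.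
have d0 : 0 < d by rewrite invr_gt0 mulr_gt0.
have d12 : d <= 2^-1 by rewrite lef_pV2 ?posrE ?mulr_gt0//; lra.
have dt : d * t <= 2^-1.
  by rewrite mulrC ler_pdivrMr ?mulr_gt0//; lra.
(* [j] steps of length [r] stay within [d]; the successor covers [j = 0]. *)
pose r := d / j.+1%:R.
have r0 : 0 < r by rewrite divr_gt0.
pose E := local_energy f z 1; have E0 : 0 <= E := local_energy_ge0 f z 1.
pose B2 := expR (t ^+ 2 + 2) * (C * E).
have B20 : 0 <= B2 by rewrite mulr_ge0 ?expR_ge0// mulr_ge0.
have H : cabs (cderiv j f z) <= (4 / r) ^+ j * Num.sqrt B2.
  apply: cauchy_estimate => // [i|w]; first exact: fock_cderiv_entire.
  move=> wz; have {}wz : cabs (w - z) <= d.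
    apply: (le_trans wz); rewrite /r mulrCA ler_piMr ?(ltW d0)//.
    by rewrite ler_pdivrMr// mul1r ler_nat.
  rewrite -[leLHS]ger0_norm ?cabs_ge0// -sqrtr_sqr ler_sqrt//.
  have wt : cabs w ^+ 2 <= t ^+ 2 + 2.
    have : cabs w <= t + d.
      by rewrite -[w](subrK z) (le_trans (cabsD _ _))// addrC lerD2l.
    have := cabs_ge0 w; set s := cabs w => s0 sd.
    apply: (@le_trans _ _ ((t + d) ^+ 2)); first by rewrite lerXn2r// nnegrE; lra.
    have : d * d <= 2^-1 * 2^-1 by rewrite ler_pM// ltW.
    rewrite !expr2; nra.
  have gE : gauss w * expR (cabs w ^+ 2) = 1 by rewrite -expRD addNr expR0.
  have := ler_wpM2r (expR_ge0 (cabs w ^+ 2)) (HC f w hf).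
  rewrite -mulrA gE mulr1 => K; apply: (le_trans K).
  rewrite mulrC /B2; apply: ler_pM; rewrite ?expR_ge0 ?mulr_ge0 ?local_energy_ge0//.
    by rewrite ler_expR.
  by rewrite ler_wpM2l// local_energy_le//; lra.
have H2 : cabs (cderiv j f z) ^+ 2 <= ((4 / r) ^+ 2) ^+ j * B2.
  have c0 : 0 <= 4 / r by rewrite divr_ge0// ltW.
  have := lerXn2r 2 _ _ H; rewrite !nnegrE cabs_ge0 mulr_ge0 ?sqrtr_ge0 ?exprn_ge0//.
  by move=> /(_ isT isT); rewrite exprMn sqr_sqrtr// -!exprM mulnC.
have r4 : (4 / r) ^+ 2 <= 2 * M ^+ 2 * (1 + t ^+ 2).
  have -> : 4 / r = M * (1 + t).
    by rewrite /r /d /M invf_div invrK; field.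
  have -> : 2 * M ^+ 2 * (1 + t ^+ 2) = M ^+ 2 * (2 * (1 + t ^+ 2)) by ring.
  rewrite exprMn ler_wpM2l ?exprn_ge0 ?(ltW M0)//.
  by have := sqr_ge0 (1 - t); rewrite !expr2; nra.
have gE : expR (t ^+ 2 + 2) * gauss z = expR 2.
  by rewrite -expRD /t addrAC subrr add0r.
have g0 : 0 <= gauss z := expR_ge0 _.
apply: (le_trans (ler_wpM2r g0 H2)).
have -> : ((4 / r) ^+ 2) ^+ j * B2 * gauss z = ((4 / r) ^+ 2) ^+ j * (expR 2 * (C * E)).
  by rewrite -gE /B2; ring.
have -> : (2 * M ^+ 2) ^+ j * (expR 2 * C) * (1 + t ^+ 2) ^+ j * local_energy f z 1 =
   (2 * M ^+ 2 * (1 + t ^+ 2)) ^+ j * (expR 2 * (C * E)).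
  by rewrite [in RHS]exprMn /E; ring.
apply: ler_wpM2r; first by rewrite mulr_ge0 ?expR_ge0// mulr_ge0.
have r40 := sqr_ge0 (4 / r).
by rewrite lerXn2r// nnegrE// (le_trans r40).
Qed.

End LocalEstimate.

(** * Carleson estimate for one positive measure *)

Section CarlesonEstimate.
Context (R : realType) (k : R) (m : {measure set (plane R) -> \bar R}).
Local Notation mu2 := (@lebesgue2 R).
Hypothesis k_ge0 : 0 <= k.
Hypothesis m_locally_finite : forall M : R, (m (disk 0%R M) < +oo)%E.
Hypothesis m_vanishing : forall e : R, 0 < e -> exists M : R, forall z : R[i], M < cabs z ->
  (m (disk z (Num.sqrt 2)) * ((1 + cabs z ^+ 2) `^ k)%:E <= e%:E)%E.
Implicit Types (f g h : R[i] -> R[i]) (z w : R[i]).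

Lemma locally_finite_sigma_finite : sigma_finite setT m.
Proof.
exists (fun n : nat => disk 0 n%:R : set (plane R)).
  apply/seteqP; split=> // p _; exists (Num.bound (cabs (toC p))) => //.
  have : cabs (toC p - 0) < (Num.bound (cabs (toC p)))%:R.
    by rewrite subr0; apply: archi_boundP; exact: cabs_ge0.
  exact.
by move=> n; split; [exact: measurable_disk|exact: m_locally_finite].
Qed.

(** Carries the sigma-finite structure of [m] for Tonelli's theorem. *)
Definition sigma_finite_copy : set (plane R) -> \bar R := m.
HB.instance Definition _ := Measure.copy sigma_finite_copy m.
HB.instance Definition _ := @Measure_isSigmaFinite.Build _ _ _ sigma_finite_copy
  locally_finite_sigma_finite.

Definition weight z : R := 1 + cabs z ^+ 2.

Lemma weight_ge1 z : 1 <= weight z.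
Proof. by rewrite lerDl exprn_ge0// cabs_ge0. Qed.

Lemma weight_gt0 z : 0 < weight z. Proof. exact: lt_le_trans ltr01 (weight_ge1 z). Qed.

Lemma measurable_weight : measurable_fun setT (fun p : plane R => weight (toC p)).
Proof.
apply: measurable_funD => //; apply: measurable_funX.
exact: ccont_measurable_cabs (entire_cont (@entire_id R)).
Qed.

Lemma weight_near z w : cabs (w - z) < 1 -> weight z <= 3 * weight w.
Proof.
move=> h; rewrite /weight.
have : cabs z <= cabs w + 1.
  by rewrite -[z](subrK w) (le_trans (cabsD _ _))// addrC lerD2l cabsBC ltW.
have := cabs_ge0 z; have := cabs_ge0 w; set s := cabs z; set t := cabs w => t0 s0 st.
have : s ^+ 2 <= (t + 1) ^+ 2 by rewrite lerXn2r// nnegrE; lra.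
have := sqr_ge0 (t - 1); rewrite !expr2; nra.
Qed.

Definition near_kernel (x : plane R * plane R) : R :=
  if cabs (toC x.2 - toC x.1) < 1 then 1 else 0.

Lemma measurable_near_kernel : measurable_fun setT near_kernel.
Proof.
have -> : near_kernel = \1_(`]-oo, 1[%classic : set (measurableTypeR R)) \o
    (fun x : plane R * plane R => cabs (toC x.2 - toC x.1)).
  apply/funext => x /=; rewrite indicE /near_kernel.
  case: ifPn => h; first by rewrite mem_set//= in_itv.
  by rewrite memNset//= in_itv /=; apply/negP.
apply: measurableT_comp; first by apply: measurable_indic; exact: measurable_itv.
apply: measurable_cabs.
  under eq_fun do rewrite cReB /=.
  apply: measurable_funB.
    exact: (measurableT_comp measurable_fst measurable_snd).
  exact: (measurableT_comp measurable_fst measurable_fst).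
under eq_fun do rewrite cImB /=.
apply: measurable_funB.
  exact: (measurableT_comp measurable_snd measurable_snd).
exact: (measurableT_comp measurable_snd measurable_fst).
Qed.

(** Multiplied by the power [al] of the weight from [local_cderiv], the exponent [k - al] leaves the
    power [k] of the vanishing condition, for every [al]. *)
Definition density (al : nat) f z : R :=
  cabs (cderiv al f z) ^+ 2 * gauss z * weight z `^ (k - al%:R).

Lemma measurable_density al f : fock f ->
  measurable_fun setT (fun p : plane R => density al f (toC p)).
Proof.
move=> hf; apply: measurable_funM; last first.
  exact: (measurableT_comp (@measurable_powR R _) measurable_weight).
apply: measurable_funM; last exact: measurable_gauss.
apply: measurable_funX; apply: cmeasurable_cabs.
exact/entire_cmeasurable/fock_cderiv_entire.
Qed.

Lemma density_ge0 al f z : 0 <= density al f z.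
Proof. by rewrite mulr_ge0 ?powR_ge0// mulr_ge0 ?expR_ge0// exprn_ge0// cabs_ge0. Qed.

(** The unit disk of [u] lies in its disk of radius [sqrt 2], to which the vanishing condition
    applies, and on the unit disk the weight is at most [3 * weight u]. For [|u| > M] the condition
    gives [e]; the other disks all lie in a single disk of finite mass, which gives [D]. *)
Lemma near_mass : forall e : R, 0 < e -> exists L D : R, 0 <= D /\
  forall u : plane R, (\int[m]_z (weight (toC z) `^ k * near_kernel (z, u))%:E <=
    (e + D * \1_(disk 0 L) u)%:E)%E.
Proof.
move=> e e0.
have k30 : 0 < 3 `^ k :> R by rewrite powR_gt0.
have [M HM] := m_vanishing (divr_gt0 e0 k30).
pose D := (3 * (1 + M ^+ 2)) `^ k * fine (m (disk 0 (M + Num.sqrt 2))).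
have fD : m (disk 0 (M + Num.sqrt 2)) \is a fin_num.
  by rewrite ge0_fin_numE.
(* [M + 1] because [disk] is open, whereas the second case is [|u| <= M]. *)
exists (M + 1), D; split; first by rewrite mulr_ge0 ?powR_ge0 ?fine_ge0.
move=> u.
have s1 : 1 <= Num.sqrt 2 :> R by rewrite -[leLHS]sqrtr1 ler_wsqrtr// ler1n.
have B : (\int[m]_z (weight (toC z) `^ k * near_kernel (z, u))%:E <=
    ((3 * weight (toC u)) `^ k)%:E * m (disk (toC u) (Num.sqrt 2)))%E.
  have -> : (((3 * weight (toC u)) `^ k)%:E * m (disk (toC u) (Num.sqrt 2)) =
      \int[m]_z ((3 * weight (toC u)) `^ k * \1_(disk (toC u) (Num.sqrt 2)) z)%:E)%E.
    transitivity (((3 * weight (toC u)) `^ k)%:E *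
        \int[m]_z (\1_(disk (toC u) (Num.sqrt 2)) z)%:E)%E.
      by rewrite integral_indic ?setIT//; exact: measurable_disk.
    rewrite -ge0_integralZl//.
    - by apply/measurable_EFinP; exact: measurable_indic_disk.
    - by rewrite lee_fin powR_ge0.
  apply: ge0_le_integral => //.
  - move=> z _; rewrite lee_fin mulr_ge0 ?powR_ge0// /near_kernel.
    by case: ifP.
  - apply/measurable_EFinP; apply: measurable_funM.
      exact: (measurableT_comp (@measurable_powR R _) measurable_weight).
    exact: measurable_fun_pair1 measurable_near_kernel.
  - apply/measurable_EFinP; apply: measurable_funM => //; exact: measurable_indic_disk.
  move=> z _; rewrite lee_fin disk_indicE /near_kernel; cbn [fst snd].
  case: ifPn => h1; last first.
    by rewrite mulr0; case: ifP => _; rewrite ?mulr0// mulr1 powR_ge0.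
  rewrite ifT; last by rewrite cabsBC (lt_le_trans h1).
  rewrite !mulr1; apply: ge0_ler_powR => //; rewrite ?nnegrE.
  - exact/ltW/weight_gt0.
  - by rewrite mulr_ge0// ltW// weight_gt0.
  - exact: weight_near.
apply: (le_trans B).
have [uM|uM] := ltP M (cabs (toC u)).
  apply: (@le_trans _ _ e%:E); last first.
    by rewrite lee_fin lerDl mulr_ge0// ?mulr_ge0 ?powR_ge0 ?fine_ge0.
  rewrite powRM//; last by rewrite ltW// weight_gt0.
  rewrite EFinM -muleA [(_ * m _)%E]muleC.
  apply: (le_trans (lee_wpmul2l _ (HM _ uM))); first by rewrite lee_fin ltW.
  by rewrite -EFinM mulrCA mulfV ?mulr1// gt_eqF.
apply: (@le_trans _ _ D%:E); last first.
  rewrite disk_indicE subr0 ifT; last by rewrite (le_lt_trans uM)// ltrDl.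
  by rewrite mulr1 lee_fin lerDr ltW.
rewrite /D EFinM fineK//; apply: lee_pmul => //.
- by rewrite lee_fin powR_ge0.
- rewrite lee_fin; apply: ge0_ler_powR => //; rewrite ?nnegrE.
  + by rewrite mulr_ge0// ltW// weight_gt0.
  + by rewrite mulr_ge0// addr_ge0// sqr_ge0.
  + rewrite ler_wpM2l// lerD2l lerXn2r// ?nnegrE ?cabs_ge0//.
    exact: le_trans (cabs_ge0 _) uM.
- apply: le_measure; rewrite ?inE; [exact: measurable_disk|exact: measurable_disk|].
  move=> p h; have {}h : cabs (toC p - toC u) < Num.sqrt 2 by exact: h.
  suff : cabs (toC p - 0) < M + Num.sqrt 2 by exact.
  rewrite subr0.
  by rewrite -[toC p](subrK (toC u)) (le_lt_trans (cabsD _ _))// addrC ler_ltD.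
Qed.

(** After exchanging the integrals, [|f u|^2] is multiplied by the weighted mass of the unit disk
    around [u], for which [near_mass] is made. *)
Lemma carleson al : forall e : R, 0 < e -> exists L C : R, 0 <= C /\
  forall f, fock f -> (\int[m]_p (density al f (toC p))%:E <=
     (e * sqnorm f + C * local_energy f 0 L)%:E)%E.
Proof.
move=> e e0; have [Ca Ca0 HCa] := local_cderiv R al.
(* [Ca] may vanish, and the tolerance is divided by it. *)
have Ca10 : 0 < Ca + 1 by rewrite ltr_wpDl.
have [L [D [D0 HD]]] := near_mass (divr_gt0 e0 Ca10).
exists L, ((Ca + 1) * D); split; first by rewrite mulr_ge0// ltW.
move=> f hf; have lf := fock_l2f hf.
pose E (u : plane R) := cabs (f (toC u)) ^+ 2 * gauss_density (toC u).
have E0 u : 0 <= E u by rewrite mulr_ge0 ?gauss_density_ge0// exprn_ge0// cabs_ge0.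
have iE : rint mu2 E := lf.2.
have mE := rint_measurable iE.
pose Phi (x : plane R * plane R) : \bar R :=
  ((Ca + 1) * (weight (toC x.1) `^ k * near_kernel x * E x.2))%:E.
have mPhi : measurable_fun setT Phi.
  apply/measurable_EFinP; apply: measurable_funM => //.
  apply: measurable_funM; last exact: (measurableT_comp mE measurable_snd).
  apply: measurable_funM; last exact: measurable_near_kernel.
  have mw := measurableT_comp (@measurable_powR R k) measurable_weight.
  exact: (measurableT_comp mw measurable_fst).
have nk0 x : 0 <= near_kernel x by rewrite /near_kernel; case: ifP.
have Phi0 x : (0 <= Phi x)%E.
  by rewrite lee_fin mulr_ge0 ?(ltW Ca10)// mulr_ge0// mulr_ge0// powR_ge0.
have T : (\int[m]_z \int[mu2]_u Phi (z, u) = \int[mu2]_u \int[m]_z Phi (z, u))%E.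
  exact: (@fubini_tonelli _ _ _ _ _ sigma_finite_copy (@lebesgue2_sfinite R) Phi mPhi Phi0).
have PhiE (z : plane R) : (\int[mu2]_u Phi (z, u) =
    ((Ca + 1) * (weight (toC z) `^ k * local_energy f (toC z) 1))%:E)%E.
  have iz := rint_local (toC z) 1 lf.
  have -> : (fun u => Phi (z, u)) = (fun u => ((Ca + 1) * (weight (toC z) `^ k *
      (\1_(disk (toC z) 1) u * (cabs (f (toC u)) ^+ 2 * gauss_density (toC u)))))%:E).
    by apply/funext => u; rewrite /Phi /= /near_kernel /= disk_indicE -mulrA.
  rewrite rint_EFin; last by apply: rintZ; exact: rintZ.
  rewrite RintegralZl//; last exact: rintZ.
  by rewrite RintegralZl.
apply: (@le_trans _ _ (\int[m]_z \int[mu2]_u Phi (z, u))%E).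
  apply: ge0_le_integral => //.
  - by move=> p _; rewrite lee_fin density_ge0.
  - by apply/measurable_EFinP; exact: measurable_density.
  - exact: (@measurable_fun_fubini_tonelli_F _ _ _ _ _ (@lebesgue2_sfinite R) Phi mPhi Phi0).
  move=> z _; rewrite PhiE lee_fin /density.
  have w0 := weight_gt0 (toC z).
  apply: (le_trans (ler_wpM2r (powR_ge0 _ _) (HCa f (toC z) hf))).
  rewrite -/(weight (toC z)) powRB; last by rewrite (gt_eqF w0) implybT.
  rewrite powR_mulrn; last exact: ltW.
  have -> : Ca * weight (toC z) ^+ al * local_energy f (toC z) 1 *
      (weight (toC z) `^ k / weight (toC z) ^+ al) =
      Ca * (weight (toC z) `^ k * local_energy f (toC z) 1).
    by field; rewrite expf_neq0// gt_eqF.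
  by rewrite ler_wpM2r ?lerDl// mulr_ge0 ?powR_ge0 ?local_energy_ge0.
rewrite T.
have iR : rint mu2 (fun u => (Ca + 1) * ((e / (Ca + 1) + D * \1_(disk 0 L) u) * E u)).
  apply: rintZ; have := rintD (rintZ (e / (Ca + 1)) iE) (rintZ D (rint_local 0 L lf)).
  by apply: eq_integrable => // u _; congr EFin; rewrite /E; ring.
apply: (@le_trans _ _ (\int[mu2]_u ((Ca + 1) * ((e / (Ca + 1) + D * \1_(disk 0 L) u) *
  E u))%:E)%E).
  apply: ge0_le_integral => //.
  - by move=> u _; apply: integral_ge0 => z _; exact: Phi0.
  - exact: (@measurable_fun_fubini_tonelli_G _ _ _ _ _ sigma_finite_copy Phi mPhi Phi0).
  - by apply/measurable_EFinP; exact: rint_measurable iR.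
  move=> u _.
  have -> : (fun z : plane R => Phi (z, u)) = (fun z : plane R => ((Ca + 1) * E u)%:E *
      (weight (toC z) `^ k * near_kernel (z, u))%:E)%E.
    by apply/funext => z; rewrite /Phi -EFinM /=; congr EFin; ring.
  rewrite ge0_integralZl//; last first.
  - by rewrite lee_fin mulr_ge0// ltW.
  - by move=> z _; rewrite lee_fin mulr_ge0 ?powR_ge0.
  - apply/measurable_EFinP; apply: measurable_funM.
      exact: (measurableT_comp (@measurable_powR R _) measurable_weight).
    exact: measurable_fun_pair1 measurable_near_kernel.
  have -> : ((Ca + 1) * ((e / (Ca + 1) + D * \1_(disk 0 L) u) * E u))%:E =
     (((Ca + 1) * E u)%:E * (e / (Ca + 1) + D * \1_(disk 0 L) u)%:E)%E.
    by rewrite -EFinM; congr EFin; ring.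
  by apply: lee_wpmul2l; [rewrite lee_fin mulr_ge0// ltW|exact: HD].
rewrite rint_EFin// lee_fin le_eqVlt; apply/orP; left; apply/eqP.
transitivity (\int[mu2]_u (e * E u + (Ca + 1) * D * (\1_(disk 0 L) u * E u))).
  by apply: eq_Rintegral => u _; field; rewrite gt_eqF.
rewrite RintegralD//; [|exact: rintZ|apply: rintZ; exact: rint_local].
by rewrite !RintegralZl//; exact: rint_local.
Qed.

End CarlesonEstimate.

(** * The form of a vanishing Carleson measure *)

Section DerivativeLinearity.
Context (R : realType).
Implicit Types (f g : R[i] -> R[i]).

Lemma cderiv_lin (b : R[i]) f g n : (forall i, entire (cderiv i f)) ->
  (forall i, entire (cderiv i g)) ->
  cderiv n (fun z => b * f z + g z) = (fun z => b * cderiv n f z + cderiv n g z).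
Proof.
move=> ef eg; elim: n => [|n ih]; first by rewrite !cderiv0.
rewrite cderivS ih (cderivS n f) (cderivS n g); apply: cderivE => z.
have /entireP hf := ef n; have /entireP hg := eg n.
exact: (cdiffD (cdiffZ b (hf z)) (hg z)).
Qed.

Lemma FC_integrand_linl al be (b : R[i]) f1 f2 g : fock f1 -> fock f2 ->
  FC_integrand al be (fun z => b * f1 z + f2 z) g =
  (fun z => b * FC_integrand al be f1 g z + FC_integrand al be f2 g z).
Proof.
move=> h1 h2; apply/funext => z; rewrite /FC_integrand cderiv_lin; first by ring.
  by move=> i; exact: fock_cderiv_entire.
by move=> i; exact: fock_cderiv_entire.
Qed.

Lemma FC_integrand_linr al be (b : R[i]) f g1 g2 : fock g1 -> fock g2 ->
  FC_integrand al be f (fun z => b * g1 z + g2 z) =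
  (fun z => conjc b * FC_integrand al be f g1 z + FC_integrand al be f g2 z).
Proof.
move=> h1 h2; apply/funext => z; rewrite /FC_integrand cderiv_lin.
- by rewrite cJD cJM; ring.
- by move=> i; exact: fock_cderiv_entire.
- by move=> i; exact: fock_cderiv_entire.
Qed.

End DerivativeLinearity.

(** * Jordan parts and the variation of [mu] *)

Section Variation.
Context (R : realType) (mu : complex_measure R).

Lemma disk_bounded_borel z (r : R) : bounded_borel (disk z r : set (plane R)).
Proof.
split; first exact: measurable_disk.
exists (cabs z + r) => p h; have {}h : cabs (toC p - z) < r by exact: h.
suff : cabs (toC p - 0) < cabs z + r by exact.
by rewrite subr0 -[toC p](subrK z) (le_lt_trans (cabsD _ _))// addrC ltrD2l.
Qed.

(** A Borel subset [B] of the disk is completed by its complement in the disk and by empty sets to a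
    partition; its sum in the definition of the variation is at least [|mu B|]. *)
Lemma upper_variation_le (h : R[i] -> R) z (r : R) : (forall w, h w <= cabs w) ->
  (upper_variation (fun A => h (mu A)) (disk z r) <= cvariation mu (disk z r))%E.
Proof.
move=> hle; apply/ereal_supP => _ [B [bB BD] <-].
apply: (@le_trans _ _ (cabs (mu B))%:E); first by rewrite lee_fin.
pose A := bigcup2 B (disk z r `\` B).
have mD : measurable (disk z r `\` B).
  by apply: measurableD; [exact: measurable_disk|case: bB].
have bA i : bounded_borel (A i).
  case: i => [|[|i]]; rewrite /A /=; [exact: bB| |exact: bounded_borel0].
  by apply: (bounded_borelS (disk_bounded_borel z r) mD); exact: subDsetl.
have UA : \bigcup_i A i = disk z r.
  by rewrite bigcup2E setDUK.
have tA : trivIset setT A.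
  by rewrite -trivIset_bigcup2 setDIK.
apply: (@le_trans _ _ (\sum_(0 <= i <oo) (cabs (mu (A i)))%:E)%E); last first.
  by apply: ereal_sup_ubound; exists A.
apply: (@le_trans _ _ (\sum_(0 <= i < 1) (cabs (mu (A i)))%:E)%E).
  by rewrite big_nat1.
by apply: nneseries_lim_ge => i _ _; rewrite lee_fin cabs_ge0.
Qed.

(** Disks are all that the Carleson estimate looks at; stated for any set function, this lets the
    four Jordan parts be treated alike. *)
Definition dominated_by_variation (m : set (plane R) -> \bar R) :=
  forall z (r : R), (m (disk z r) <= cvariation mu (disk z r))%E.

Lemma re_pos_le : dominated_by_variation (re_pos mu).
Proof.
by move=> z r; apply: (upper_variation_le (h := fun w => Re w)) => w; exact: Re_le_norm.
Qed.

Lemma re_neg_le : dominated_by_variation (re_neg mu).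
Proof.
move=> z r; apply: (upper_variation_le (h := fun w => - Re w)) => w.
by rewrite -cReN -(cabsN w) Re_le_norm.
Qed.

Lemma im_pos_le : dominated_by_variation (im_pos mu).
Proof.
move=> z r; apply: (upper_variation_le (h := fun w => Im w)) => w.
exact: le_trans (ler_norm _) (Im_le_cabs _).
Qed.

Lemma im_neg_le : dominated_by_variation (im_neg mu).
Proof.
move=> z r; apply: (upper_variation_le (h := fun w => - Im w)) => w.
by rewrite -cImN -(cabsN w); exact: le_trans (ler_norm _) (Im_le_cabs _).
Qed.

Context (k : R).
Hypotheses (k_ge0 : 0 <= k) (mu_vanishing : vanishing_FC mu k).

Lemma dominated_carleson (m : {measure set (plane R) -> \bar R}) al :
  dominated_by_variation m -> forall e : R, 0 < e -> exists L C : R, 0 <= C /\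
  forall f, fock f -> (\int[m]_p (density k al f (toC p))%:E <=
     (e * sqnorm f + C * local_energy f 0 L)%:E)%E.
Proof.
move=> dm; apply: carleson => //.
  by move=> M; apply: (le_lt_trans (dm 0 M)); exact: cm_locally_finite.
move=> e e0; have [M HM] := mu_vanishing e0; exists M => z Mz.
apply: (le_trans (lee_wpmul2r _ (dm z _)) (ltW (HM z Mz))).
by rewrite lee_fin powR_ge0.
Qed.

End Variation.

Section Form.
Context (R : realType) (mu : complex_measure R) (k : R).
Hypotheses (k_ge0 : 0 <= k) (mu_vanishing : vanishing_FC mu k).
Implicit Types (f g : R[i] -> R[i]).

Section SingleMeasure.
Variables (m : {measure set (plane R) -> \bar R}).
Hypothesis dm : dominated_by_variation mu m.

Lemma rint_density al f : fock f -> rint m (fun p => density k al f (toC p)).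
Proof.
move=> hf; have [L [C [C0 H]]] := dominated_carleson k_ge0 mu_vanishing al dm ltr01.
apply: ge0_rint; first exact: measurable_density.
  by move=> p; exact: density_ge0.
exact: le_lt_trans (H f hf) (ltry _).
Qed.

Definition energy al f : R := \int[m]_p density k al f (toC p).

Lemma energy_ge0 al f : 0 <= energy al f.
Proof. by apply: Rintegral_ge0 => p _; exact: density_ge0. Qed.

Lemma energy_le al : forall e : R, 0 < e -> exists L C : R, 0 <= C /\
  forall f, fock f -> energy al f <= e * sqnorm f + C * local_energy f 0 L.
Proof.
move=> e e0; have [L [C [C0 H]]] := dominated_carleson k_ge0 mu_vanishing al dm e0.
exists L, C; split=> // f hf; rewrite -lee_fin -rint_EFin; last exact: rint_density.
exact: H.
Qed.

Lemma cmeasurable_FC al be f g : fock f -> fock g -> cmeasurable (FC_integrand al be f g).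
Proof.
move=> hf hg; apply: cmeasM; last by apply: cmeasR; exact: measurable_gauss.
apply: cmeasM; first exact/entire_cmeasurable/fock_cderiv_entire.
exact/cmeasJ/entire_cmeasurable/fock_cderiv_entire.
Qed.

Lemma FC_pointwise al be f g (s : R) z : 0 < s -> (al + be)%:R = 2 * k ->
  cabs (FC_integrand al be f g z) <=
  2^-1 * (s * density k al f z + s^-1 * density k be g z).
Proof.
move=> s0 abk; rewrite !cabsM cabs_conj cabsR (ger0_norm (expR_ge0 _)).
have w0 := weight_gt0 z.
(* AM-GM is applied with scale [s * t]; its inverse contains [t^-1], which is the weight attached to
   [be]. *)
pose t := weight z `^ (k - al%:R); have t0 : 0 < t by rewrite powR_gt0.
have tE : weight z `^ (k - be%:R) = t^-1.
  rewrite -powRN; congr (_ `^ _).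
  by move: abk; rewrite natrD; lra.
have := amgm_scaled (cabs (cderiv al f z)) (cabs (cderiv be g z)) (mulr_gt0 s0 t0) (expR_ge0 (- cabs z ^+ 2)).
move=> /le_trans; apply; rewrite /density tE -/t le_eqVlt; apply/orP; left; apply/eqP.
by rewrite invfM /gauss; ring.
Qed.

Lemma rint_pair al be f g (s : R) : fock f -> fock g -> rint m (fun p =>
  2^-1 * (s * density k al f (toC p) + s^-1 * density k be g (toC p))).
Proof.
move=> hf hg; apply: rintZ.
exact: (rintD (rintZ _ (rint_density al hf)) (rintZ _ (rint_density be hg))).
Qed.

Lemma cintegrable_FC al be f g : fock f -> fock g -> (al + be)%:R = 2 * k ->
  cintegrable m (FC_integrand al be f g).
Proof.
move=> hf hg abk.
by apply: (cintegrable_le (cmeasurable_FC al be hf hg) _ (rint_pair al be 1 hf hg)) => p;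
  exact: FC_pointwise.
Qed.

Lemma cintegral_FC_le al be f g (s : R) : 0 < s -> fock f -> fock g ->
  (al + be)%:R = 2 * k ->
  cabs (cintegral m (FC_integrand al be f g)) <= s * energy al f + s^-1 * energy be g.
Proof.
move=> s0 hf hg abk.
have := cintegral_le (cmeasurable_FC al be hf hg) (fun p => FC_pointwise f g (toC p) s0 abk)
  (rint_pair al be s hf hg).
have rf := rint_density al hf; have rg := rint_density be hg.
rewrite (RintegralZl _ measurableT (rintD (rintZ s rf) (rintZ s^-1 rg))).
rewrite (RintegralD measurableT (rintZ s rf) (rintZ s^-1 rg)).
rewrite (RintegralZl _ measurableT rf) (RintegralZl _ measurableT rg).
by rewrite mulrA divff// mul1r.
Qed.

End SingleMeasure.

Variables (al be : nat).
Hypothesis abk : (al + be)%:R = 2 * k.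

Lemma cm_integrable_FC f g : fock f -> fock g ->
  cm_integrable mu (FC_integrand al be f g).
Proof.
move=> hf hg; split; apply: cintegrable_FC => //.
- exact: re_pos_le.
- exact: re_neg_le.
- exact: im_pos_le.
- exact: im_neg_le.
Qed.

Lemma cm_integral_lin (b : R[i]) (h1 h2 : R[i] -> R[i]) : cm_integrable mu h1 ->
  cm_integrable mu h2 ->
  cm_integral mu (fun z => b * h1 z + h2 z) = b * cm_integral mu h1 + cm_integral mu h2.
Proof.
move=> [a1 a2 a3 a4] [b1 b2 b3 b4]; rewrite /cm_integral.
rewrite !cintegralD// ?cintegralZ//; try exact: cintegrableZ.
by ring.
Qed.

Definition total_energy (j : nat) f : R :=
  energy (re_pos mu) j f + energy (re_neg mu) j f +
  energy (im_pos mu) j f + energy (im_neg mu) j f.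

Lemma total_energy_ge0 j f : 0 <= total_energy j f.
Proof. by rewrite !addr_ge0// energy_ge0. Qed.

(** Monotonicity in the radius lets the four Jordan parts share one radius. *)
Lemma local_energy_monomial f (L M : R) : l2f f -> L <= M ->
  local_energy f 0 L <= local_energy f 0 M.
Proof. by move=> lf LM; apply: local_energy_le; rewrite // subrr cabs0 add0r. Qed.

Lemma total_energy_le j : forall e : R, 0 < e -> exists L C : R, 0 <= C /\
  forall f, fock f -> total_energy j f <= e * sqnorm f + C * local_energy f 0 L.
Proof.
move=> e e0; have e4 : 0 < e / 4 by rewrite divr_gt0.
have [L1 [C1 [C10 H1]]] := energy_le (@re_pos_le _ mu) j e4.
have [L2 [C2 [C20 H2]]] := energy_le (@re_neg_le _ mu) j e4.
have [L3 [C3 [C30 H3]]] := energy_le (@im_pos_le _ mu) j e4.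
have [L4 [C4 [C40 H4]]] := energy_le (@im_neg_le _ mu) j e4.
pose L := Num.max (Num.max L1 L2) (Num.max L3 L4).
have L1L : L1 <= L by rewrite !le_max lexx.
have L2L : L2 <= L by rewrite !le_max lexx !orbT.
have L3L : L3 <= L by rewrite !le_max lexx !orbT.
have L4L : L4 <= L by rewrite !le_max lexx !orbT.
exists L, (C1 + C2 + C3 + C4); split; first by rewrite !addr_ge0.
move=> f hf; have lf := fock_l2f hf.
have half_disk_cst := ler_wpM2l C10 (local_energy_monomial lf L1L).
have K2 := ler_wpM2l C20 (local_energy_monomial lf L2L).
have K3 := ler_wpM2l C30 (local_energy_monomial lf L3L).
have K4 := ler_wpM2l C40 (local_energy_monomial lf L4L).
have := H1 f hf; have := H2 f hf; have := H3 f hf; have := H4 f hf.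
rewrite /total_energy !mulrDl; clearbody L; lra.
Qed.

Lemma local_energy_le_sqnorm f (L : R) : l2f f -> local_energy f 0 L <= sqnorm f.
Proof.
move=> lf; apply: le_Rintegral => //; [exact: rint_local|exact: lf.2|].
move=> p _; rewrite disk_indicE.
have e0 : 0 <= cabs (f (toC p)) ^+ 2 * gauss_density (toC p) by
  rewrite mulr_ge0 ?gauss_density_ge0// exprn_ge0// cabs_ge0.
by case: ifP => _; rewrite ?mul1r ?mul0r.
Qed.

Lemma total_energy_bounded j : exists2 K : R, 0 <= K & forall f, fock f ->
  total_energy j f <= K * sqnorm f.
Proof.
have [L [C [C0 H]]] := total_energy_le j ltr01; exists (1 + C); first by rewrite addr_ge0.
move=> f hf; apply: (le_trans (H f hf)); rewrite mulrDl lerD2l ler_wpM2l//.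
exact/local_energy_le_sqnorm/fock_l2f.
Qed.

(** The same scale [s] is kept in the four Jordan parts, so that a single optimization applies to
    the sums of their energies. *)
Lemma FC_form_le f g : fock f -> fock g -> cabs (FC_form mu al be f g) <=
  2 * (Num.sqrt (total_energy al f) * Num.sqrt (total_energy be g)).
Proof.
move=> hf hg; apply: le_2sqrt; rewrite ?total_energy_ge0// => s s0.
have E1 := cintegral_FC_le (@re_pos_le _ mu) s0 hf hg abk.
have E2 := cintegral_FC_le (@re_neg_le _ mu) s0 hf hg abk.
have E3 := cintegral_FC_le (@im_pos_le _ mu) s0 hf hg abk.
have E4 := cintegral_FC_le (@im_neg_le _ mu) s0 hf hg abk.
rewrite /FC_form /cm_integral.
have i1 : cabs ((0 +i* 1) : R[i]) = 1 by rewrite /= expr0n add0r expr1n sqrtr1.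
apply: (le_trans (cabsD _ _)); rewrite cabsM i1 mul1r.
apply: (le_trans (lerD (cabsB _ _) (cabsB _ _))).
apply: (le_trans (lerD (lerD E1 E2) (lerD E3 E4))).
have aux (a b c d a' b' c' d' : R) :
    s * a + s^-1 * a' + (s * b + s^-1 * b') + (s * c + s^-1 * c' + (s * d + s^-1 * d')) =
    s * (a + b + c + d) + (a' + b' + c' + d') / s by ring.
by rewrite aux.
Qed.

Lemma FC_form_sesquilinear : bounded_sesquilinear (FC_form mu al be).
Proof.
split.
- move=> b f1 f2 g h1 h2 hg; rewrite /FC_form FC_integrand_linl//.
  by apply: cm_integral_lin; exact: cm_integrable_FC.
- move=> b f g1 g2 hf h1 h2; rewrite /FC_form FC_integrand_linr//.
  by apply: cm_integral_lin; exact: cm_integrable_FC.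
have [Ka Ka0 HKa] := total_energy_bounded al.
have [Kb Kb0 HKb] := total_energy_bounded be.
exists (2 * (Num.sqrt Ka * Num.sqrt Kb)) => f g hf hg.
apply: (le_trans (FC_form_le hf hg)).
rewrite !fock_normE; [|exact: fock_l2f|exact: fock_l2f].
have -> : 2 * (Num.sqrt Ka * Num.sqrt Kb) * Num.sqrt (sqnorm f) * Num.sqrt (sqnorm g) =
  2 * ((Num.sqrt Ka * Num.sqrt (sqnorm f)) * (Num.sqrt Kb * Num.sqrt (sqnorm g))) by ring.
have Hf : Num.sqrt (total_energy al f) <= Num.sqrt Ka * Num.sqrt (sqnorm f).
  by rewrite -sqrtrM// ler_wsqrtr// HKa.
have Hg : Num.sqrt (total_energy be g) <= Num.sqrt Kb * Num.sqrt (sqnorm g).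
  by rewrite -sqrtrM// ler_wsqrtr// HKb.
by rewrite ler_wpM2l// ler_pM// sqrtr_ge0.
Qed.

(** Everything that the compactness argument has to know about [mu], in one functional [J]: a
    multiple of the energy of order [al], the energy of order [be] being absorbed in the norm of
    [g]. *)
Lemma FC_form_compactness : exists J : (R[i] -> R[i]) -> R,
  (forall f g, fock f -> fock g ->
     cabs (FC_form mu al be f g) <= Num.sqrt (J f) * fock_norm g) /\
  (forall e : R, 0 < e -> exists L C : R, 0 <= C /\
     forall f, fock f -> J f <= e * sqnorm f + C * local_energy f 0 L).
Proof.
have [Kb Kb0 HKb] := total_energy_bounded be.
(* The square of the bound in [FC_form_le] is at most [4 Kb] times the energy of [f] times
   [sqnorm g]; the added 1 makes [M] invertible. *)
pose M := 4 * Kb + 1.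
have M0 : 0 < M by rewrite ltr_wpDl// mulr_ge0.
exists (fun f => M * total_energy al f).
split=> [f g hf hg|e e0].
  apply: (le_trans (FC_form_le hf hg)).
  rewrite fock_normE; last exact: fock_l2f.
  rewrite -[leLHS]ger0_norm; last by rewrite mulr_ge0// mulr_ge0// sqrtr_ge0.
  rewrite -sqrtr_sqr -[leRHS]sqrtrM; last first.
    by rewrite mulr_ge0 ?(ltW M0) ?total_energy_ge0.
  rewrite ler_wsqrtr// !exprMn !sqr_sqrtr ?total_energy_ge0//.
  have := ler_wpM2l (total_energy_ge0 al f) (HKb g hg).
  have P : 0 <= total_energy al f * sqnorm g by rewrite mulr_ge0 ?total_energy_ge0 ?sqnorm_ge0.
  rewrite /M; move: P; set a := total_energy al f; set b := total_energy be g.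
  set c := sqnorm g => P Q.
  have -> : (4 * Kb + 1) * a * c = 4 * (a * (Kb * c)) + a * c by ring.
  have -> : (2 : R) ^+ 2 * (a * b) = 4 * (a * b) by ring.
  lra.
have [L [C [C0 H]]] := total_energy_le al (divr_gt0 e0 M0).
exists L, (M * C); split; first by rewrite mulr_ge0// ltW.
move=> f hf; apply: (le_trans (ler_wpM2l (ltW M0) (H f hf))).
have aux (x y : R) : M * (e / M * x + C * y) = e * x + M * C * y.
  by clearbody M; field; rewrite gt_eqF.
by rewrite aux.
Qed.

End Form.

(** * The operator of a bounded sesquilinear form *)

Section CoefficientEstimates.
Context (R : realType).
Implicit Types (f g : R[i] -> R[i]).

Lemma conjcN1 : conjc (-1) = -1 :> R[i].
Proof. exact: (rmorphN1 (@conjc R)). Qed.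

Lemma fock_inner_sub f g h : l2f f -> l2f g -> l2f h ->
  fock_inner f (fun z => g z - h z) = fock_inner f g - fock_inner f h.
Proof.
move=> hf hg hh.
have -> : (fun z => g z - h z) = (fun z => -1 * h z + g z).
  by apply/funext => z; rewrite mulN1r addrC.
by rewrite fock_inner_linr// conjcN1 mulN1r addrC.
Qed.

(** The parallelogram identity, with the square of the sum dropped. *)
Lemma sqnorm_sub_le f g : l2f f -> l2f g -> sqnorm (fun z => f z - g z) <= 2 * sqnorm f + 2 *
  sqnorm g.
Proof.
move=> lf lg.
have E1 := sqnorm_lin (-1) lg lf; have E2 := sqnorm_lin 1 lg lf.
rewrite conjcN1 in E1; rewrite conjc1 in E2.
have P : sqnorm (fun z => -1 * g z + f z) + sqnorm (fun z => 1 * g z + f z) = 2 * sqnorm f +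
  2 * sqnorm g.
  apply: (@complexI R); rewrite rmorphD /= E1 E2 rmorphD !rmorphM /=.
  have -> : (2 : R)%:C = 2 by exact: (rmorph_nat (real_complex R) 2).
  ring.
have -> : (fun z => f z - g z) = (fun z => -1 * g z + f z).
  by apply/funext => z; rewrite mulN1r addrC.
by rewrite -P lerDl sqnorm_ge0.
Qed.

Lemma taylor_coef_sub f g j : l2f f -> l2f g ->
  taylor_coef (fun z => f z - g z) j = taylor_coef f j - taylor_coef g j.
Proof.
move=> lf lg; have lm := @l2f_monomial R j.
have -> : (fun z => f z - g z) = (fun z => -1 * g z + f z).
  by apply/funext => z; rewrite mulN1r addrC.
by rewrite /taylor_coef fock_inner_linl//; ring.
Qed.

Lemma taylor_coef_le f j : l2f f -> j`!%:R * cabs (taylor_coef f j) ^+ 2 <= sqnorm f.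
Proof.
move=> lf; apply: le_trans (bessel_le j.+1 lf); rewrite /coef_sqnorm big_ord_recr /= lerDr.
by apply: sumr_ge0 => i _; rewrite mulr_ge0// exprn_ge0// cabs_ge0.
Qed.

Lemma taylor_coef_tail (L : R) : 0 <= L -> exists2 Q : R, 0 <= Q & forall f i, l2f f ->
  cabs (taylor_coef f i) * L ^+ i <= Q * Num.sqrt (sqnorm f) * 2^-1 ^+ i.
Proof.
(* [(4 L^2)^i / i! <= expR (8 L^2)], where the factor [4^i] provides the square of the decay
   [2^-i]. *)
move=> L0; exists (Num.sqrt (expR (2 * (4 * L ^+ 2)))); first exact: sqrtr_ge0.
move=> f i lf; have h0 : 0 <= (2^-1 : R) ^+ i by rewrite exprn_ge0// invr_ge0.
have f0 : 0 < i`!%:R :> R by rewrite ltr0n fact_gt0.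
rewrite -[leLHS]ger0_norm ?mulr_ge0 ?cabs_ge0 ?exprn_ge0// -sqrtr_sqr.
have -> : (2^-1 : R) ^+ i = Num.sqrt ((2^-1 ^+ i) ^+ 2) by rewrite sqrtr_sqr ger0_norm.
rewrite -!sqrtrM ?mulr_ge0 ?expR_ge0 ?sqnorm_ge0//.
apply: ler_wsqrtr.
have -> : (cabs (taylor_coef f i) * L ^+ i) ^+ 2 =
    (i`!%:R * cabs (taylor_coef f i) ^+ 2) * ((4 * L ^+ 2) ^+ i / i`!%:R) * (2^-1 ^+ i) ^+ 2.
  have -> : (4 * L ^+ 2) ^+ i = (2 ^+ i) ^+ 2 * (L ^+ i) ^+ 2.
    by rewrite -exprMn -(exprMn i 2) -!exprM [(i * 2)%N]mulnC exprM exprMn;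
      congr ((_ * _) ^+ _); ring.
  rewrite exprVn; field; rewrite expf_neq0//= gt_eqF//.
rewrite ler_wpM2r ?exprn_ge0// mulrC; apply: ler_pM.
- by rewrite divr_ge0// exprn_ge0// mulr_ge0// exprn_ge0.
- by rewrite mulr_ge0// exprn_ge0// cabs_ge0.
- have r0 : 0 <= 4 * L ^+ 2 by rewrite mulr_ge0// exprn_ge0.
  apply: (le_trans (pow_fact_le i r0)).
  by rewrite ler_piMl ?expR_ge0// exprn_ile1 ?invr_ge0// invf_le1// ler1n.
- exact: taylor_coef_le.
Qed.

(** The tail is small uniformly over bounded sets of functions, so coefficientwise convergence of a
    bounded family implies uniform convergence on [|z| <= L]. *)
Lemma fock_value_le (L : R) : 0 <= L -> exists2 Q : R, 0 <= Q & forall f N z, fock f ->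
  cabs z <= L -> cabs (f z) <=
   \sum_(i < N) cabs (taylor_coef f i) * L ^+ i + Q * Num.sqrt (sqnorm f) * 2^-1 ^+ N.
Proof.
move=> L0; have [Q Q0 HQ] := taylor_coef_tail L0; exists (Q * 2); first by rewrite mulr_ge0.
move=> f N z hf zL; have lf := fock_l2f hf.
have cv : ccvg (fun n => partial_series (taylor_coef f) (N + n) z) (f z).
  rewrite [in X in ccvg _ X](fock_power_series hf) => e /(power_series_cvg z (taylor_coef_entire_coef lf)) [n _ Hn].
  by exists n => // m /= nm; apply: Hn => /=; rewrite (leq_trans nm)// leq_addl.
apply: (ccvg_le cv) => n.
rewrite /partial_series big_split_ord /= (le_trans (cabsD _ _))// lerD//.
  apply: (le_trans (cabs_sum _ _ _)); apply: ler_sum => i _.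
  by rewrite cabsM cabsX ler_wpM2l ?cabs_ge0// lerXn2r// ?nnegrE// cabs_ge0.
apply: (le_trans (cabs_sum _ _ _)).
apply: (@le_trans _ _ (\sum_(i < n) Q * Num.sqrt (sqnorm f) * 2^-1 ^+ N * 2^-1 ^+ i)).
  apply: ler_sum => i _; rewrite -mulrA -exprD; apply: le_trans (HQ f (N + i)%N lf).
  by rewrite cabsM cabsX ler_wpM2l ?cabs_ge0// lerXn2r// ?nnegrE// cabs_ge0.
rewrite -big_distrr /=.
have P : 0 <= Q * Num.sqrt (sqnorm f) * 2^-1 ^+ N.
  by rewrite mulr_ge0 ?exprn_ge0 ?invr_ge0// mulr_ge0// sqrtr_ge0.
apply: (le_trans (ler_wpM2l P (sum_half_le R n))).
by rewrite le_eqVlt; apply/orP; left; apply/eqP; ring.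
Qed.

Lemma local_energy_le_sup f (L S : R) : l2f f ->
  (forall z, cabs z < L -> cabs (f z) <= S) -> local_energy f 0 L <= S ^+ 2.
Proof.
move=> lf HS; rewrite -[leRHS]mulr1 -(Rint_gauss_density R) -RintegralZl//;
  last exact: rint_gauss_density.
apply: le_Rintegral => //; [exact: rint_local|by apply: rintZ; exact: rint_gauss_density|].
move=> p _; rewrite disk_indicE subr0; case: ifPn => h.
  rewrite mul1r ler_wpM2r ?gauss_density_ge0// lerXn2r// ?nnegrE ?cabs_ge0 ?HS//.
  exact: le_trans (cabs_ge0 _) (HS _ h).
by rewrite mul0r mulr_ge0 ?gauss_density_ge0// sqr_ge0.
Qed.

End CoefficientEstimates.

(** * Riesz representation and the operator of the form *)

Section FormOperator.
Context (R : realType) (F : (R[i] -> R[i]) -> (R[i] -> R[i]) -> R[i]).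
Hypothesis F_sesq : bounded_sesquilinear F.
Implicit Types (f g h : R[i] -> R[i]) (c : nat -> R[i]).

Lemma form_bound : exists2 M : R, 0 <= M & forall f g, fock f -> fock g ->
  cabs (F f g) <= M * fock_norm f * fock_norm g.
Proof.
have [_ _ [M HM]] := F_sesq; exists `|M| => // f g hf hg.
apply: (le_trans (HM f g hf hg)).
by rewrite ler_wpM2r ?fock_norm_ge0// ler_wpM2r ?fock_norm_ge0// ler_norm.
Qed.

Lemma form0r f : fock f -> F f (fun=> 0) = 0.
Proof.
move=> hf; have [_ Fr _] := F_sesq.
have := Fr 1 f _ _ hf (@fock0 R) (@fock0 R).
have -> : (fun z : R[i] => 1 * 0 + 0 : R[i]) = (fun=> 0).
  by apply/funext => z; rewrite mulr0 addr0.
rewrite conjc1 mul1r => /eqP; rewrite -subr_eq0 opprD addNKr oppr_eq0.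
by move=> /eqP.
Qed.

Lemma form_partial_series f c N : fock f ->
  F f (partial_series c N) = \sum_(i < N) conjc (c i) * F f (@monomial R i).
Proof.
move=> hf; have [_ Fr _] := F_sesq; elim: N => [|n ih].
  rewrite big_ord0 -(form0r hf); congr (F f _).
  by apply/funext => z; rewrite /partial_series big_ord0.
rewrite big_ord_recr /= -ih addrC -Fr//; [|exact: fock_monomial|exact: fock_partial_series].
by congr (F f _); apply/funext => z; rewrite /partial_series big_ord_recr /= addrC.
Qed.

Lemma form_sub f g h : fock f -> fock g -> fock h ->
  F f (fun z => g z - h z) = F f g - F f h.
Proof.
move=> hf hg hh; have [_ Fr _] := F_sesq.
have -> : (fun z => g z - h z) = (fun z => -1 * h z + g z).
  by apply/funext => z; rewrite mulN1r addrC.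
by rewrite Fr// conjcN1 mulN1r addrC.
Qed.

(** The representative is built from its coefficients [F f (z^n) / n!]. Testing [F f] on its [N]-th
    partial sum [S] gives [|S|^2 = F f S <= M |f| |S|], so the coefficients are those of a Fock
    function. The two functionals agree on polynomials, and by Parseval's identity everywhere. *)
Lemma riesz f : fock f -> exists2 h, fock h & forall g, fock g -> F f g = fock_inner h g.
Proof.
move=> hf; have [M M0 HM] := form_bound.
pose c n : R[i] := n`!%:R^-1 * F f (@monomial R n).
have FE n : F f (@monomial R n) = n`!%:R * c n.
  by rewrite /c mulrA mulfV ?fact_neq0// mul1r.
have wE N : (coef_sqnorm c N)%:C = F f (partial_series c N).
  rewrite form_partial_series// rmorph_sum; apply: eq_bigr => i _ /=.
  have -> : conjc (c i) * F f (@monomial R i) = i`!%:R * (c i * conjc (c i)).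
    by rewrite FE; ring.
  rewrite mulcJ rmorphM; congr (_ * _).
  exact: (rmorph_nat (real_complex R)).
have w0 N : 0 <= coef_sqnorm c N.
  by apply: sumr_ge0 => i _; rewrite mulr_ge0// exprn_ge0// cabs_ge0.
have wB N : coef_sqnorm c N <= (M * fock_norm f) ^+ 2.
  have := HM f _ hf (fock_partial_series c N).
  rewrite -wE.
  rewrite cabsR.
  rewrite (ger0_norm (w0 N)).
  rewrite (@fock_normE _ (partial_series c N));
    last exact: (fock_l2f (fock_partial_series c N)).
  rewrite sqnorm_partial_series; have := sqr_sqrtr (w0 N).
  have := sqrtr_ge0 (coef_sqnorm c N); set s := Num.sqrt _ => s0 <-.
  have [->|sn0] := eqVneq s 0; first by rewrite expr0n sqr_ge0.
  have sp : 0 < s by rewrite lt_neqAle eq_sym sn0.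
  rewrite expr2 ler_pM2r// => H; rewrite -expr2 lerXn2r// nnegrE//.
  by rewrite mulr_ge0// fock_norm_ge0.
have [hh _ fch] := power_series_fock wB; exists (power_series c) => // g hg.
have lh := fock_l2f hh; have lg := fock_l2f hg.
(* The sum of the continuity constants of the two functionals; the 2 is that of [cauchy_schwarz]. *)
pose K := M * fock_norm f + 2 * fock_norm (power_series c).
have K0 : 0 <= K by rewrite addr_ge0// mulr_ge0// fock_norm_ge0.
have PE N : F f (partial_series (taylor_coef g) N) =
  fock_inner (power_series c) (partial_series (taylor_coef g) N).
  rewrite form_partial_series// fock_inner_partial_series//; apply: eq_bigr => i _.
  by rewrite FE fock_inner_taylor_coef fch.
apply/eqP; rewrite -subr_eq0 -cabs_eq0 eq_le cabs_ge0 andbT.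
apply/ler_addgt0Pr => e e0; rewrite add0r.
have K10 : 0 < K + 1 by rewrite ltr_wpDl.
have d0 : 0 < (e / (K + 1)) ^+ 2 by rewrite exprn_gt0// divr_gt0.
have [N _ HN] := parseval hg d0.
have {HN} := HN N (leqnn N) => /= HN.
have hr := fock_sub hg (fock_partial_series (taylor_coef g) N).
pose r z := g z - partial_series (taylor_coef g) N z.
have nr : fock_norm r <= e / (K + 1).
  rewrite fock_normE; last exact: fock_l2f hr.
  rewrite -[leRHS]gtr0_norm ?divr_gt0// -sqrtr_sqr ler_wsqrtr//.
  exact: ltW.
have -> : F f g - fock_inner (power_series c) g = F f r - fock_inner (power_series c) r.
  rewrite form_sub//; last exact: fock_partial_series.
  rewrite fock_inner_sub//; last exact/fock_l2f/fock_partial_series.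
  by rewrite PE; ring.
apply: (le_trans (cabsB _ _)).
apply: (le_trans (lerD (HM f r hf hr) (cauchy_schwarz lh (fock_l2f hr)))).
rewrite mulrA -mulrDl -/K; apply: (le_trans (ler_wpM2l K0 nr)).
by rewrite mulrCA ler_piMr ?(ltW e0)// ler_pdivrMr// mul1r lerDl.
Qed.

(** The operator evaluates the form at kernels; by the reproducing formula, this evaluates the Riesz
    representative pointwise. *)
Lemma form_operatorP f : fock f -> fock (form_operator F f) /\
  forall g, fock g -> fock_inner (form_operator F f) g = F f g.
Proof.
move=> hf; have [h hh H] := riesz hf.
have -> : form_operator F f = h.
  apply/funext => z; rewrite /form_operator H; last exact: fock_kernelP.
  exact: fock_reproducing.
by split=> // g hg; rewrite H.
Qed.

Lemma form_operator_lin (b : R[i]) f1 f2 : fock f1 -> fock f2 ->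
  form_operator F (fun z => b * f1 z + f2 z) =
  (fun z => b * form_operator F f1 z + form_operator F f2 z).
Proof.
move=> h1 h2; have [Fl _ _] := F_sesq.
by apply/funext => z; rewrite /form_operator Fl//; exact: fock_kernelP.
Qed.

(** The bound is tested on [g = T f], for which the form is [|T f|^2], and one factor [|T f|] is
    cancelled. *)
Lemma form_operator_norm_le f (B : R) : fock f -> 0 <= B ->
  (forall g, fock g -> cabs (F f g) <= B * fock_norm g) ->
  fock_norm (form_operator F f) <= B.
Proof.
move=> hf B0 HB; have [hT HT] := form_operatorP hf.
set t := fock_norm _; have t0 : 0 <= t := fock_norm_ge0 _.
have := HB _ hT; rewrite -HT// fock_inner_norm cabsR ger0_norm ?sqnorm_ge0//.
rewrite -fock_norm_sqr; last exact: fock_l2f.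
rewrite -/t; have [->//|tn0] := eqVneq t 0.
by rewrite expr2 ler_pM2r// lt_neqAle eq_sym tn0.
Qed.

Lemma form_operator_bounded : bounded_operator (form_operator F).
Proof.
split; [by move=> f hf; case: (form_operatorP hf)|exact: form_operator_lin|].
have [M M0 HM] := form_bound; exists M => f hf.
apply: form_operator_norm_le => //; first by rewrite mulr_ge0// fock_norm_ge0.
by move=> g hg; exact: HM.
Qed.

End FormOperator.

Section UltrafilterLimit.
Context (R : realType) (U : set_system nat) (UU : UltraFilter U).

(** Compactness gives a cluster point. An ultrafilter contains the preimage of each of its
    neighbourhoods or the complement, and clustering rules out the complement. *)
Lemma ultra_cvg_real (w : nat -> R) (B : R) : (forall n, `|w n| <= B) ->
  exists l : R, w @ U --> l.
Proof.
move=> wB; have [|l [_ wl]] := @segment_compact R (- B) B (w @ U) _.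
  by apply: (@filterE _ U) => n /=; rewrite in_itv /= -ler_norml.
exists l; apply/cvgrPdist_lt => e e0.
have [//|Ue] := in_ultra_setVsetC [set n | `|l - w n| < e] UU.
have [|x [nx lx]] := wl [set x | ~ `|l - x| < e] (ball l e) _ (nbhsx_ballx l e e0).
  exact: Ue.
by case: nx; exact: lx.
Qed.

Lemma ultra_cvg_complex (w : nat -> R[i]) (B : R) : (forall n, cabs (w n) <= B) ->
  exists l : R[i], cabs (w n - l) @[n --> U] --> (0 : R).
Proof.
move=> wB.
have [a wa] := @ultra_cvg_real (fun n => Re (w n)) B
  (fun n => le_trans (Re_le_cabs _) (wB n)).
have [b wb] := @ultra_cvg_real (fun n => Im (w n)) B
  (fun n => le_trans (Im_le_cabs _) (wB n)).
exists (a +i* b); apply/cvgrPdist_le => e e0.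
have e20 : 0 < e / 2 by rewrite divr_gt0.
have /cvgrPdist_le /(_ _ e20) Ha := wa; have /cvgrPdist_le /(_ _ e20) Hb := wb.
near=> n; rewrite sub0r normrN ger0_norm ?cabs_ge0//.
apply: (le_trans (cabs_le_ReIm _)); rewrite cReB cImB [leRHS]splitr lerD//.
  by rewrite distrC; near: n.
by rewrite distrC; near: n.
Unshelve. all: by end_near. Qed.

Lemma cvg_cabs_le (w : nat -> R[i]) l : cabs (w n - l) @[n --> U] --> (0 : R) ->
  cabs (w n) @[n --> U] --> cabs l.
Proof.
move=> H; apply/cvgrPdist_le => e e0.
have /cvgrPdist_le /(_ _ e0) H' := H; near=> n.
apply: (@le_trans _ _ (cabs (w n - l))); last first.
  rewrite -[leLHS]ger0_norm ?cabs_ge0// -normrN -[- _]sub0r; near: n; exact: H'.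
rewrite ler_norml cabsBC cabs_sub andbT -cabsBC lerNl opprB.
exact: cabs_sub.
Unshelve. all: by end_near. Qed.

End UltrafilterLimit.

Section Compactness.
Context (R : realType) (F : (R[i] -> R[i]) -> (R[i] -> R[i]) -> R[i]).
Hypothesis F_sesq : bounded_sesquilinear F.
Variable J : (R[i] -> R[i]) -> R.
Hypothesis form_le : forall f g, fock f -> fock g ->
  cabs (F f g) <= Num.sqrt (J f) * fock_norm g.
Hypothesis J_local : forall e : R, 0 < e -> exists L C : R, 0 <= C /\
  forall f, fock f -> J f <= e * sqnorm f + C * local_energy f 0 L.

(** The assumptions express weak convergence to 0. It becomes uniform on the disk of radius [L],
    which makes the local term of [J_local] small; the other term is small by boundedness. *)
Lemma weakly_null_J (U : set_system nat) (UU : ProperFilter U)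
    (v : nat -> R[i] -> R[i]) (B e : R) :
  (forall n, fock (v n)) -> 0 <= B -> (forall n, sqnorm (v n) <= B) ->
  (forall j, cabs (taylor_coef (v n) j) @[n --> U] --> (0 : R)) ->
  0 < e -> \forall n \near U, J (v n) <= e.
Proof.
move=> hv B0 vB vj e0.
have e1 : 0 < e / (2 * (B + 1)) by rewrite divr_gt0// mulr_gt0// ltr_wpDl.
have [L [C [C0 HJ]]] := J_local e1.
(* Chosen so that [C S^2 <= e / 2]. Half of [S] bounds the first [N] coefficients, the other half
   the tail of the series. *)
pose S := Num.sqrt (e / (2 * (C + 1))).
have e2 : 0 < e / (2 * (C + 1)) by rewrite divr_gt0// mulr_gt0// ltr_wpDl.
have S0 : 0 < S by rewrite sqrtr_gt0.
have S20 : 0 < S / 2 by rewrite divr_gt0.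
have [Q Q0 HQ] := fock_value_le (normr_ge0 L).
pose K := Q * Num.sqrt B.
have K0 : 0 <= K by rewrite mulr_ge0// sqrtr_ge0.
have [N HN] : exists N, K * 2^-1 ^+ N <= S / 2.
  have : (fun n => K * 2^-1 ^+ n) @ \oo --> K * 0.
    by apply: cvgMr; apply: cvg_expr; rewrite ger0_norm ?invr_ge0// invf_lt1// ltr1n.
  rewrite mulr0 => /cvgrPdist_le /(_ _ S20) [N _ /(_ N (leqnn N)) /=].
  rewrite sub0r normrN ger0_norm; first by exists N.
  by rewrite mulr_ge0// exprn_ge0// invr_ge0.
have : (fun n => \sum_(i < N) cabs (taylor_coef (v n) i) * `|L| ^+ i) @ U -->
  \sum_(i < N) 0 * `|L| ^+ i.
  by apply: cvg_big => [|i _]; [exact: add_continuous|apply: cvgMl; exact: vj].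
rewrite big1 => [|i _]; last by rewrite mul0r.
move=> /cvgrPdist_le /(_ _ S20) Hs.
near=> n.
have Hn : \sum_(i < N) cabs (taylor_coef (v n) i) * `|L| ^+ i <= S / 2.
  apply: le_trans (ler_norm _) _; rewrite -normrN -sub0r; near: n; exact: Hs.
apply: (le_trans (HJ _ (hv n))); rewrite [leRHS]splitr; apply: lerD.
  apply: (@le_trans _ _ (e / (2 * (B + 1)) * (B + 1))).
    by rewrite ler_wpM2l ?(ltW e1)// (le_trans (vB n))// lerDl.
  by rewrite le_eqVlt; apply/orP; left; apply/eqP; field; rewrite gt_eqF// ltr_wpDl.
apply: (@le_trans _ _ ((C + 1) * S ^+ 2)).
  apply: ler_pM => //; [exact: local_energy_ge0|by rewrite lerDl|].
  apply: local_energy_le_sup; first exact/fock_l2f/hv.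
  move=> z zL; apply: (le_trans (HQ (v n) N z (hv n) _)).
    by rewrite (le_trans (ltW zL))// ler_norm.
  rewrite [leRHS]splitr lerD//; apply: le_trans HN.
  rewrite ler_wpM2r ?exprn_ge0 ?invr_ge0// ler_wpM2l//.
  by apply: ler_wsqrtr; exact: vB.
rewrite sqr_sqrtr ?(ltW e2)// le_eqVlt; apply/orP; left; apply/eqP.
by field; rewrite gt_eqF// ltr_wpDl.
Unshelve. all: by end_near. Qed.

Lemma form_operator_compact : compact_operator (form_operator F).
Proof.
split; first exact: form_operator_bounded.
move=> u hu [M HM].
have M0 : 0 <= M by exact: le_trans (fock_norm_ge0 _) (HM 0%N).
have uB n : sqnorm (u n) <= M ^+ 2.
  rewrite -fock_norm_sqr; last exact: fock_l2f.
  by rewrite lerXn2r// nnegrE// fock_norm_ge0.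
(* [oU] says that [U] contains every neighbourhood of infinity, hence its members have indices
   beyond any bound. *)
have [U [UU oU]] := ultraFilterLemma (@eventually_filter : ProperFilter (\oo : set_system nat)).
have fB j n : cabs (taylor_coef (u n) j) <= M.
  rewrite -(@ler_pXn2r _ 2)// ?nnegrE ?cabs_ge0//.
  apply: le_trans (uB n); apply: le_trans (taylor_coef_le j (fock_l2f (hu n))).
  by rewrite ler_peMl ?exprn_ge0 ?cabs_ge0// ler1n fact_gt0.
have /choice[l Hl] : forall j, exists lj : R[i],
    cabs (taylor_coef (u n) j - lj) @[n --> U] --> (0 : R).
  by move=> j; exact: (ultra_cvg_complex UU (fB j)).
(* Only finitely many coefficients occur, so Bessel's bound passes to the limit along [U], and [l]
   is the sequence of coefficients of a Fock function. *)
have lB N : coef_sqnorm l N <= M ^+ 2.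
  apply: (@cvgr_to_le _ U _ _ (fun n => coef_sqnorm (taylor_coef (u n)) N)).
    apply: cvg_big => [|i _]; first exact: add_continuous.
    apply: cvgMr; rewrite expr2; under eq_fun do rewrite expr2.
    by apply: cvgM; exact: (cvg_cabs_le UU (Hl i)).
  by apply: nearW => n; apply: le_trans (bessel_le N (fock_l2f (hu n))) (uB n).
have [hp pB fcp] := power_series_fock lB.
pose v n z := u n z - power_series l z.
have hv n : fock (v n) by exact: fock_sub.
have vB n : sqnorm (v n) <= 4 * M ^+ 2.
  apply: (le_trans (sqnorm_sub_le (fock_l2f (hu n)) (fock_l2f hp))).
  by have := uB n; lra.
have vj j : cabs (taylor_coef (v n) j) @[n --> U] --> (0 : R).
  suff -> : (fun n => cabs (taylor_coef (v n) j)) =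
    (fun n => cabs (taylor_coef (u n) j - l j)) by [].
  by apply/funext => n; rewrite taylor_coef_sub ?fcp//; exact: fock_l2f.
have B0 : 0 <= 4 * M ^+ 2 by rewrite mulr_ge0// sqr_ge0.
have TE n : (fun z => form_operator F (u n) z - form_operator F (power_series l) z) =
    form_operator F (v n).
  have -> : v n = (fun z => -1 * power_series l z + u n z).
    by apply/funext => z; rewrite mulN1r addrC.
  by rewrite form_operator_lin//; apply/funext => z; rewrite mulN1r addrC.
(* A member of [U] supplies an index beyond [m] at which [J] is at most [(k + 1)^-2]; the bound
   [sqrt J] on the norm is then [1 / (k + 1)]. *)
have step m k : exists n, (m < n)%N /\ fock_norm (form_operator F (v n)) <= k.+1%:R^-1.
  have d0 : 0 < (k.+1%:R^-1 : R) ^+ 2 by rewrite exprn_gt0// invr_gt0.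
  have H1 : \forall n \near U, J (v n) <= k.+1%:R^-1 ^+ 2.
    exact: weakly_null_J hv B0 vB vj d0.
  have H2 : \forall n \near U, (m < n)%N by apply: oU; exact: nbhs_infty_gt.
  have [n [Jn mn]] := filter_ex (filterI H1 H2).
  exists n; split=> //; apply: form_operator_norm_le => //.
  move=> g hg; apply: (le_trans (form_le (hv n) hg)).
  rewrite ler_wpM2r ?fock_norm_ge0// -[leRHS]ger0_norm ?invr_ge0// -sqrtr_sqr.
  exact: ler_wsqrtr.
have /choice[s Hs] : forall mk : nat * nat, exists n, (mk.1 < n)%N /\
    fock_norm (form_operator F (v n)) <= mk.2.+1%:R^-1 by move=> [m k]; exact: step.
pose phi := fix phi (k : nat) : nat := match k with 0 => s (0, 0)%N | k'.+1 => s (phi k',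
  k'.+1) end.
exists phi.
  by apply: homo_ltn => [y x z|i]; [exact: ltn_trans|case: (Hs (phi i, i.+1))].
exists (form_operator F (power_series l)); first by case: (form_operatorP F_sesq hp).
apply: (@squeeze_cvgr _ _ _ _ (fun=> 0) (@harmonic R)); last 2 first.
- exact: cvg_cst.
- exact: cvg_harmonic.
apply: nearW => k; rewrite fock_norm_ge0 TE /=.
by case: k => [|k] /=; [case: (Hs (0, 0)%N)|case: (Hs (phi k, k.+1))].
Qed.

End Compactness.

(** Integrals have default values and [form_operator] is defined for any [F]. The first three
    clauses therefore certify that the integrals converge and that the operator proved compact is
    the one which the form defines. *)
Theorem corollary6p3 (R : realType) (k : R) (mu : complex_measure R)
    (al be : nat) (k_ge0 : 0 <= k) (k_half : exists m : nat, k = m%:R / 2)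
    (mu_vanishing : vanishing_FC mu k) (al_be : (al + be)%:R = 2 * k) :
  [/\ forall f g : R[i] -> R[i], fock f -> fock g ->
        cm_integrable mu (FC_integrand al be f g),
      bounded_sesquilinear (FC_form mu al be),
      forall f g : R[i] -> R[i], fock f -> fock g ->
        fock_inner (form_operator (FC_form mu al be) f) g
          = FC_form mu al be f g &
      compact_operator (form_operator (FC_form mu al be))].
Proof.
have sesq := FC_form_sesquilinear k_ge0 mu_vanishing al_be.
have [J [form_le J_local]] := FC_form_compactness k_ge0 mu_vanishing al_be.
split=> //.
- by move=> f g; exact: (cm_integrable_FC k_ge0 mu_vanishing al_be).
- by move=> f g hf; have [_] := form_operatorP sesq hf; exact.
- exact: (form_operator_compact sesq form_le J_local).
Qed.
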